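(* Let $g\geq2$ be an integer and let $\theta\colon\pi_1\Sigma_g\rightarrow Q$ be a surjective homomorphism onto a finite solvable group $Q$ of odd order. Then there exist an integer $d \ge 1$ and a linear representation $\rho\colon\pi_1\Sigma_g\rightarrow\mathrm{GL}_d(\mathbb{Z})$ with infinite image such that every element of $\rho(\pi_1\Sigma_g\setminus\ker\theta)$ has finite order.
   Context: $\Sigma_g$ denotes the closed connected orientable surface of genus $g$. *)

(* Defs.v *)
From HB Require Import structures.
From Stdlib Require Import Relation_Operators Operators_Properties.
From mathcomp Require Export all_boot all_order all_algebra all_fingroup.
From mathcomp Require Export all_solvable generic_quotient.
From mathcomp Require Export all_classical all_reals all_analysis.
From mathcomp Require Export continuous_path.
From mathcomp Require Import lra.
Export numFieldNormedType.Exports.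

Set Implicit Arguments.
Unset Strict Implicit.
Unset Printing Implicit Defensive.

Import Order.TTheory GRing.Theory Num.Theory.

Local Open Scope classical_set_scope.
Local Open Scope ring_scope.
Local Open Scope quotient_scope.

Section UnitInterval.
Context (R : realType).

Definition unit_interval : Type := set_type (`[0, 1]%classic : set R).
HB.instance Definition _ :=
  Topological.copy unit_interval (set_type (`[0, 1]%classic : set R)).

Definition uval : unit_interval -> R := set_val.

Lemma clamp_subproof (t : R) :
  Num.max 0 (Num.min t 1) \in (`[0, 1]%classic : set R).
Proof.
by rewrite inE/= in_itv/= le_max lexx/= ge_max ler01/= ge_min lexx orbT.
Qed.

(* The nearest point of [0, 1]; the identity on [0, 1]. *)
Definition clamp (t : R) : unit_interval := 
  exist (fun x : R => x \in (`[0, 1]%classic : set R)) _ (clamp_subproof t).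

Lemma uval_itv s : 0 <= uval s <= 1.
Proof.
have : (`[0, 1]%classic : set R) (uval s) by exact: set_valP.
by rewrite /= in_itv.
Qed.

Lemma uval_ge0 s : 0 <= uval s.
Proof. by case/andP: (uval_itv s). Qed.

Lemma uval_le1 s : uval s <= 1.
Proof. by case/andP: (uval_itv s). Qed.

Lemma uval_clamp t : uval (clamp t) = Num.max 0 (Num.min t 1).
Proof. by []. Qed.

Lemma clampE t : 0 <= t <= 1 -> uval (clamp t) = t.
Proof.
by move=> /andP[t0 t1]; rewrite uval_clamp (min_idPl t1) (max_idPr t0).
Qed.

Lemma uval_inj : injective uval.
Proof. exact: val_inj. Qed.

Lemma uvalK : cancel uval clamp.
Proof. by move=> s; apply: uval_inj; rewrite clampE// uval_ge0 uval_le1. Qed.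

Lemma clamp01 : clamp 0 != clamp 1.
Proof.
apply/eqP => /(congr1 uval); rewrite !clampE ?lexx ?ler01// => /eqP.
by rewrite eq_sym oner_eq0.
Qed.

HB.instance Definition _ :=
  @isBiPointed.Build unit_interval (clamp 0) (clamp 1) clamp01.

Lemma uval0 : uval zero = 0.
Proof. by rewrite clampE// lexx ler01. Qed.

Lemma uval1 : uval one = 1.
Proof. by rewrite clampE// lexx ler01. Qed.

Lemma uval_continuous : continuous uval.
Proof. exact: initial_continuous. Qed.

Lemma clamp_continuous : continuous clamp.
Proof.
apply: continuous_comp_initial => t.
apply: (@continuous_max R R (cst 0) (fun t => Num.min t 1)).
  exact: cst_continuous.
by apply: (@continuous_min R R id (cst 1)); [exact: cvg_id|exact: cst_continuous].
Qed.

End UnitInterval.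

Section Homotopy.
Context (R : realType) (T : topologicalType).
Local Notation I := (unit_interval R).

Lemma if_le_continuous (X : topologicalType) (h : X -> R) (c : R)
    (f g : X -> T) :
  continuous h -> continuous f -> continuous g ->
  (forall x, h x = c -> f x = g x) ->
  continuous (fun x => if h x <= c then f x else g x).
Proof.
move=> ch cf cg fg; set k := fun x => _.
have /continuousP chP := ch.
have clA : closed [set x | h x <= c].
  rewrite (_ : [set x | h x <= c] = h @^-1` [set y | y <= c])//.
  by apply: preimage_closed => //; exact: closed_le.
have clB : closed [set x | c <= h x].
  rewrite (_ : [set x | c <= h x] = h @^-1` [set y | c <= y])//.
  by apply: preimage_closed => //; exact: closed_ge.
apply/continuous_subspace_setT.
rewrite (_ : setT = [set x | h x <= c] `|` [set x | c <= h x]); last first.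
  apply/esym/seteqP; split => x //= _.
  by case: (leP (h x) c) => [|/ltW]; [left|right].
apply: withinU_continuous => //.
- apply: (@subspace_eq_continuous _ _ _ f); last exact: continuous_subspaceT.
  by move=> x; rewrite inE/= => xc; rewrite /from_subspace /k xc.
- apply: (@subspace_eq_continuous _ _ _ g); last exact: continuous_subspaceT.
  move=> x; rewrite inE/= => cx; rewrite /from_subspace /k; case: ifPn => // xc.
  by apply/esym/fg/eqP; rewrite eq_le xc.
Qed.

(* Homotopy relative to the endpoints; the second coordinate is the time. *)
Definition homotopic (p q : I -> T) : Prop :=
  exists H : I * I -> T, [/\ continuous H,
    forall s, H (s, zero) = p s, forall s, H (s, one) = q s,
    forall t, H (zero, t) = p zero & forall t, H (one, t) = p one].

Lemma homotopic_ends (p q : I -> T) :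
  homotopic p q -> p zero = q zero /\ p one = q one.
Proof. by case=> H [_ H0 H1 Hz Ho]; rewrite -!H1 Hz Ho. Qed.

(* p followed by q, each at double speed. *)
Definition concat (p q : I -> T) (s : I) : T :=
  if uval s <= 2^-1 then p (clamp (2 * uval s))
  else q (clamp (2 * uval s - 1)).

Definition reverse (p : I -> T) (s : I) : T := p (clamp (1 - uval s)).



Lemma continuous_compose (X Y Z : topologicalType) (f : X -> Y) (g : Y -> Z) :
  continuous f -> continuous g -> continuous (fun x => g (f x)).
Proof. by move=> cf cg x; apply: continuous_comp; [exact: cf|exact: cg]. Qed.

Lemma continuous_pair (X Y Z : topologicalType) (f : X -> Y) (g : X -> Z) :
  continuous f -> continuous g -> continuous (fun x => (f x, g x)).
Proof. by move=> cf cg x; apply: cvg_pair; [exact: cf|exact: cg]. Qed.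

Lemma continuous_fst (X Y : topologicalType) : continuous (@fst X Y).
Proof. by move=> ?; exact: cvg_fst. Qed.

Lemma continuous_snd (X Y : topologicalType) : continuous (@snd X Y).
Proof. by move=> ?; exact: cvg_snd. Qed.

Lemma continuous_uval1 : continuous (fun z : I * I => uval z.1).
Proof.
exact: (continuous_compose (@continuous_fst _ _) (@uval_continuous R)).
Qed.

Lemma continuous_uval2 : continuous (fun z : I * I => uval z.2).
Proof.
exact: (continuous_compose (@continuous_snd _ _) (@uval_continuous R)).
Qed.

Lemma continuous_affine (X : topologicalType) (f : X -> R) (a b : R) :
  continuous f -> continuous (fun x => a * f x + b).
Proof.
move=> cf x; apply: cvgD; last exact: cvg_cst.
by apply: cvgM; [exact: cvg_cst|exact: cf].
Qed.

Lemma continuous_clamp (X : topologicalType) (f : X -> R) (a b : R) :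
  continuous f -> continuous (fun x => clamp (a * f x + b)).
Proof.
move=> cf; apply: continuous_compose; last exact: clamp_continuous.
exact: continuous_affine.
Qed.

Lemma homotopic_refl (p : I -> T) : continuous p -> homotopic p p.
Proof.
move=> cp; exists (fun z => p z.1); split => //.
exact: (continuous_compose (@continuous_fst _ _) cp).
Qed.

Lemma homotopic_sym (p q : I -> T) : homotopic p q -> homotopic q p.
Proof.
move=> pq; have [e0 e1] := homotopic_ends pq.
case: pq => H [cH H0 H1 Hz Ho].
exists (fun z => H (z.1, clamp (-1 * uval z.2 + 1))); split => /=.
- apply: (continuous_compose _ cH); apply: continuous_pair.
    exact: continuous_fst.
  by apply: continuous_clamp; exact: continuous_uval2.
- by move=> s; rewrite uval0 mulr0 add0r; exact: H1.
- by move=> s; rewrite uval1 mulr1 addNr; exact: H0.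
- by move=> t; rewrite Hz.
- by move=> t; rewrite Ho.
Qed.

Lemma half_eq (x : R) : x = 2^-1 -> 2 * x = 1.
Proof. by move->; rewrite divff. Qed.

Lemma homotopic_trans (p q r : I -> T) :
  homotopic p q -> homotopic q r -> homotopic p r.
Proof.
move=> pq qr; have [e0 e1] := homotopic_ends pq.
case: pq => H [cH H0 H1 Hz Ho]; case: qr => K [cK K0 K1 Kz Ko].
exists (fun z => if uval z.2 <= 2^-1 then H (z.1, clamp (2 * uval z.2 + 0))
                 else K (z.1, clamp (2 * uval z.2 + -1))); split => /=.
- apply: if_le_continuous.
  + exact: continuous_uval2.
  + apply: (continuous_compose _ cH); apply: continuous_pair.
      exact: continuous_fst.
    by apply: continuous_clamp; exact: continuous_uval2.
  + apply: (continuous_compose _ cK); apply: continuous_pair.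
      exact: continuous_fst.
    by apply: continuous_clamp; exact: continuous_uval2.
  + by case=> s t /= /half_eq ->; rewrite addr0 subrr [LHS]H1 [RHS]K0.
- by move=> s; rewrite uval0 invr_ge0 ler0n mulr0 addr0; exact: H0.
- move=> s; rewrite uval1 ifF; last by apply/negbTE; rewrite -ltNge; lra.
  by rewrite mulr1 (_ : 2 + -1 = 1); [exact: K1|lra].
- by move=> t; case: ifP => _; rewrite ?Hz ?Kz.
- by move=> t; case: ifP => _; rewrite ?Ho ?Ko.
Qed.

Lemma concatE (p q : I -> T) s : concat p q s =
  if uval s <= 2^-1 then p (clamp (2 * uval s + 0))
  else q (clamp (2 * uval s + -1)).
Proof. by rewrite /concat addr0. Qed.

Lemma concat0 (p q : I -> T) : concat p q zero = p zero.
Proof. by rewrite /concat uval0 invr_ge0 ler0n mulr0. Qed.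

Lemma concat1 (p q : I -> T) : concat p q one = q one.
Proof.
rewrite /concat uval1 ifF; last by apply/negbTE; rewrite -ltNge; lra.
by rewrite mulr1 (_ : 2 - 1 = 1)//; lra.
Qed.

Lemma concat_continuous (p q : I -> T) : continuous p -> continuous q ->
  p one = q zero -> continuous (concat p q).
Proof.
move=> cp cq pq; rewrite (funext (concatE p q)).
apply: if_le_continuous.
- exact: uval_continuous.
- apply: (continuous_compose _ cp); apply: continuous_clamp.
  exact: uval_continuous.
- apply: (continuous_compose _ cq); apply: continuous_clamp.
  exact: uval_continuous.
- by move=> s /half_eq ->; rewrite addr0 subrr.
Qed.

Lemma concat_homotopic (p p' q q' : I -> T) : p one = q zero ->
  homotopic p p' -> homotopic q q' ->
  homotopic (concat p q) (concat p' q').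
Proof.
move=> pq [H [cH H0 H1 Hz Ho]] [K [cK K0 K1 Kz Ko]].
exists (fun z => if uval z.1 <= 2^-1 then H (clamp (2 * uval z.1 + 0), z.2)
                 else K (clamp (2 * uval z.1 + -1), z.2)); split => /=.
- apply: if_le_continuous.
  + exact: continuous_uval1.
  + apply: (continuous_compose _ cH); apply: continuous_pair.
      by apply: continuous_clamp; exact: continuous_uval1.
    exact: continuous_snd.
  + apply: (continuous_compose _ cK); apply: continuous_pair.
      by apply: continuous_clamp; exact: continuous_uval1.
    exact: continuous_snd.
  + by case=> s t /= /half_eq ->; rewrite addr0 subrr [LHS]Ho [RHS]Kz.
- by move=> s; rewrite concatE; case: ifP => _.
- by move=> s; rewrite concatE; case: ifP => _.
- by move=> t; rewrite uval0 invr_ge0 ler0n mulr0 addr0 [LHS]Hz concat0.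
- move=> t; rewrite uval1 ifF; last by apply/negbTE; rewrite -ltNge; lra.
  by rewrite mulr1 (_ : 2 + -1 = 1) ?[LHS]Ko ?concat1//; lra.
Qed.

Lemma reverse0 (p : I -> T) : reverse p zero = p one.
Proof. by rewrite /reverse uval0 subr0. Qed.

Lemma reverse1 (p : I -> T) : reverse p one = p zero.
Proof. by rewrite /reverse uval1 subrr. Qed.

Lemma reverseE (p : I -> T) s : reverse p s = p (clamp (-1 * uval s + 1)).
Proof. by rewrite /reverse mulN1r addrC. Qed.

Lemma reverse_continuous (p : I -> T) : continuous p -> continuous (reverse p).
Proof.
move=> cp; rewrite (funext (reverseE p)).
apply: (continuous_compose _ cp); apply: continuous_clamp.
exact: uval_continuous.
Qed.

Lemma reverseK (p : I -> T) : reverse (reverse p) = p.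
Proof.
apply/funext => s; rewrite /reverse clampE; last first.
  by have /andP[s0 s1] := uval_itv s; apply/andP; split; lra.
by rewrite opprB addrC subrK uvalK.
Qed.

Lemma reverse_homotopic (p q : I -> T) :
  homotopic p q -> homotopic (reverse p) (reverse q).
Proof.
move=> [H [cH H0 H1 Hz Ho]].
exists (fun z => H (clamp (-1 * uval z.1 + 1), z.2)); split => /=.
- apply: (continuous_compose _ cH); apply: continuous_pair.
    by apply: continuous_clamp; exact: continuous_uval1.
  exact: continuous_snd.
- by move=> s; rewrite reverseE.
- by move=> s; rewrite reverseE.
- by move=> t; rewrite uval0 mulr0 add0r reverse0 [LHS]Ho.
- by move=> t; rewrite uval1 mulr1 addNr reverse1 [LHS]Hz.
Qed.

Lemma reparam_homotopic (p : I -> T) (f g : I -> R) :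
  continuous p -> continuous f -> continuous g ->
  f zero = g zero -> f one = g one ->
  homotopic (fun s => p (clamp (f s))) (fun s => p (clamp (g s))).
Proof.
move=> cp cf cg fg0 fg1.
exists (fun z => p (clamp (f z.1 + uval z.2 * (g z.1 - f z.1)))); split => /=.
- apply: (continuous_compose _ cp).
  apply: continuous_compose; last exact: clamp_continuous.
  have cf1 : continuous (fun z : I * I => f z.1).
    exact: (continuous_compose (@continuous_fst _ _) cf).
  have cg1 : continuous (fun z : I * I => g z.1).
    exact: (continuous_compose (@continuous_fst _ _) cg).
  move=> z; apply: cvgD; first exact: cf1.
  apply: cvgM; first exact: continuous_uval2.
  by apply: cvgB; [exact: cg1|exact: cf1].
- by move=> s; rewrite uval0 mul0r addr0.
- by move=> s; rewrite uval1 mul1r addrC subrK.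
- by move=> t; rewrite fg0 subrr mulr0 addr0.
- by move=> t; rewrite fg1 subrr mulr0 addr0.
Qed.

Lemma reparam_uval (p : I -> T) (m : I -> T) (f : I -> R) :
  continuous p -> continuous f -> f zero = 0 -> f one = 1 ->
  (forall s, m s = p (clamp (f s))) -> homotopic m p.
Proof.
move=> cp cf f0 f1 mE; rewrite (funext mE) [X in homotopic _ X](_ : p =
  (fun s => p (clamp (uval s)))); last by apply/funext => s; rewrite uvalK.
by apply: reparam_homotopic; rewrite ?f0 ?f1 ?uval0 ?uval1//;
  exact: uval_continuous.
Qed.

Lemma concat_l (p q : I -> T) t :
  0 <= t <= 2^-1 -> concat p q (clamp t) = p (clamp (2 * t)).
Proof.
by move=> /andP[t0 t1]; rewrite /concat clampE ?t1//; apply/andP; split; lra.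
Qed.

Lemma concat_r (p q : I -> T) t :
  2^-1 < t <= 1 -> concat p q (clamp t) = q (clamp (2 * t - 1)).
Proof.
move=> /andP[t0 t1]; rewrite /concat clampE; last by apply/andP; split; lra.
by rewrite leNgt t0.
Qed.

Lemma concatA_homotopic (p q r : I -> T) :
  continuous p -> continuous q -> continuous r ->
  p one = q zero -> q one = r zero ->
  homotopic (concat (concat p q) r) (concat p (concat q r)).
Proof.
move=> cp cq cr pq qr.
apply: (@reparam_uval _ _ (fun s => Num.min (2 * uval s + 0)
  (Num.min (1 * uval s + 4^-1) (2^-1 * uval s + 2^-1)))).
- apply: concat_continuous => //; first exact: concat_continuous.
  by rewrite concat0.
- have cu a b := @continuous_affine _ _ a b (@uval_continuous R).
  move=> x; apply: (@continuous_min R I); first exact: cu.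
  by apply: (@continuous_min R I); exact: cu.
- rewrite uval0 !mulr0 !add0r; apply/min_idPl.
  by rewrite le_min !invr_ge0 !ler0n.
- have h : (2^-1 * 1 + 2^-1 : R) = 1 by lra.
  rewrite uval1 h [X in Num.min _ X]min_r; last lra.
  by rewrite min_r//; lra.
move=> s; rewrite -[in LHS](uvalK s); have := uval_itv s.
move: (uval s) => t /andP[t0 t1].
have [t2|t2] := leP t 2^-1; last first.
  rewrite concat_r ?t2// (min_r (x := 2 * t + 0)); last first.
    by rewrite ge_min; apply/orP; right; lra.
  rewrite min_r; last lra.
  rewrite concat_r; last by apply/andP; split; lra.
  rewrite (_ : 2 * (2^-1 * t + 2^-1) - 1 = t); last by lra.
  by rewrite concat_r ?t2.
rewrite concat_l ?t0//; have [t4|t4] := leP t 4^-1.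
  rewrite min_l; last by rewrite le_min; apply/andP; split; lra.
  rewrite addr0 !concat_l//; last by apply/andP; split; lra.
  by apply/andP; split; lra.
rewrite concat_r; last by apply/andP; split; lra.
rewrite min_r; last by rewrite ge_min; apply/orP; left; lra.
rewrite min_l; last lra.
rewrite concat_r; last by apply/andP; split; lra.
rewrite concat_l; last by apply/andP; split; lra.
by congr (q (clamp _)); lra.
Qed.

Lemma concat1p_homotopic (p : I -> T) :
  continuous p -> homotopic (concat (cst (p zero)) p) p.
Proof.
move=> cp; apply: (@reparam_uval _ _ (fun s => Num.max 0 (2 * uval s + -1))) => //.
- move=> x; apply: (@continuous_max R I (cst 0)); first exact: cst_continuous.
  exact: (continuous_affine (@uval_continuous R)).
- by rewrite uval0; apply/max_idPl; lra.
- by rewrite uval1 max_r; lra.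
move=> s; rewrite concatE; case: leP => s2.
  by rewrite (max_idPl _)//; lra.
by rewrite (max_idPr _)//; lra.
Qed.

Lemma concatp1_homotopic (p : I -> T) :
  continuous p -> homotopic (concat p (cst (p one))) p.
Proof.
move=> cp; apply: (@reparam_uval _ _ (fun s => Num.min (2 * uval s + 0) 1)) => //.
- move=> x; apply: (@continuous_min R I _ (cst 1)); last exact: cst_continuous.
  exact: (continuous_affine (@uval_continuous R)).
- by rewrite uval0 min_l; lra.
- by rewrite uval1; apply/min_idPr; lra.
move=> s; rewrite concatE; case: leP => s2.
  by rewrite (min_idPl _)//; lra.
by rewrite (min_idPr _)//; lra.
Qed.

Lemma concatpV_homotopic (p : I -> T) :
  continuous p -> homotopic (concat p (reverse p)) (cst (p zero)).
Proof.
move=> cp; rewrite (_ : concat _ _ = (fun s : I =>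
  p (clamp (Num.min (2 * uval s + 0) ((-2) * uval s + 2))))); last first.
  apply/funext => s; rewrite concatE; have /andP[s0 s1] := uval_itv s.
  case: leP => s2; first by rewrite (min_idPl _)//; lra.
  rewrite (min_idPr _); last lra.
  rewrite /reverse clampE; last by apply/andP; split; lra.
  by congr (p (clamp _)); lra.
apply: (@reparam_homotopic _ _ (cst 0)) => //.
- have cu a b := @continuous_affine _ _ a b (@uval_continuous R).
  by move=> x; apply: (@continuous_min R I); exact: cu.
- exact: cst_continuous.
- by rewrite uval0 min_l /=; lra.
- by rewrite uval1 min_r /=; lra.
Qed.

End Homotopy.

Section FundamentalGroup.
Context (R : realType) (T : topologicalType) (x0 : T).
Local Notation I := (unit_interval R).
Local Notation loop := ({path I from x0 to x0}).

Lemma loop_continuous (p : loop) : continuous p.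
Proof. exact: cts_fun. Qed.

Lemma loop01 (p q : loop) : p one = q zero.
Proof. by rewrite path_one path_zero. Qed.

Definition loop_concat (p q : loop) : loop :=
  mk_path (concat_continuous (@loop_continuous p) (@loop_continuous q)
             (loop01 p q))
    (etrans (concat0 p q) path_zero) (etrans (concat1 p q) path_one).

Definition loop_reverse (p : loop) : loop :=
  mk_path (reverse_continuous (@loop_continuous p))
    (etrans (reverse0 p) path_one) (etrans (reverse1 p) path_zero).

Definition loop_cst : loop := cst x0.

Definition loop_homotopic (p q : loop) : bool := `[< homotopic p q >].

Lemma loop_homotopic_refl : reflexive loop_homotopic.
Proof. by move=> p; apply/asboolP/homotopic_refl/loop_continuous. Qed.

Lemma loop_homotopic_sym : symmetric loop_homotopic.
Proof.
by move=> p q; apply/asboolP/asboolP; exact: homotopic_sym.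
Qed.

Lemma loop_homotopic_trans : transitive loop_homotopic.
Proof.
move=> q p r /asboolP pq /asboolP qr; apply/asboolP.
exact: homotopic_trans pq qr.
Qed.

Canonical loop_homotopic_equiv := EquivRel loop_homotopic
  loop_homotopic_refl loop_homotopic_sym loop_homotopic_trans.

Definition fundamental_group : Type := {eq_quot loop_homotopic_equiv}.
HB.instance Definition _ := Quotient.on fundamental_group.
HB.instance Definition _ := Choice.on fundamental_group.

Local Notation pi1 := fundamental_group.

Lemma pi1_eqP (p q : loop) : \pi_pi1 p = \pi_pi1 q <-> homotopic p q.
Proof. by split=> [/eqmodP/asboolP//|pq]; apply/eqmodP/asboolP. Qed.

Lemma pi1_repr (p : loop) : homotopic (repr (\pi_pi1 p)) p.
Proof. by apply/pi1_eqP; rewrite reprK. Qed.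

Definition pi1_mul (a b : pi1) : pi1 := \pi_pi1 (loop_concat (repr a) (repr b)).
Definition pi1_inv (a : pi1) : pi1 := \pi_pi1 (loop_reverse (repr a)).
Definition pi1_one : pi1 := \pi_pi1 loop_cst.

Lemma pi1_mulE (p q : loop) :
  pi1_mul (\pi_pi1 p) (\pi_pi1 q) = \pi_pi1 (loop_concat p q).
Proof.
apply/pi1_eqP; apply: concat_homotopic; first exact: loop01.
- exact: pi1_repr.
- exact: pi1_repr.
Qed.

Lemma pi1_invE (p : loop) : pi1_inv (\pi_pi1 p) = \pi_pi1 (loop_reverse p).
Proof. by apply/pi1_eqP; apply: reverse_homotopic; exact: pi1_repr. Qed.

Lemma pi1_mulA : associative pi1_mul.
Proof.
elim/quotW=> a; elim/quotW=> b; elim/quotW=> c.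
rewrite (pi1_mulE b c) (pi1_mulE a b) (pi1_mulE a) (pi1_mulE _ c).
apply/esym/pi1_eqP; apply: concatA_homotopic;
  by [exact: loop_continuous|exact: loop01].
Qed.

Lemma pi1_mul1 : left_id pi1_one pi1_mul.
Proof.
elim/quotW=> a; rewrite pi1_mulE; apply/pi1_eqP.
have := @concat1p_homotopic R T a (@loop_continuous _).
by rewrite path_zero.
Qed.

Lemma pi1_mulr1 : right_id pi1_one pi1_mul.
Proof.
elim/quotW=> a; rewrite pi1_mulE; apply/pi1_eqP.
have := @concatp1_homotopic R T a (@loop_continuous _).
by rewrite path_one.
Qed.

Lemma pi1_mulrV : right_inverse pi1_one pi1_inv pi1_mul.
Proof.
elim/quotW=> a; rewrite pi1_invE pi1_mulE; apply/pi1_eqP.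
have := @concatpV_homotopic R T a (@loop_continuous _).
by rewrite path_zero.
Qed.

Lemma pi1_mulV : left_inverse pi1_one pi1_inv pi1_mul.
Proof.
elim/quotW=> a; rewrite pi1_invE pi1_mulE; apply/pi1_eqP.
have := @concatpV_homotopic R T (loop_reverse a) (@loop_continuous _).
by rewrite path_zero /= /mk_path reverseK.
Qed.

HB.instance Definition _ := isGroup.Build fundamental_group
  pi1_mulA pi1_mul1 pi1_mulr1 pi1_mulV pi1_mulrV.

End FundamentalGroup.

Section ClosedSurface.
Context (R : realType) (g : nat).

Definition closed_disc : set (R * R) := [set z | z.1 ^+ 2 + z.2 ^+ 2 <= 1].

(* The boundary circle is cut into 4g arcs of equal length: the i-th one is
   boundary_point @` `[i, i + 1], for 0 <= i < 4g. *)
Definition boundary_point (t : R) : R * R :=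
  (cos (2 * pi * t / (4 * g)%:R), sin (2 * pi * t / (4 * g)%:R)).

(* The arcs 4k, 4k + 1, 4k + 2, 4k + 3 carry, counterclockwise, the labels
   a_k, b_k, a_k^-1, b_k^-1: the disc is a 4g-gon with boundary word
   [a_0, b_0] ... [a_(g-1), b_(g-1)], and arcs with the same label are glued
   according to their orientations. *)
Definition side_pairing (z w : closed_disc) : Prop :=
  exists (k : nat) (s : R), [/\ (k < g)%N, 0 <= s <= 1 &
    (set_val z = boundary_point ((4 * k)%:R + s) /\
     set_val w = boundary_point ((4 * k + 3)%:R - s)) \/
    (set_val z = boundary_point ((4 * k + 1)%:R + s) /\
     set_val w = boundary_point ((4 * k + 4)%:R - s))].

Definition glued (z w : closed_disc) : bool :=
  `[< clos_refl_sym_trans _ side_pairing z w >].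

Lemma glued_refl : reflexive glued.
Proof. by move=> z; apply/asboolP; exact: rst_refl. Qed.

Lemma glued_sym : symmetric glued.
Proof. by move=> z w; apply/asboolP/asboolP; exact: rst_sym. Qed.

Lemma glued_trans : transitive glued.
Proof.
move=> w z u /asboolP zw /asboolP wu; apply/asboolP; exact: rst_trans zw wu.
Qed.

Canonical glued_equiv := EquivRel glued glued_refl glued_sym glued_trans.

(* The closed connected orientable surface of genus g, for g >= 1 (nothing is
   glued when g = 0, which leaves a disc instead of a sphere). *)
Definition closed_surface : Type := quotient_topology {eq_quot glued_equiv}.
HB.instance Definition _ :=
  Topological.copy closed_surface (quotient_topology {eq_quot glued_equiv}).
HB.instance Definition _ :=
  Quotient.copy closed_surface (quotient_topology {eq_quot glued_equiv}).

End ClosedSurface.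

(* Main.v *)
(* The polygon presents the fundamental group by a_k, b_k with the single relator
   prod [a_k, b_k]. Loops are products of the a_k, b_k because each chart of the
   surface contracts in polar coordinates; a solution of the relator in a group G
   defines a flat bundle on the surface, whose holonomy is the homomorphism to G.

   The relator is used through wreath products: a solution modulo a defect can be
   corrected whenever the total defect over the points of a transitive action is
   zero. Fix a prime p dividing #|Q|. The map from the preimage of <q> to Z/p,
   for q of order p, lifts in this way to an integral cocycle on the cosets. These
   cocycles, divided by a power of p and reduced, define on a normal subgroup of
   finite index a map psi to a field with p^N elements which does not vanish on
   suitable powers of the elements mapped to order p. It lifts to unitriangular
   matrices with superdiagonal (psi, psi^p, psi^(p^2), ...), one diagonal at a time,
   since shrinking the subgroup by an index divisible by p kills the obstruction.
   The N-th power of such a matrix is 1 + Norm(psi) E, a power of a central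
   element z of order p. Hence the group acts on a finite set commuting with a
   permutation z of order p, and for theta c of order p a power of c acts at each
   point as a nontrivial power of z. In the image of 1 - z, the sum over a cycle
   of z vanishes.

   Combining the primes, let op be the product of the operators 1 - z: an affine
   action with translations in the range of op over such permutations makes every
   element outside ker theta torsion. Some generator maps outside ker theta; give
   translations (op f, op f') to another pair a_k, b_k and none to the other
   generators. The relator is one linear condition on the pair (f, f'), hence has a
   solution with (op f, op f') nonzero. If the image were finite, the sum of the
   translations of its elements would be invariant under that generator, hence
   zero, and so would be all translations. *)

From HB Require Import structures.
From Stdlib Require Import Relation_Operators Operators_Properties.
From mathcomp Require Import all_field zify ring lra.
Require Import Defs.

Set Implicit Arguments.
Unset Strict Implicit.
Unset Printing Implicit Defensive.

Import Order.TTheory GRing.Theory Num.Theory.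

(** * Surface groups and wreath products *)


Section SurfaceGenerators.
Local Open Scope group_scope.

(** The obstacle is that every element outside the kernel must become torsion, so some power of it
    has to move every point of one finite set in a controlled way. A character psi of a finite index
    subgroup, induced up, takes different values at different points, and none of them may be 0.
    Hence the coefficient field: the cocycles attached to the elements of order [p] of [Q] get
    coefficients independent over the prime field, so that they cannot cancel. The norm then turns
    an arbitrary nonzero value into a nonzero element of the prime field, that is, into a power of
    one permutation [z]. Being a product of N Frobenius conjugates, the norm appears as the corner
    entry of the N-th power of a nilpotent matrix; N is a power of [p] so that (1 + X)^N = 1 + X^N.
    Shrinking the subgroup must not make psi vanish on the powers that are tested. So psi is fixed
    on the first subgroup, and the later ones are cut out by an auxiliary homomorphism to an
    integral wreath product, nontrivial on a commutator that the coset cocycles do not see. *)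

Definition is_hom (G H : groupType) (f : G -> H) : Prop :=
  forall x y, f (x * y) = f x * f y.

Fixpoint relator (G : groupType) (g : nat) (a b : nat -> G) : G :=
  if g is k.+1 then relator k a b * (a k * b k * (a k)^-1 * (b k)^-1) else 1.

Lemma hom1 (G H : groupType) (f : G -> H) : is_hom f -> f 1 = 1.
Proof. by move=> hf; apply: (mulgI (f 1)); rewrite -hf !mulg1. Qed.

Lemma homV (G H : groupType) (f : G -> H) : is_hom f -> forall x, f x^-1 = (f x)^-1.
Proof.
by move=> hf x; apply: (mulgI (f x)); rewrite -hf !mulgV hom1.
Qed.

Lemma homX (G H : groupType) (f : G -> H) : is_hom f ->
  forall x n, f (x ^+ n) = f x ^+ n.
Proof.
by move=> hf x; elim=> [|n IH]; rewrite ?expg0 ?hom1// !expgS hf IH.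
Qed.

Lemma hom_relator (G H : groupType) (f : G -> H) : is_hom f ->
  forall n a b, f (relator n a b) = relator n (f \o a) (f \o b).
Proof.
move=> hf; elim=> [|n IH] a b /=; first by rewrite (hom1 hf).
by rewrite !hf !(homV hf) IH.
Qed.

Lemma eq_relator (G : groupType) n (a b a' b' : nat -> G) :
  (forall k, k < n -> a k = a' k /\ b k = b' k)%N ->
  relator n a b = relator n a' b'.
Proof.
elim: n => [//|n IH] E /=; have [-> ->] := E n (leqnn _).
by rewrite IH// => k kn; apply: E; exact: ltnW.
Qed.

Definition upd (G : Type) (f : nat -> G) (k : nat) (v : G) : nat -> G :=
  fun i => if i == k then v else f i.

(** [u] and [v] are the prefixes of the relator that end just before [a k] and just after its
    inverse: there [z] and [z^-1] are inserted, and both are conjugated to the front. *)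
Lemma relator_updl (G : groupType) n k (a b : nat -> G) z : (k < n)%N ->
  let u := relator k a b in let v := u * (a k * b k * (a k)^-1) in
  relator n (upd a k (z * a k)) b =
    (u * z * u^-1) * (v * z^-1 * v^-1) * relator n a b.
Proof.
move=> + u v; elim: n => [//|n IH]; rewrite ltnS leq_eqVlt => /orP[/eqP kn|kn] /=.
  rewrite -kn /upd eqxx.
  rewrite (@eq_relator _ k _ _ a b); last first.
    by move=> i ik; rewrite ifN// neq_ltn ik.
  by rewrite /v -/u !invgM !mulgA !invgK !(mulgKV, mulgK).
by rewrite IH// /upd ifN ?gtn_eqF// !mulgA.
Qed.

(** The inverse of [b k] is the last letter of its commutator, so the second prefix is the whole of
    [relator k.+1]. *)
Lemma relator_updr (G : groupType) n k (a b : nat -> G) z : (k < n)%N ->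
  let u := relator k a b * a k in let v := relator k.+1 a b in
  relator n a (upd b k (z * b k)) =
    (u * z * u^-1) * (v * z^-1 * v^-1) * relator n a b.
Proof.
move=> + u v; elim: n => [//|n IH]; rewrite ltnS leq_eqVlt => /orP[/eqP kn|kn] /=.
  rewrite -kn /upd eqxx.
  rewrite (@eq_relator _ k a _ a b); last first.
    by move=> i ik; rewrite ifN// neq_ltn ik.
  by rewrite /v /u /= !invgM !mulgA !invgK !(mulgKV, mulgK).
by rewrite IH// /upd ifN ?gtn_eqF// !mulgA.
Qed.

Definition generates (G : groupType) (g : nat) (a b : nat -> G) : Prop :=
  forall P : G -> Prop, (forall k, (k < g)%N -> P (a k) /\ P (b k)) -> P 1 ->
    (forall x y, P x -> P y -> P (x * y)) -> (forall x, P x -> P x^-1) ->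
  forall x, P x.

(** All that the algebra retains of the surface; uniqueness of the homomorphism comes from
    [generates]. *)
Definition presents (G : groupType) (g : nat) (a b : nat -> G) : Prop :=
  [/\ relator g a b = 1, generates g a b &
   forall (H : groupType) (c d : nat -> H), relator g c d = 1 ->
     exists f : G -> H,
       is_hom f /\ forall k, (k < g)%N -> f (a k) = c k /\ f (b k) = d k].

Lemma eq_hom (G H : groupType) g (a b : nat -> G) (f f' : G -> H) :
  generates g a b -> is_hom f -> is_hom f' ->
  (forall k, (k < g)%N -> f (a k) = f' (a k) /\ f (b k) = f' (b k)) -> f =1 f'.
Proof.
move=> gen hf hf' E; apply: gen => //.
- by rewrite !hom1.
- by move=> x y Ex Ey; rewrite hf hf' Ex Ey.
- by move=> x Ex; rewrite !homV// Ex.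
Qed.

(* These elements are the deck transformations relating the two occurrences
   of a generator in the relator. *)
Lemma generates_dual (G : groupType) g (a b : nat -> G) (D : G -> Prop) :
  generates g a b -> D 1 ->
  (forall x y, D x -> D y -> D (x * y)) -> (forall x, D x -> D x^-1) ->
  (forall k, (k < g)%N -> let u := relator k a b in
    D (u * (u * (a k * b k * (a k)^-1))^-1) /\
    D (u * a k * (relator k.+1 a b)^-1)) ->
  forall x, D x.
Proof.
move=> gen D1 DM DV Dk; apply: gen => //.
suff H n : (n <= g)%N ->
    D (relator n a b) /\ forall k, (k < n)%N -> D (a k) /\ D (b k).
  by have [] := H g (leqnn _).
elim: n => [//|n IH] ng; have [Du DI] := IH (ltnW ng).
have [] := Dk n ng; set u := relator n a b; rewrite /= -/u => F1 F2.
(* As the prefix [u] is already in [D], conjugating by it frees the two given elements of it; [a n]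
   and then [b n] are recovered from the resulting words. *)
have E1 : D (a n * b n * (a n)^-1).
  have := DV _ (DM _ _ (DM _ _ (DV _ Du) F1) Du).
  by rewrite /u !invgM !invgK !mulgA !(mulgKV, mulgK, mulVg, mul1g).
have E2 : D (a n * b n * a n * (b n)^-1 * (a n)^-1).
  have := DM _ _ (DM _ _ (DV _ Du) F2) Du.
  by rewrite /u !invgM !invgK !mulgA !(mulgKV, mulgK, mulVg, mul1g).
have Da : D (a n).
  have := DM _ _ (DM _ _ (DV _ E1) E2) E1.
  by rewrite !invgM !invgK !mulgA !(mulgKV, mulgK).
have Db : D (b n).
  have := DM _ _ (DM _ _ (DV _ Da) E1) Da.
  by rewrite !mulgA !(mulgKV, mulgK, mulVg, mul1g).
split=> [|k].
  by apply: (DM _ _ Du (DM _ _ (DM _ _ (DM _ _ Da Db) (DV _ Da)) (DV _ Db))).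
by rewrite ltnS leq_eqVlt => /orP[/eqP ->//|]; exact: DI.
Qed.

End SurfaceGenerators.

Section Wreath.
Local Open Scope group_scope.
Context (G : groupType) (X : finType).

Definition wreath : Type := ({ffun X -> G} * {perm X})%type.
HB.instance Definition _ :=
  Choice.copy wreath ({ffun X -> G} * {perm X})%type.

Definition wreath_one : wreath := ([ffun=> 1], 1).
(** Permutations act on the right, so the first component of a homomorphism to [wreath] is a cocycle
    over its permutation action. *)
Definition wreath_mul (p q : wreath) : wreath :=
  ([ffun x => p.1 x * q.1 (p.2 x)], p.2 * q.2).
Definition wreath_inv (p : wreath) : wreath :=
  ([ffun x => (p.1 (p.2^-1 x))^-1], p.2^-1).

Lemma wreath_mulA : associative wreath_mul.
Proof.
move=> p q r; congr pair; last exact: mulgA.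
by apply/ffunP => x; rewrite !ffunE /= !permM mulgA.
Qed.

Lemma wreath_mul1 : left_id wreath_one wreath_mul.
Proof.
move=> [p s]; congr pair; last exact: mul1g.
by apply/ffunP => x; rewrite !ffunE /= perm1 mul1g.
Qed.

Lemma wreath_mulr1 : right_id wreath_one wreath_mul.
Proof.
move=> [p s]; congr pair; last exact: mulg1.
by apply/ffunP => x; rewrite !ffunE /= mulg1.
Qed.

Lemma wreath_mulV : left_inverse wreath_one wreath_inv wreath_mul.
Proof.
move=> [p s]; congr pair; last exact: mulVg.
by apply/ffunP => x; rewrite !ffunE /= mulVg.
Qed.

Lemma wreath_mulrV : right_inverse wreath_one wreath_inv wreath_mul.
Proof.
move=> [p s]; congr pair; last exact: mulgV.
by apply/ffunP => x; rewrite !ffunE /= permK mulgV.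
Qed.

HB.instance Definition _ := isGroup.Build wreath
  wreath_mulA wreath_mul1 wreath_mulr1 wreath_mulV wreath_mulrV.

Lemma wreathM1 (p q : wreath) x : (p * q).1 x = p.1 x * q.1 (p.2 x).
Proof. by rewrite ffunE. Qed.

Lemma wreathM2 (p q : wreath) : (p * q).2 = p.2 * q.2.
Proof. by []. Qed.

Lemma wreathV1 (p : wreath) x : (p^-1).1 x = (p.1 (p.2^-1 x))^-1.
Proof. by rewrite ffunE. Qed.

Lemma wreathV2 (p : wreath) : (p^-1).2 = (p.2)^-1.
Proof. by []. Qed.

Lemma wreath11 x : (1 : wreath).1 x = 1.
Proof. by rewrite ffunE. Qed.

Lemma wreathP (p q : wreath) : p.1 =1 q.1 -> p.2 = q.2 -> p = q.
Proof. by case: p q => [f s] [h t] /= /ffunP -> ->. Qed.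

Lemma wreath_eq1 (p q : wreath) x : p = q -> p.1 x = q.1 x.
Proof. by move->. Qed.

Lemma wreath_snd_hom : is_hom (fun p : wreath => p.2 : {perm X}).
Proof. by []. Qed.

Definition wr (f : X -> G) (s : {perm X}) : wreath := ([ffun x => f x], s).

End Wreath.

(** * Correcting a defective solution of the relator *)

Section MassTransport.
Local Open Scope group_scope.
Context (Gam : groupType) (g : nat) (a b : nat -> Gam).
Hypothesis gen : generates g a b.
Context (X : finType) (Pi : Gam -> {perm X}).
Hypothesis Pi_hom : is_hom Pi.
Hypothesis Pi_trans : forall x y, exists c, Pi c x = y.
Context (G : groupType) (M : G -> Prop) (V : zmodType) (chi : G -> V).
Hypotheses (M1 : M 1) (MM : forall m n, M m -> M n -> M (m * n))
  (MV : forall m, M m -> M m^-1) (MJ : forall h m, M m -> M (h * m * h^-1)).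
Hypothesis chiM : forall m n, M m -> M n -> chi (m * n) = (chi m + chi n)%R.
Hypothesis chiJ : forall h m, M m -> chi (h * m * h^-1) = chi m.

Definition lift_gens (al : nat -> X -> G) (c : nat -> Gam) (k : nat) :
  wreath G X := wr (al k) (Pi (c k)).

(** When the relator holds in [Gam] the permutation part is trivial, and the function measures the
    obstruction to extending the lifts to a homomorphism. *)
Definition defect (al be : nat -> X -> G) : wreath G X :=
  relator g (lift_gens al a) (lift_gens be b).

Definition congM (al al' : nat -> X -> G) : Prop :=
  forall k x, M (al' k x * (al k x)^-1).

Lemma congM_refl al : congM al al.
Proof. by move=> k x; rewrite mulgV. Qed.

Lemma congM_trans al1 al2 al3 : congM al1 al2 -> congM al2 al3 -> congM al1 al3.
Proof.
move=> h1 h2 k x; have := MM (h2 k x) (h1 k x).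
by rewrite mulgA mulgKV.
Qed.

Lemma wreathJ1 (p : wreath G X) f x :
  (p * wr f 1 * p^-1).1 x = p.1 x * f (p.2 x) * (p.1 x)^-1.
Proof.
have E : (p * wr f 1).2 = p.2 by rewrite wreathM2 mulg1.
by rewrite wreathM1 wreathV1 E permK wreathM1 ffunE.
Qed.

Lemma wreathJ2 (p : wreath G X) f : (p * wr f 1 * p^-1).2 = 1.
Proof. by rewrite !wreathM2 wreathV2 /= mulg1 mulgV. Qed.

Lemma wr1V f : (wr f 1 : wreath G X)^-1 = wr (fun x => (f x)^-1) 1.
Proof.
apply: wreathP => [x|]; last by rewrite wreathV2 invg1.
by rewrite wreathV1 !ffunE invg1 perm1.
Qed.

Let pt (y : X) (m : G) (x : X) : G := if x == y then m else 1.

Lemma chi1 : chi 1 = 0%R.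
Proof.
by apply/(addrI (chi 1)); rewrite -chiM// mulg1 addr0.
Qed.

Lemma chiV m : M m -> chi m^-1 = (- chi m)%R.
Proof.
move=> Mm; apply/eqP; rewrite -addr_eq0; apply/eqP.
by rewrite -chiM ?mulVg ?chi1//; exact: MV.
Qed.

Lemma M_pt y m x : M m -> M (pt y m x).
Proof. by rewrite /pt; case: ifP. Qed.

(** Inserting [m] over the point [y] contributes at the two points that the prefixes carry to [y],
    with opposite signs; [chi] ignores the conjugations. *)
Lemma pair_conj (u v : wreath G X) (R : wreath G X) y m x : M m -> M (R.1 x) ->
  let R' := (u * wr (pt y m) 1 * u^-1) * (v * (wr (pt y m) 1)^-1 * v^-1) * R in
  M (R'.1 x) /\ chi (R'.1 x) =
    (chi (R.1 x) + chi m *+ (u.2 x == y) - chi m *+ (v.2 x == y))%R.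
Proof.
move=> Mm MR R'; rewrite /R' wr1V wreathM1 wreathM1 wreathJ1 wreathJ2 perm1.
rewrite wreathJ1 wreathM2 !wreathJ2 mulg1 perm1.
have Mu := MJ (u.1 x) (M_pt y (u.2 x) Mm).
have Mv := MJ (v.1 x) (MV (M_pt y (v.2 x) Mm)).
split; first by do 2?apply: MM.
rewrite (chiM (MM Mu Mv) MR) (chiM Mu Mv) !chiJ ?chiV//; try exact: M_pt; last exact/MV/M_pt.
rewrite addrC addrA /pt; congr (_ + _ - _)%R; by case: ifP; rewrite ?chi1.
Qed.

Let mv (f : X -> V) (x y : X) (e : V) : X -> V :=
  fun z => (f z + e *+ (z == x) - e *+ (z == y))%R.

Section Attainable.
Variables al be : nat -> X -> G.

Definition attainable (f : X -> V) : Prop :=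
  exists al' be', [/\ congM al al', congM be be' &
    forall x, M ((defect al' be').1 x) /\ chi ((defect al' be').1 x) = f x].

(* Changing the lift of a generator by m in M changes the defect by m at one
   point and by m^-1 at another; only the total of chi cannot be changed. *)
Definition movable (c : Gam) : Prop :=
  forall f x m, M m -> attainable f -> attainable (mv f x (Pi c x) (chi m)).

Lemma movable1 : movable 1.
Proof.
move=> f x m _ [al' [be' [h1 h2 h3]]]; exists al', be'; split=> // z.
have [? ->] := h3 z; split=> //; rewrite /mv (hom1 Pi_hom) perm1.
by rewrite addrK.
Qed.

Lemma movableM c d : movable c -> movable d -> movable (c * d).
Proof.
move=> hc hd f x m Mm Of; have := hd _ (Pi c x) m Mm (hc f x m Mm Of).
congr attainable; apply/funext => z; rewrite /mv Pi_hom permM.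
by rewrite subrK.
Qed.

Lemma movableV c : movable c -> movable c^-1.
Proof.
move=> hc f x m Mm Of.
have := hc f (Pi c^-1 x) m^-1 (MV Mm) Of.
congr attainable; apply/funext => z; rewrite /mv (homV Pi_hom) permKV chiV//.
by rewrite !mulNrn opprK addrAC.
Qed.

Lemma relator_snd n al' be' :
  (relator n (lift_gens al' a) (lift_gens be' b)).2 = Pi (relator n a b).
Proof.
rewrite (hom_relator Pi_hom).
exact: (hom_relator (@wreath_snd_hom G X)).
Qed.

Lemma movable_all c : movable c.
Proof.
move: c; apply: (generates_dual gen); [exact: movable1|exact: movableM|
  exact: movableV|].
move=> k kg u; split=> f x m Mm [al' [be' [h1 h2 h3]]].
- set v := u * (a k * b k * (a k)^-1).
  (* [m] is inserted over [Pi u x], which the prefix [u] reaches from [x] and the prefix [v] from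
     [Pi (u * v^-1) x]: these are the two points of the move. *)
  exists (upd al' k (fun x' => pt (Pi u x) m x' * al' k x')), be'.
  split=> //.
  + apply: (congM_trans h1) => i z; rewrite /upd.
    by case: eqP => [->|_]; rewrite ?mulgK ?mulgV//; exact: M_pt.
  + have -> : defect (upd al' k (fun x' => pt (Pi u x) m x' * al' k x')) be' =
      relator g (upd (lift_gens al' a) k
        (wr (pt (Pi u x) m) 1 * lift_gens al' a k)) (lift_gens be' b).
      apply: eq_relator => i ig; split=> //; rewrite /lift_gens /upd.
      case: eqP => // ->; apply: wreathP => [z|]; last by rewrite wreathM2 mul1g.
      by rewrite wreathM1 !ffunE perm1.
    rewrite relator_updl// => z; have [Mz fz] := h3 z.
    have [P1 P2] := pair_conj
      (relator k (lift_gens al' a) (lift_gens be' b))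
      (relator k (lift_gens al' a) (lift_gens be' b) *
         (lift_gens al' a k * lift_gens be' b k * (lift_gens al' a k)^-1))
      (Pi u x) Mm Mz.
    split; [exact: P1|rewrite P2 /mv -fz].
    have -> : (relator k (lift_gens al' a) (lift_gens be' b)).2 = Pi u.
      by rewrite relator_snd.
    have -> : (relator k (lift_gens al' a) (lift_gens be' b) *
         (lift_gens al' a k * lift_gens be' b k * (lift_gens al' a k)^-1)).2
         = Pi v.
      rewrite /v !wreathM2 wreathV2 !Pi_hom (homV Pi_hom).
      by rewrite relator_snd.
    rewrite (inj_eq perm_inj); congr (_ - _ *+ (nat_of_bool _))%R.
    rewrite Pi_hom permM (homV Pi_hom).
    by rewrite -[RHS](inj_eq (@perm_inj _ (Pi v))) permKV.
- set v := relator k.+1 a b; pose w := u * a k.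
  exists al', (upd be' k (fun x' => pt (Pi w x) m x' * be' k x')).
  split=> //.
  + apply: (congM_trans h2) => i z; rewrite /upd.
    by case: eqP => [->|_]; rewrite ?mulgK ?mulgV//; exact: M_pt.
  + have -> : defect al' (upd be' k (fun x' => pt (Pi w x) m x' * be' k x')) =
      relator g (lift_gens al' a) (upd (lift_gens be' b) k
        (wr (pt (Pi w x) m) 1 * lift_gens be' b k)).
      apply: eq_relator => i ig; split=> //; rewrite /lift_gens /upd.
      case: eqP => // ->; apply: wreathP => [z|]; last by rewrite wreathM2 mul1g.
      by rewrite wreathM1 !ffunE perm1.
    rewrite relator_updr// => z; have [Mz fz] := h3 z.
    have [P1 P2] := pair_conj
      (relator k (lift_gens al' a) (lift_gens be' b) * lift_gens al' a k)
      (relator k.+1 (lift_gens al' a) (lift_gens be' b))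
      (Pi w x) Mm Mz.
    split; [exact: P1|rewrite P2 /mv -fz].
    have -> : (relator k (lift_gens al' a) (lift_gens be' b) *
               lift_gens al' a k).2 = Pi w.
      by rewrite /w wreathM2 Pi_hom relator_snd.
    rewrite relator_snd.
    rewrite (inj_eq perm_inj); congr (_ - _ *+ (nat_of_bool _))%R.
    rewrite Pi_hom permM (homV Pi_hom).
    by rewrite -[RHS](inj_eq (@perm_inj _ (Pi v))) permKV.
Qed.

(** By transitivity all the mass can be carried to one point [x0]; what arrives there is the total,
    which is 0. *)
Lemma mass_transport :
  (forall x, M ((defect al be).1 x)) ->
  (\sum_x chi ((defect al be).1 x) = 0)%R ->
  exists al' be', [/\ congM al al', congM be be' &
    forall x, M ((defect al' be').1 x) /\ chi ((defect al' be').1 x) = 0%R].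
Proof.
move=> MR sum0; pose f x := chi ((defect al be).1 x).
have [x0|X0] := pickP (fun _ : X => true); last first.
  exists al, be; split; try exact: congM_refl.
  by move=> x; have := X0 x.
move=> _; have Of : attainable f.
  by exists al, be; split=> //; exact: congM_refl.
have H (s : seq X) : attainable (fun z =>
    f z - \sum_(x <- s) f x *+ (z == x) + (\sum_(x <- s) f x) *+ (z == x0))%R.
  elim: s => [|x s IH].
    move: Of; congr attainable; apply/funext => z.
    by rewrite !big_nil subr0 mul0rn addr0.
  have [c cx] := Pi_trans x x0.
  have := movable_all c x (MV (MR x)) IH.
  congr attainable; apply/funext => z; rewrite /mv cx !big_cons chiV//.
  rewrite !mulNrn opprK mulrnDl opprD !addrA -/(f x).
  rewrite -!addrA; congr (_ + _)%R.
  rewrite [RHS]addrCA; congr (_ + _)%R.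
  by rewrite [RHS]addrCA [RHS]addrC -!addrA addrCA.
have [al' [be' [h1 h2 h3]]] := H (index_enum X).
exists al', be'; split=> // x; have [? ->] := h3 x; split=> //.
rewrite sum0 mul0rn addr0 (bigD1 x)//= eqxx mulr1n big1 ?addr0 ?subrr// => y yx.
by rewrite eq_sym (negPf yx).
Qed.

End Attainable.
End MassTransport.

Section AdditiveGroup.
Variable V : zmodType.

Definition addg : Type := V.
HB.instance Definition _ := Choice.copy addg V.
HB.instance Definition _ := isGroup.Build addg
  (@addrA V) (@add0r V) (@addr0 V) (@addNr V) (@addrN V).

Lemma addgM (x y : addg) : (x * y)%g = (x + y : V)%R. Proof. by []. Qed.
Lemma addgV (x : addg) : (x^-1)%g = (- x : V)%R. Proof. by []. Qed.
Lemma addgX (x : addg) n : (x ^+ n)%g = ((x : V) *+ n)%R.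
Proof. by elim: n => [|n IH]; rewrite ?mulr0n// expgS IH mulrS. Qed.

End AdditiveGroup.

Section Homs.
Local Open Scope group_scope.

Lemma relator_abelian (G : groupType) n (a b : nat -> G) :
  (forall x y : G, x * y = y * x) -> relator n a b = 1.
Proof.
move=> C; elim: n => [//|n IH] /=.
by rewrite IH mul1g (C (a n)) mulgK mulgV.
Qed.

Lemma relator_b1 (G : groupType) n (a : nat -> G) :
  relator n a (fun=> 1) = 1.
Proof.
by elim: n => [//|n IH] /=; rewrite IH mul1g invg1 !mulg1 mulgV.
Qed.

Lemma hom_comp (G H K : groupType) (f : G -> H) (h : H -> K) :
  is_hom f -> is_hom h -> is_hom (h \o f).
Proof. by move=> hf hh x y; rewrite /= hf hh. Qed.

Section WreathMap.
Context (G H : groupType) (X : finType) (e : G -> H).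
Definition wreath_map (w : wreath G X) : wreath H X := wr (e \o w.1) w.2.
Lemma wreath_map_hom : is_hom e -> is_hom wreath_map.
Proof.
move=> he p q; apply: wreathP => // x.
by rewrite wreathM1 !ffunE /= wreathM1 he.
Qed.
End WreathMap.

Section Induced.
Context (Gam H : groupType) (X : finType) (Pi : Gam -> {perm X}).
Context (L : Gam -> Prop) (psi : Gam -> H) (sec : X -> Gam).
Hypothesis Pi_hom : is_hom Pi.
Hypothesis psiM : forall x y, L x -> L y -> psi (x * y) = psi x * psi y.
Hypothesis secL : forall x c, L (sec x * c * (sec (Pi c x))^-1).

(** The Kaloujnine-Krasner map: [psi] is evaluated on the Schreier elements of the section [sec],
    which lie in [L], where [psi] is multiplicative. *)
Definition induced (c : Gam) : wreath H X :=
  wr (fun x => psi (sec x * c * (sec (Pi c x))^-1)) (Pi c).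

Lemma induced_hom : is_hom induced.
Proof.
move=> c d; apply: wreathP => [x|]; last by rewrite wreathM2 /= Pi_hom.
rewrite wreathM1 !ffunE -psiM// Pi_hom permM; congr psi.
by rewrite !mulgA mulgKV.
Qed.
End Induced.

Lemma wreath_prod_hom (V : zmodType) (X : finType) :
  is_hom (fun w : wreath (addg V) X => (\sum_x (w.1 x : V))%R : addg V).
Proof.
move=> p q; rewrite addgM [X in (_ + X)%R](reindex_inj (@perm_inj _ p.2)) /=.
by rewrite -big_split; apply: eq_bigr => x _; rewrite wreathM1 addgM.
Qed.

Lemma fix_wreathX (G : groupType) (X : finType) (w : wreath G X) x n :
  w.2 x = x -> (w ^+ n).1 x = w.1 x ^+ n /\ (w ^+ n).2 x = x.
Proof.
move=> wx; elim: n => [|n [IH1 IH2]]; first by rewrite wreath11 perm1.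
by rewrite !expgS wreathM1 wreathM2 permM wx IH1.
Qed.

End Homs.

Section PowZ.
Local Open Scope group_scope.
Context (Q : finGroupType) (q : Q).

Definition powz (n : addg int) : Q := q ^+ `|modz n #[q]|%N.

Lemma powz_nat (n : nat) : powz (Posz n) = q ^+ n.
Proof. by rewrite /powz modz_nat absz_nat expg_mod_order. Qed.

Lemma modz_natP (n : int) : exists2 k : nat, modz n #[q] = k &
  exists m : int, n = (m * Posz #[q] + Posz k)%R.
Proof.
exists `|modz n #[q]|%N.
  by rewrite gez0_abs// modz_ge0// gt_eqF// ltz_nat order_gt0.
exists (divz n #[q]); rewrite gez0_abs; first exact: divz_eq.
by rewrite modz_ge0// gt_eqF// ltz_nat order_gt0.
Qed.

Lemma powz_hom : is_hom powz.
Proof.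
move=> m n; rewrite addgM {1}/powz -modzDm.
have [i im _] := modz_natP m; have [j jn _] := modz_natP n.
rewrite /powz im jn -PoszD modz_nat !absz_nat expg_mod_order.
by rewrite expgnDr.
Qed.

Lemma powz_eq1 n : (powz n == 1) = (#[q] %| n)%Z.
Proof.
rewrite /powz -order_dvdn; have [i im [m nE]] := modz_natP n.
by rewrite im absz_nat nE rpredDl ?dvdz_mull.
Qed.

End PowZ.

(** * Integral cocycles on the cosets of a cyclic subgroup *)

Section CosetLift.
Local Open Scope group_scope.
Context (Gam : groupType) (g : nat) (a b : nat -> Gam).
Hypothesis pres : presents g a b.
Context (Q : finGroupType) (theta : Gam -> Q).
Hypotheses (theta_hom : is_hom theta) (theta_surj : forall x, exists c, theta c = x).
Variable q : Q.

Definition cosets_of : finType := {A : {set Q} | A \in rcosets <[q]> [set: Q]%SET}.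

Lemma cosetR_subproof (c : Q) (A : cosets_of) :
  val A :* c \in rcosets <[q]> [set: Q]%SET.
Proof.
case: A => A /= /rcosetsP[y _ ->]; apply/rcosetsP; exists (y * c) => //.
by rewrite rcosetM.
Qed.

Definition cosetR (c : Q) (A : cosets_of) : cosets_of :=
  exist _ (val A :* c) (cosetR_subproof c A).

Lemma cosetR_inj c : injective (cosetR c).
Proof. by move=> A B /(congr1 val) /= /rcoset_inj /val_inj. Qed.

Definition coset_perm (c : Gam) : {perm cosets_of} :=
  perm (@cosetR_inj (theta c)).

Lemma coset_perm_hom : is_hom coset_perm.
Proof.
move=> c d; apply/permP => A; rewrite permM !permE; apply: val_inj => /=.
by rewrite theta_hom rcosetM.
Qed.

Lemma repr_coset (A : cosets_of) : <[q]> :* fingroup.repr (val A) = val A.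
Proof. by case: A => A /= /rcosetsP[y _ ->]; rewrite rcoset_repr. Qed.

Lemma coset_perm_trans A B : exists c, coset_perm c A = B.
Proof.
have [c cE] := theta_surj ((fingroup.repr (val A))^-1 * fingroup.repr (val B)).
exists c; rewrite permE; apply: val_inj; rewrite /= cE -{1}[sval A]repr_coset.
by rewrite -rcosetM mulKVg repr_coset.
Qed.

Lemma coset_trans_cycle (A : cosets_of) c :
  fingroup.repr (val A) * theta c * (fingroup.repr (val (coset_perm c A)))^-1 \in <[q]>.
Proof.
rewrite -mem_rcoset repr_coset permE /= -{2}[sval A]repr_coset.
by rewrite -rcosetM mem_rcoset mulgV group1.
Qed.

(** The induced map with values in [<[q]>] is lifted to integers by arbitrary logarithms. The defect
    is divisible by the order of [q], and its total is 0 because summing over the points is a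
    homomorphism to an abelian group. The point [x0] is the coset of 1. *)
Lemma coset_lift : exists (X : finType) (x0 : X)
    (eta : Gam -> wreath (addg int) X), [/\ is_hom eta,
  forall c, theta c = 1 -> (eta c).2 = 1 /\
    forall x, (#[q] %| ((eta c).1 x : int))%Z &
  forall c, theta c = q -> (eta c).2 x0 = x0 /\
    (#[q] %| ((eta c).1 x0 - 1 : int)%R)%Z].
Proof.
have [rel gen univ] := pres.
pose X := cosets_of; have [sec secE] := choice (fun A : X => theta_surj (fingroup.repr (val A))).
pose L c := theta c \in <[q]>.
have secL (x : X) c : L (sec x * c * (sec (coset_perm c x))^-1).
  by rewrite /L !theta_hom (homV theta_hom) !secE coset_trans_cycle.
pose ind := induced coset_perm theta sec.
have ind_hom : is_hom ind.
  by apply: (@induced_hom _ _ _ _ L) => //; exact: coset_perm_hom.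
have [lg lgE] : exists lg : Q -> int, forall x, x \in <[q]> -> powz q (lg x) = x.
  have H x : exists n : int, x \in <[q]> -> powz q n = x.
    case: (boolP (x \in <[q]>)) => [/cycleP[i ->]|_]; last by exists 0%R.
    by exists (Posz i); rewrite powz_nat.
  by have [lg ?] := choice H; exists lg.
pose al (s : nat -> Gam) (k : nat) (x : X) : addg int := lg ((ind (s k)).1 x).
have alE s k : wreath_map (powz q) (wr (al s k) (coset_perm (s k))) = ind (s k).
  apply: wreathP => // x; rewrite !ffunE /= ffunE /al lgE ?ffunE//.
  exact: secL.
have pz_hom := wreath_map_hom (X := X) (powz_hom q).
pose M (n : addg int) : Prop := (#[q] %| (n : int))%Z.
have [||||||||al' [be' [hal hbe h]]] := @mass_transport Gam g a b gen X coset_perm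
   coset_perm_hom coset_perm_trans (addg int) M int id _ _ _ _ _ _ (al a) (al b).
- exact: dvdz0.
- by move=> m n; exact: rpredD.
- by move=> m; rewrite /M addgV rpredN.
- by move=> c m; rewrite /M !addgM addgV addrAC subrr add0r.
- by [].
- by move=> c m _; rewrite !addgM addgV addrAC subrr add0r.
- move=> x; rewrite /M -powz_eq1; apply/eqP.
  have := hom_relator pz_hom g (lift_gens coset_perm (al a) a)
    (lift_gens coset_perm (al b) b).
  rewrite (@eq_relator _ _ _ _ (ind \o a) (ind \o b)); last first.
    by move=> k _; split; exact: alE.
  rewrite -(hom_relator ind_hom) rel (hom1 ind_hom).
  by move=> /(wreath_eq1 x); rewrite wreath11 ffunE.
- rewrite (hom_relator (@wreath_prod_hom int X)).
  by rewrite relator_abelian// => x y; rewrite !addgM addrC.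
have dE : relator g (lift_gens coset_perm al' a) (lift_gens coset_perm be' b) = 1.
  apply: wreathP => [x|]; first by rewrite wreath11; exact: (h x).2.
  by rewrite relator_snd ?rel ?(hom1 coset_perm_hom)//; exact: coset_perm_hom.
have [eta [eta_hom etaE]] := univ _ _ _ dE.
have redE : forall c, wreath_map (powz q) (eta c) = ind c.
  apply: (eq_hom gen) => //; first exact: hom_comp eta_hom pz_hom.
  have red s (al1 : nat -> X -> addg int) k : congM M (al s) al1 ->
      wreath_map (powz q) (lift_gens coset_perm al1 s k) = ind (s k).
    move=> cg; rewrite -alE; apply: wreathP => // x; rewrite !ffunE /= !ffunE.
    have := cg k x; rewrite /M -powz_eq1 powz_hom (homV (powz_hom q)).
    by move/eqP/divg1_eq.
  by move=> k kg; rewrite /=; have [-> ->] := etaE k kg; split; exact: red.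
have eta2 c : (eta c).2 = coset_perm c.
  by have [] := redE c.
have eta1 c x : powz q ((eta c).1 x) =
    fingroup.repr (val x) * theta c * (fingroup.repr (val (coset_perm c x)))^-1.
  have /(wreath_eq1 x) := redE c; rewrite !ffunE /= => ->.
  by rewrite !theta_hom (homV theta_hom) !secE.
have HT : <[q]> :* 1 \in rcosets <[q]> [set: Q]%SET.
  by apply/rcosetsP; exists 1.
pose x0 : X := exist (fun A : {set Q} => is_true (A \in rcosets <[q]> [set: Q]%SET)) _ HT.
exists X, x0, eta; split=> // c tc.
- have cp1 : coset_perm c = 1.
    by apply/permP => A; rewrite permE perm1; apply: val_inj; rewrite /= tc rcoset1.
  split=> [|x]; first by rewrite eta2.
  by rewrite -powz_eq1 eta1 cp1 perm1 tc mulg1 mulgV.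
have cp0 : coset_perm c x0 = x0.
  rewrite permE; apply: val_inj; rewrite /= tc -rcosetM mul1g rcoset1.
  by rewrite rcoset_id// cycle_id.
split; first by rewrite eta2.
(* The chosen representative of the trivial coset need not be 1, but it is a power of [q] and so
   cancels by commutativity. *)
have r0 : fingroup.repr (val x0) \in <[q]>.
  by have := mem_repr 1 (rcoset_refl <[q]>%G 1); rewrite {2}rcoset1.
have := powz_hom q ((eta c).1 x0) (-1 : int)%R.
rewrite addgM -[_ = _]/(powz q _ = _) => E; rewrite -powz_eq1 E eta1 cp0 tc.
have -> : powz q (-1 : int)%R = q^-1.
  by rewrite -[(-1 : int)%R]/((Posz 1 : addg int)^-1) (homV (powz_hom q)) powz_nat.
have /cycleP[i ->] := r0.
by rewrite -expgSr expgS mulgK mulgV.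
Qed.
End CosetLift.

Section ShiftWreath.
Local Open Scope group_scope.
Context (Gam : groupType) (g : nat) (a b : nat -> Gam).
Hypotheses (pres : presents g a b) (g_ge2 : (2 <= g)%N).
Variables (m e : nat).
Hypotheses (m_gt1 : (1 < m)%N) (e_gt0 : (0 < e)%N) (e_ltm : (e < m)%N).

Definition shift : {perm 'Z_m} := perm (@addrI 'Z_m 1%R).

Lemma shiftX n x : (shift ^+ n) x = (n%:R + x)%R.
Proof.
elim: n x => [|n IH] x; first by rewrite expg0 perm1 add0r.
by rewrite expgSr permM IH permE /= mulrS addrA.
Qed.

Lemma shift_m : shift ^+ m = 1.
Proof. by apply/permP => x; rewrite shiftX perm1 pchar_Zp// add0r. Qed.

(** With [e] the order of [Q], both powers lie in the kernel of [theta], so this commutator dies in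
    [Q] and in every cocycle that is additive on that kernel. *)
Definition shift_comm : Gam :=
  a 0 ^+ e * a 1 ^+ e * (a 0 ^+ e)^-1 * (a 1 ^+ e)^-1.

(** Sending all [b k] to 1 satisfies the relator. [a 0] goes to the cyclic shift and [a 1] to the
    indicator function of 0, so the commutator becomes [e] times a difference of two indicator
    functions, which are distinct as 0 < e < m. *)
Lemma shift_wreath : exists h : Gam -> wreath (addg int) 'Z_m, [/\ is_hom h,
  forall c, (h (c ^+ m)).2 = 1, (h shift_comm).2 = 1,
  forall x, (e %| ((h shift_comm).1 x : int))%Z &
  exists x, (h shift_comm).1 x = (- Posz e)%R].
Proof.
have [rel gen univ] := pres.
pose A (k : nat) : wreath (addg int) 'Z_m :=
  if k == 0 then wr (fun=> 1) shift
  else if k == 1%N then wr (fun x => Posz (x == 0)%R : addg int) 1 else 1.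
have [h [h_hom hE]] := univ _ A (fun=> 1) (relator_b1 _ _).
have [h0 _] := hE 0 (ltnW g_ge2); have [h1 _] := hE 1%N g_ge2.
have sh c : exists i, (h c).2 = shift ^+ i.
  move: c; apply: gen.
  - move=> k kg; have [-> ->] := hE k kg; split; last by exists 0.
    by rewrite /A; case: ifP => _; [exists 1%N|case: ifP => _; exists 0].
  - by exists 0; rewrite (hom1 h_hom).
  - move=> x y [i xi] [j yj]; exists (i + j)%N.
    by rewrite h_hom wreathM2 xi yj expgnDr.
  - move=> x [i xi]; exists (i * m.-1)%N.
    rewrite (homV h_hom) wreathV2 xi; apply: (mulgI (shift ^+ i)).
    rewrite mulgV -expgnDr -{1}[i]muln1 -mulnDr add1n prednK ?(ltnW m_gt1)//.
    by rewrite mulnC expgM shift_m expg1n.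
have h0e : h (a 0 ^+ e) = wr (fun=> 1) (shift ^+ e).
  rewrite (homX h_hom) h0 /A eqxx; elim: (e) => [|n IH].
    by rewrite !expg0; apply: wreathP => // x; rewrite !ffunE.
  rewrite !expgS IH; apply: wreathP => [x|//].
  by rewrite wreathM1 !ffunE mul1g.
pose f (x : 'Z_m) : addg int := (Posz (x == 0)%R *+ e)%R.
have h1e : h (a 1 ^+ e) = wr f 1.
  rewrite (homX h_hom) h1 /A /=; apply: wreathP => [x|].
    have [|-> _] := fix_wreathX (w := wr (fun x => Posz (x == 0)%R : addg int) 1)
      (x := x) e; first by rewrite perm1.
    by rewrite addgX !ffunE.
  elim: (e) => [//|n IH]; by rewrite expgS wreathM2 IH mulg1.
have hc : h shift_comm =
    wr (fun=> 1) (shift ^+ e) * wr f 1 * (wr (fun=> 1) (shift ^+ e))^-1 * (wr f 1)^-1.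
  by rewrite /shift_comm !h_hom !(homV h_hom) h0e h1e.
have hc1 x : (h shift_comm).1 x = (f (e%:R + x) - f x)%R.
  rewrite hc wreathM1 wreathJ2 perm1 wr1V wreathJ1 !ffunE invg1 mulg1 mul1g.
  by rewrite /= shiftX addgM addgV.
exists h; split=> //.
- move=> c; have [i ci] := sh c.
  rewrite (homX h_hom); have /= -> := homX (@wreath_snd_hom (addg int) 'Z_m) (h c) m.
  by rewrite ci -expgM mulnC expgM shift_m expg1n.
- by rewrite hc wreathM2 wreathJ2 wreathV2 mul1g invg1.
- move=> x; rewrite hc1 /f -mulrnBl.
  have D (u : int) : (e %| (u *+ e)%R)%Z by rewrite -mulr_natr natz dvdz_mull.
  exact: D.
- exists 0%R; rewrite hc1 addr0 /f eqxx (_ : (e%:R == 0 :> 'Z_m)%R = false) ?mul0rn ?sub0r.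
    by congr (- _)%R; exact: natz.
  apply/negP => /eqP/(congr1 val) /=; rewrite val_Zp_nat// modn_small//.
  by move=> e0; move: e_gt0; rewrite e0.
Qed.
End ShiftWreath.

(** * Normal subgroups of finite index *)

Section FiniteKernels.
Local Open Scope group_scope.
Variable Gam : groupType.

Definition finker (L : Gam -> Prop) : Prop :=
  exists (H : finGroupType) (f : Gam -> H), is_hom f /\ forall c, L c <-> f c = 1.

Lemma finkerT : finker (fun=> True).
Proof. by exists {perm bool}, (fun=> 1); split=> // x y; rewrite mulg1. Qed.

Lemma finkerI L1 L2 : finker L1 -> finker L2 -> finker (fun c => L1 c /\ L2 c).
Proof.
move=> [H1 [f1 [hf1 k1]]] [H2 [f2 [hf2 k2]]].
exists (H1 * H2)%type, (fun c => (f1 c, f2 c)); split.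
  by move=> x y; rewrite hf1 hf2.
move=> c; rewrite k1 k2; split=> [[-> ->]//|E].
by split; [exact: (congr1 fst E)|exact: (congr1 snd E)].
Qed.

Lemma finker_all (I : finType) (L : I -> Gam -> Prop) :
  (forall i, finker (L i)) -> finker (fun c => forall i, L i c).
Proof.
move=> Lf; suff [H [f [hf fE]]] : finker (fun c => forall i, i \in enum I -> L i c).
  exists H, f; split=> // c; rewrite -fE; split=> [Lc i _|Lc i]; first exact: Lc.
  by apply: Lc; rewrite mem_enum.
elim: (enum I) => [|i s IH].
  have [H [f [hf fE]]] := finkerT; exists H, f; split=> // c.
  by rewrite -fE; split.
have [H [f [hf fE]]] := finkerI (Lf i) IH.
exists H, f; split=> // c; rewrite -fE; split=> [Lc|[Lc1 Lc2] j].
  split; first by apply: Lc; rewrite mem_head.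
  by move=> j js; apply: Lc; rewrite in_cons js orbT.
by rewrite in_cons => /predU1P[->//|]; exact: Lc2.
Qed.

Lemma finker_hom (H : finGroupType) (f : Gam -> H) : is_hom f ->
  finker (fun c => f c = 1).
Proof. by move=> hf; exists H, f. Qed.

(** The group acts on [X * 'Z_n] by moving the point and adding the cocycle value; the subgroup is
    the kernel of this finite action. *)
Lemma finker_wreath (X : finType) (eta : Gam -> wreath (addg int) X) (n : nat) :
  is_hom eta -> (1 < n)%N ->
  finker (fun c => (eta c).2 = 1 /\ forall x, (n %| ((eta c).1 x : int))%Z).
Proof.
move=> eta_hom n1; pose T := (X * 'Z_n)%type.
pose tr (c : Gam) (t : T) : T := ((eta c).2 t.1, t.2 + ((eta c).1 t.1)%:~R)%R.
have tr_inj c : injective (tr c).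
  move=> [x i] [y j] [/perm_inj <- E]; congr pair.
  by apply: (addIr (((eta c).1 x)%:~R)%R); apply/val_inj; exact: E.
exists {perm T}, (fun c => perm (@tr_inj c)); split.
  move=> c d; apply/permP => -[x i]; rewrite permM !permE /tr.
  have E1 : (eta (c * d)).1 x = ((eta c).1 x + (eta d).1 ((eta c).2 x) : int)%R.
    by rewrite eta_hom wreathM1.
  have E2 : (eta (c * d)).2 x = (eta d).2 ((eta c).2 x).
    by rewrite eta_hom wreathM2 permM.
  by congr pair; [exact: E2|rewrite /fst E1 rmorphD /= addrA].
have intr0 z : (z%:~R == 0 :> 'Z_n)%R = (n %| z)%Z.
  have nat0 k : (k%:R == 0 :> 'Z_n)%R = (n %| k)%N.
    by rewrite -val_eqE /= val_Zp_nat.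
  case: z => k; first exact: nat0.
  by rewrite NegzE mulrNz oppr_eq0 dvdzE abszN; exact: nat0.
move=> c; split=> [[c2 c1]|/permP E].
  apply/permP => -[x i]; rewrite perm1 permE /tr /= c2 perm1; congr pair.
  by have := c1 x; rewrite -intr0 => /eqP ->; rewrite addr0.
split=> [|x].
  by apply/permP => x; have := congr1 fst (E (x, 0%R)); rewrite !perm1 permE.
by have /eqP := congr1 snd (E (x, 0%R)); rewrite perm1 permE /= add0r intr0.
Qed.

Lemma finker_quotient L : finker L -> exists (P : finGroupType) (f : Gam -> P),
  [/\ is_hom f, forall x, exists c, f c = x & forall c, L c <-> f c = 1].
Proof.
move=> [H [f [hf fE]]]; pose S := [set x : H | `[< exists c, f c = x >]]%SET.
have gS : group_set S.
  apply/group_setP; split; first by rewrite inE; apply/asboolP; exists 1; exact: hom1.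
  move=> x y; rewrite !inE => /asboolP/asboolP[c <-] /asboolP/asboolP[d <-].
  by apply/asboolP/asboolP; exists (c * d).
pose K := group gS; have fK c : f c \in K by rewrite inE; apply/asboolP; exists c.
exists (subg_of K), (fun c => subg K (f c)); split.
- by move=> c d; rewrite hf subgM.
- move=> x; have := subgP x; rewrite inE => /asboolP[c cx]; exists c.
  by rewrite cx sgvalK.
- move=> c; rewrite fE; split=> [->|/(congr1 sgval)]; first by rewrite morph1.
  by rewrite subgK.
Qed.

(** The fibres are cosets of the kernel of the projection between the two quotients, and the image
    of [k] has order [p] in that kernel. *)
Lemma quotient_fibres (P P' : finGroupType) (f : Gam -> P) (f' : Gam -> P') p k :
  is_hom f -> is_hom f' -> (forall x, exists c, f c = x) ->
  (forall x, exists c, f' c = x) -> (forall c, f' c = 1 -> f c = 1) ->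
  prime p -> f k = 1 -> f' k <> 1 -> f' (k ^+ p) = 1 ->
  exists pr : P' -> P, (forall c, pr (f' c) = f c) /\
    forall x, (p %| #|[set y | pr y == x]|%SET)%N.
Proof.
move=> hf hf' fs fs' ff' pp fk fk' fkp.
have [s sE] := choice fs'; pose pr y := f (s y).
have prE c : pr (f' c) = f c.
  apply/eqP; rewrite eq_mulgV1 -(homV hf) -hf; apply/eqP/ff'.
  by rewrite hf' (homV hf') sE mulgV.
have prM : {in [set: P']%SET &, {morph pr : x y / x * y}}.
  by move=> x y _ _; rewrite -(sE x) -(sE y) -hf' !prE hf.
pose prm := Morphism prM.
exists pr; split=> // x; have [c cx] := fs x.
have -> : [set y | pr y == x]%SET = 'ker prm :* f' c.
  apply/setP => y; rewrite inE mem_rcoset; apply/eqP/idP => [yx|].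
    apply/kerP; rewrite ?inE//= prM ?inE// yx -cx -(prE c) -prM ?inE//.
    by rewrite mulgV -(hom1 hf') prE (hom1 hf).
  move=> /kerP; rewrite ?inE => /(_ isT) /=.
  rewrite prM ?inE// -(homV hf') prE (homV hf) cx => /eqP.
  by rewrite -eq_mulgV1 => /eqP.
rewrite card_rcoset; suff <- : #[f' k] = p.
  apply: order_dvdG; apply/kerP; rewrite ?inE//=; by rewrite prE.
apply: nt_prime_order => //; first by rewrite -(homX hf').
exact/eqP.
Qed.

End FiniteKernels.

(** * Lifts to unitriangular matrices *)


Section Band.
Local Open Scope ring_scope.
Context (F : finFieldType) (N : nat).
Local Notation mx := 'M[F]_N.+1.
Implicit Types X Y : mx.

Definition deg (j : nat) X : Prop :=
  forall i c : 'I_N.+1, (c < i + j)%N -> X i c = 0.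

Lemma deg0 j : deg j 0.
Proof. by move=> i c _; rewrite mxE. Qed.

Lemma degD j X Y : deg j X -> deg j Y -> deg j (X + Y).
Proof. by move=> dX dY i c ic; rewrite mxE dX// dY// addr0. Qed.

Lemma deg_le j j' X : (j' <= j)%N -> deg j X -> deg j' X.
Proof. by move=> jj dX i c ic; apply: dX; apply: leq_trans ic _; rewrite leq_add2l. Qed.

Lemma degM j j' X Y : deg j X -> deg j' Y -> deg (j + j') (X * Y).
Proof.
move=> dX dY i c ic; rewrite mxE big1// => l _.
have [li|li] := ltnP l (i + j); first by rewrite dX// mul0r.
rewrite dY ?mulr0//; apply: leq_trans ic _.
by rewrite addnA leq_add2r.
Qed.

Lemma leadM j j' X Y (i l c : 'I_N.+1) : deg j X -> deg j' Y ->
  l = (i + j)%N :> nat -> c = (l + j')%N :> nat -> (X * Y) i c = X i l * Y l c.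
Proof.
move=> dX dY lE cE; rewrite mxE (bigD1 l)//= big1 ?addr0// => l' l'l.
have [li|li] := ltnP l' (i + j); first by rewrite dX// mul0r.
rewrite dY ?mulr0// cE ltn_add2r lE ltn_neqAle li andbT -lE.
by rewrite eq_sym; apply: contra l'l => /eqP /val_inj ->.
Qed.

Lemma deg1 : deg 0 (1 : mx).
Proof.
move=> i c; rewrite addn0 mxE => ci; rewrite (_ : (i == c) = false)//.
by apply/negbTE; rewrite -val_eqE /= neq_ltn ci orbT.
Qed.

Lemma degX X n : deg 1 X -> deg n (X ^+ n).
Proof.
move=> dX; elim: n => [|n IH]; first exact: deg1.
by rewrite exprS -add1n; exact: degM.
Qed.

Lemma leadX X n (i c : 'I_N.+1) : deg 1 X -> c = (i + n)%N :> nat ->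
  (X ^+ n) i c = \prod_(i <= r < i + n) X (inord r) (inord r.+1).
Proof.
move=> dX; elim: n c => [|n IH] c cE.
  rewrite expr0 addn0 big_geq// mxE.
  by rewrite (_ : c = i) ?eqxx//; apply: val_inj; rewrite /= cE addn0.
have inN : (i + n < N.+1)%N by rewrite -addnS -cE ltnW// ltnS -cE ltn_ord.
pose l := Ordinal inN.
rewrite exprSr (@leadM n 1 _ _ _ l)//; [|exact: degX|by rewrite cE addn1 addnS].
rewrite addnS big_nat_recr ?leq_addr//= (IH l)//; congr (_ * X _ _).
  by apply/ord_inj; rewrite (inordK inN).
by rewrite -addnS -cE inord_val.
Qed.

Lemma deg_eq0 X : deg N.+1 X -> X = 0.
Proof.
move=> dX; apply/matrixP => i c; rewrite dX ?mxE//.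
by rewrite (leq_trans (ltn_ord c))// leq_addl.
Qed.

Definition utset : {set {'GL_N.+1[F]}} :=
  [set A : {'GL_N.+1[F]} | [forall i : 'I_N.+1, forall c : 'I_N.+1,
    (c < i + 1)%N ==> ((GLval A - 1 : mx) i c == 0)]]%SET.

Lemma utsetP (A : {'GL_N.+1[F]}) :
  reflect (deg 1 (GLval A - 1)) (A \in utset).
Proof.
rewrite inE; apply: (iffP forallP) => [H i c ic|H i].
  by have /forallP/(_ c)/implyP/(_ ic)/eqP := H i.
by apply/forallP => c; apply/implyP => ic; rewrite H.
Qed.

(** The error is the product of the two nilpotent parts, which lies twice as high; hence the lowest
    superdiagonal is additive. *)
Lemma unipM j (A B : mx) : deg j (A - 1) -> deg j (B - 1) ->
  deg j (A * B - 1) /\ deg (j + j) ((A * B - 1) - ((A - 1) + (B - 1))).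
Proof.
move=> dA dB; have E : A * B - 1 - ((A - 1) + (B - 1)) = (A - 1) * (B - 1).
  rewrite mulrBr mulr1 mulrBl mul1r [A - 1 + _]addrC opprD addrA.
  by rewrite opprB addrA subrK.
have dAB := degM dA dB; rewrite E; split=> //.
have -> : A * B - 1 = (A - 1) * (B - 1) + ((A - 1) + (B - 1)).
  by rewrite -E subrK.
by apply: degD; [exact: deg_le (leq_addr _ _) dAB|exact: degD].
Qed.

Lemma utset_group : group_set utset.
Proof.
apply/group_setP; split.
  by apply/utsetP; rewrite subrr; exact: deg0.
move=> A B /utsetP dA /utsetP dB; apply/utsetP.
by have [] := unipM dA dB.
Qed.

Definition ut : finGroupType := subg_of (group utset_group).
Definition mat (A : ut) : mx := GLval (sgval A).

Lemma matM (A B : ut) : mat (A * B)%g = mat A * mat B.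
Proof. by []. Qed.

Lemma mat1 : mat 1%g = 1.
Proof. by []. Qed.

Lemma matX (A : ut) n : mat (A ^+ n)%g = mat A ^+ n.
Proof. by elim: n => [//|n IH]; rewrite expgS matM IH exprS. Qed.

Lemma mat_inj : injective mat.
Proof. by move=> A B AB; apply/val_inj/val_inj; exact: AB. Qed.

Lemma mat_deg (A : ut) : deg 1 (mat A - 1).
Proof. by apply/utsetP; exact: subgP. Qed.

Lemma ut_of (X : mx) : deg 1 (X - 1) -> exists A : ut, mat A = X.
Proof.
move=> dX.
have Xu : X \in unitmx.
  rewrite unitmxE -det_tr det_trig.
    rewrite big1 ?unitr1// => i _; rewrite mxE.
    have : (X - 1) i i = 0 by apply: dX; rewrite addn1.
    by rewrite !mxE eqxx => /eqP; rewrite subr_eq0 => /eqP.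
  apply/is_trig_mxP => i c ic; rewrite mxE.
  have := dX c i; rewrite addn1 ltnS => /(_ (ltnW ic)); rewrite !mxE.
  by rewrite (_ : (c == i) = false) ?subr0// -val_eqE /= gtn_eqF.
pose U : {'GL_N.+1[F]} := Sub X Xu.
have Uut : U \in group utset_group by apply/utsetP.
by exists (subg _ U); rewrite /mat subgK.
Qed.

Definition utn (j : nat) (A : ut) : Prop := deg j (mat A - 1).

Lemma utn1 j : utn j 1%g.
Proof. by rewrite /utn mat1 subrr; exact: deg0. Qed.

Lemma utnM j A B : utn j A -> utn j B -> utn j (A * B)%g.
Proof. by move=> dA dB; have [] := unipM dA dB. Qed.

Lemma utnX j A n : utn j A -> utn j (A ^+ n)%g.
Proof.
by move=> dA; elim: n => [|n IH]; [exact: utn1|rewrite expgS; exact: utnM].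
Qed.

Lemma utnV j A : utn j A -> utn j A^-1%g.
Proof. by move=> dA; rewrite invg_expg; exact: utnX. Qed.

Lemma ut_conj (h A : ut) :
  mat (h * A * h^-1)%g - 1 = mat h * (mat A - 1) * mat h^-1%g.
Proof.
have E : mat h * mat h^-1%g = 1 by rewrite -matM mulgV.
by rewrite !matM mulrBr mulr1 mulrBl E.
Qed.

Lemma mat_deg0 (A : ut) : deg 0 (mat A).
Proof.
rewrite -[mat A](subrK 1); apply: degD; last exact: deg1.
exact: deg_le (mat_deg A).
Qed.

Lemma mat_diag (A : ut) i : mat A i i = 1.
Proof.
have : (mat A - 1) i i = 0 by apply: mat_deg; rewrite addn1.
by rewrite !mxE eqxx => /eqP; rewrite subr_eq0 => /eqP.
Qed.

Lemma utnJ j h A : utn j A -> utn j (h * A * h^-1)%g.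
Proof.
move=> dA; rewrite /utn ut_conj -[j]addn0 -[j]add0n.
by apply: degM; [apply: degM => //|]; exact: mat_deg0.
Qed.

(** Indexed by all rows, with value 0 in the rows that the superdiagonal does not reach, so that all
    bands share one type. *)
Definition band (j : nat) (A : ut) : {ffun 'I_N.+1 -> F} :=
  [ffun i : 'I_N.+1 => oapp (fun c => (mat A - 1) i c) 0 (insub (i + j)%N)].

Lemma bandM j A B : (0 < j)%N -> utn j A -> utn j B ->
  band j (A * B)%g = band j A + band j B.
Proof.
move=> j0 dA dB; apply/ffunP => i; rewrite !ffunE.
case: insubP => [c _ cE|_] /=; last by rewrite addr0.
have [_ D] := unipM dA dB; have := D i c.
rewrite cE addnA -addn1 leq_add2l => /(_ j0); rewrite matM !mxE.
by move/eqP; rewrite subr_eq0 => /eqP.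
Qed.

(** Conjugation by a unitriangular matrix only changes entries above the lowest superdiagonal; this
    is the invariance that [mass_transport] asks of [chi]. *)
Lemma bandJ j h A : utn j A -> band j (h * A * h^-1)%g = band j A.
Proof.
move=> dA; apply/ffunP => i; rewrite !ffunE.
case: insubP => [c _ cE|//] /=; rewrite ut_conj.
have dhA : deg j (mat h * (mat A - 1)).
  by rewrite -[j]add0n; apply: degM => //; exact: mat_deg0.
rewrite (@leadM j 0 _ _ _ c)//; [|exact: mat_deg0|by rewrite addn0].
rewrite (@leadM 0 j _ _ _ i)//; [|exact: mat_deg0|by rewrite addn0].
by rewrite !mat_diag mul1r mulr1.
Qed.

Lemma band_eq0 j A : utn j A -> band j A = 0 -> utn j.+1 A.
Proof.
move=> dA b0 i c; rewrite addnS ltnS leq_eqVlt => /orP[/eqP cE|]; last exact: dA.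
have := congr1 (fun f : {ffun 'I_N.+1 -> F} => f i) b0; rewrite !ffunE.
case: insubP => [c' _ c'E|]; last by rewrite -cE ltn_ord.
by rewrite (_ : c = c')//; apply/ord_inj; rewrite cE.
Qed.

Lemma utn_eq1 A : utn N.+1 A -> A = 1%g.
Proof.
by move=> /deg_eq0/eqP; rewrite subr_eq0 => /eqP E; apply: mat_inj; rewrite E.
Qed.

End Band.

Section Regular.
Local Open Scope group_scope.
Context (Gam : groupType) (P : finGroupType) (f : Gam -> P).
Hypothesis f_hom : is_hom f.

Definition regular (c : Gam) : {perm P} := perm (mulIg (f c)).

Lemma regularE c x : regular c x = x * f c.
Proof. by rewrite permE. Qed.

Lemma regular_hom : is_hom regular.
Proof. by move=> c d; apply/permP => x; rewrite permM !regularE f_hom mulgA. Qed.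

Lemma regular_trans : (forall x, exists c, f c = x) ->
  forall x y, exists c, regular c x = y.
Proof.
move=> fs x y; have [c cE] := fs (x^-1 * y); exists c.
by rewrite regularE cE mulKVg.
Qed.

End Regular.

Section Pullback.
Local Open Scope group_scope.
Context (G : groupType) (X X' : finType) (pr : X' -> X).

Definition pulled (w' : wreath G X') (w : wreath G X) : Prop :=
  forall x, w'.1 x = w.1 (pr x) /\ pr (w'.2 x) = w.2 (pr x).

Lemma pulledM w1' w1 w2' w2 : pulled w1' w1 -> pulled w2' w2 ->
  pulled (w1' * w2') (w1 * w2).
Proof.
move=> h1 h2 x; have [E1 E2] := h1 x; have [E3 E4] := h2 (w1'.2 x).
by rewrite !wreathM1 !wreathM2 !permM E1 E3 E4 E2.
Qed.

Lemma pulledV w' w : pulled w' w -> pulled w'^-1 w^-1.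
Proof.
move=> h x; have [E1 E2] := h (w'.2^-1 x); rewrite permKV in E2.
have E3 : pr (w'.2^-1 x) = w.2^-1 (pr x) by rewrite E2 permK.
by rewrite !wreathV1 !wreathV2 E1 E3.
Qed.

Lemma pulled_relator n (A' B' : nat -> wreath G X') (A B : nat -> wreath G X) :
  (forall k, pulled (A' k) (A k)) -> (forall k, pulled (B' k) (B k)) ->
  pulled (relator n A' B') (relator n A B).
Proof.
move=> hA hB; elim: n => [|n IH] /=.
  by move=> x; rewrite !wreath11 !perm1.
by do ![exact: IH|exact: hA|exact: hB|apply: pulledM|apply: pulledV].
Qed.

End Pullback.

Section Tower.
Local Open Scope group_scope.
Context (Gam : groupType) (g : nat) (a b : nat -> Gam).
Hypothesis pres : presents g a b.
Context (F : finFieldType) (n p : nat).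
Local Notation N := n.+1.
Local Notation V := {ffun 'I_N.+1 -> F}.
Hypotheses (p_pr : prime p) (p_char : p \in [pchar F]%R).
Context (L : nat -> Gam -> Prop) (w : nat -> Gam).
Hypotheses (L_fin : forall j, finker (L j)) (L_dec : forall j c, L j.+1 c -> L j c).
(** [w j] witnesses that the index of [L j.+1] in [L j] is divisible by [p]. *)
Hypotheses (wL : forall j, L j (w j)) (wnL : forall j, ~ L j.+1 (w j))
  (wpL : forall j, L j.+1 (w j ^+ p)).
Variable psi : Gam -> V.
Hypotheses (psiM : forall x y, L 0 x -> L 0 y -> psi (x * y) = (psi x + psi y)%R)
  (psiN : forall x, psi x ord_max = 0%R).

Lemma band1_hom : is_hom (fun A : ut F N => band 1 A : addg V).
Proof. by move=> A B; rewrite bandM//; exact: mat_deg. Qed.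

Lemma band1_surj (v : V) : v ord_max = 0%R -> exists A : ut F N, band 1 A = v.
Proof.
move=> v0; pose X : 'M[F]_N.+1 := (\matrix_(i, c)
  if c == i :> nat then 1 else if c == i.+1 :> nat then v i else 0)%R.
have [|A AX] := @ut_of F N X.
  move=> i c; rewrite addn1 ltnS !mxE => ci.
  rewrite -val_eqE /= eq_sym; case: ltngtP ci => // [ic|_ _]; last by rewrite subrr.
  by rewrite (ltn_eqF (ltn_trans ic _)) ?subrr.
exists A; apply/ffunP => i; rewrite ffunE; case: insubP => [c _ cE|] /=.
  rewrite AX !mxE cE addn1 eqxx -val_eqE /= cE addn1.
  by rewrite gtn_eqF// ltn_eqF// subr0.
rewrite addn1 ltnS -ltnNge ltnS => ni; rewrite (_ : i = ord_max) ?v0//.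
by apply/ord_inj/eqP; rewrite eqn_leq ni -ltnS ltn_ord.
Qed.

Lemma band1_eq0 j (A : ut F N) : (1 < j)%N -> utn j A -> band 1 A = 0%R.
Proof.
move=> j1 Aj; apply/ffunP => i; rewrite !ffunE; case: insubP => [c _ cE|//] /=.
by apply: Aj; rewrite cE ltn_add2l.
Qed.

(** A solution up to superdiagonal [j.+1] over the quotient by [L j], whose first superdiagonal is
    induced from [psi]. The section [s] matters only modulo [L 0], so it can be pulled back along
    the chain without changing the values of [psi]. *)
Definition stage (j : nat) : Prop :=
  exists (P : finGroupType) (f : Gam -> P) (s : P -> Gam)
    (al be : nat -> P -> ut F N),
  [/\ is_hom f, forall x, exists c, f c = x, forall c, L j c <-> f c = 1,
      forall x c, L 0 (s x * c * (s (x * f c))^-1) &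
      [/\ forall k x, band 1 (al k x) = psi (s x * a k * (s (x * f (a k)))^-1),
          forall k x, band 1 (be k x) = psi (s x * b k * (s (x * f (b k)))^-1) &
          forall x, utn j.+2 ((defect g a b (regular f) al be).1 x)]].

(** The first superdiagonal of the defect is the relator evaluated in the homomorphism induced from
    [psi], hence 0. *)
Lemma stage0 : stage 0.
Proof.
have [rel gen univ] := pres.
have [P [f [hf fs fk]]] := finker_quotient (L_fin 0).
have [s sE] := choice fs.
have sL x c : L 0 (s x * c * (s (x * f c))^-1).
  by apply/fk; rewrite !hf (homV hf) !sE mulgV.
have H (t : nat -> Gam) (kx : nat * P) : exists A : ut F N, band 1 A =
    psi (s kx.2 * t kx.1 * (s (kx.2 * f (t kx.1)))^-1).
  exact: band1_surj.
have [al0 al0E] := choice (H a); have [be0 be0E] := choice (H b).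
pose al k x := al0 (k, x); pose be k x := be0 (k, x).
exists P, f, s, al, be; split=> //; split=> [k x|k x|x].
- exact: (al0E (k, x)).
- exact: (be0E (k, x)).
apply: band_eq0; first exact: mat_deg.
have ind_hom : is_hom (induced (regular f) (psi : Gam -> addg V) s).
  apply: (@induced_hom _ _ _ _ (L 0)) => //; first exact: regular_hom.
  by move=> y c; rewrite regularE; exact: sL.
have := hom_relator (wreath_map_hom (X := P) band1_hom) g
  (lift_gens (regular f) al a) (lift_gens (regular f) be b).
rewrite (@eq_relator _ _ _ _ (induced (regular f) (psi : Gam -> addg V) s \o a)
   (induced (regular f) (psi : Gam -> addg V) s \o b)); last first.
  move=> k _; split; apply: wreathP => // y; rewrite !ffunE /= ffunE regularE.
    exact: (al0E (k, y)).
  exact: (be0E (k, y)).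
rewrite -(hom_relator ind_hom) rel (hom1 ind_hom).
by move=> /(wreath_eq1 x); rewrite wreath11 ffunE.
Qed.

(* Each point of the quotient by L j has a multiple of p points above it in the
   quotient by L j.+1, so that the total defect becomes 0 in characteristic p. *)
Lemma stageS j : stage j -> stage j.+1.
Proof.
have [rel gen univ] := pres.
move=> [P [f [s [al [be [hf fs fk sL [alE beE dE]]]]]]].
have [P' [f' [hf' fs' fk']]] := finker_quotient (L_fin j.+1).
have [||||pr [prE prF]] :=
  @quotient_fibres Gam P P' f f' p (w j) hf hf' fs fs' _ p_pr _ _ _.
- by move=> c /fk'/L_dec/fk.
- exact/fk/wL.
- by move=> /fk'; exact: wnL.
- exact/fk'/wpL.
have prM x c : pr (x * f' c) = pr x * f c.
  by have [d <-] := fs' x; rewrite -hf' !prE hf.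
pose s' := s \o pr; pose al1 k x := al k (pr x); pose be1 k x := be k (pr x).
have pl (c : nat -> Gam) (al2 : nat -> P -> ut F N) k :
    pulled pr (lift_gens (regular f') (fun k x => al2 k (pr x)) c k)
      (lift_gens (regular f) al2 c k).
  by move=> x; rewrite !ffunE !regularE prM.
have dpr x : (defect g a b (regular f') al1 be1).1 x =
             (defect g a b (regular f) al be).1 (pr x).
  by have [] := pulled_relator g (pl a al) (pl b be) x.
have [||||||||al' [be' [hal hbe h]]] := @mass_transport Gam g a b gen P'
   (regular f') (regular_hom hf') (regular_trans fs') (ut F N)
   (@utn F N j.+2) V (band j.+2) _ _ _ _ _ _ al1 be1.
- exact: utn1.
- exact: utnM.
- exact: utnV.
- exact: utnJ.
- by move=> A B; exact: bandM.
- by move=> h A; exact: bandJ.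
- by move=> x; rewrite dpr.
- rewrite (partition_big pr xpredT)//= big1// => x _.
  rewrite (eq_bigr (fun=> band j.+2 ((defect g a b (regular f) al be).1 x))).
    rewrite sumr_const; have := prF x; rewrite cardsE => /dvdnP[m ->].
    have Vp (v : V) : (v *+ p = 0)%R.
      by apply/ffunP => i; rewrite ffunMnE ffunE -mulr_natr (pcharf0 p_char) mulr0.
    by rewrite mulnC mulrnA Vp mul0rn.
  by move=> y /eqP <-; rewrite dpr.
exists P', f', s', al', be'; split=> //.
  by move=> x c; rewrite /s' /= prM; exact: sL.
(* The corrections live from superdiagonal [j.+2] on and leave the first one untouched. *)
have keep (al2 al3 : nat -> P' -> ut F N) : congM (@utn F N j.+2) al2 al3 ->
    forall k x, band 1 (al3 k x) = band 1 (al2 k x).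
  move=> cg k x; rewrite -[al3 k x](mulgKV (al2 k x)) bandM//; try exact: mat_deg.
  by rewrite (@band1_eq0 j.+2 _ isT (cg k x)) add0r.
split=> [k x|k x|x].
- by rewrite (keep _ _ hal) alE /s' /= prM.
- by rewrite (keep _ _ hbe) beE /s' /= prM.
by have [h1 h2] := h x; exact: band_eq0.
Qed.

(** At [stage n] the defect lies beyond the last superdiagonal, so it is 1 and the presentation
    gives [Psi]. On [L n] the conjugator [d] is the section value at the point. *)
Lemma lift_tower : exists (P : finGroupType) (f : Gam -> P)
    (Psi : Gam -> wreath (ut F N) P),
  [/\ is_hom f, is_hom Psi, forall c, L n c <-> f c = 1,
      forall c, (Psi c).2 = regular f c &
      forall c x, f c = 1 -> exists d, band 1 ((Psi c).1 x) = psi (d * c * d^-1)].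
Proof.
have [rel gen univ] := pres.
have: stage n by elim: n => [|j IH]; [exact: stage0|exact: stageS].
move=> [P [f [s [al [be [hf fs fk sL [alE beE dE]]]]]]].
have d1 : relator g (lift_gens (regular f) al a) (lift_gens (regular f) be b) = 1.
  apply: wreathP => [x|]; first by rewrite wreath11; exact/utn_eq1/dE.
  by rewrite relator_snd ?rel ?(hom1 (regular_hom hf))//; exact: regular_hom.
have [Psi [Psi_hom PsiE]] := univ _ _ _ d1.
have ind_hom : is_hom (induced (regular f) (psi : Gam -> addg V) s).
  apply: (@induced_hom _ _ _ _ (L 0)) => //; first exact: regular_hom.
  by move=> y c; rewrite regularE; exact: sL.
have redE : forall c, wreath_map (fun A : ut F N => band 1 A : addg V) (Psi c) =
    induced (regular f) (psi : Gam -> addg V) s c.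
  apply: (eq_hom gen) => //.
    exact: hom_comp Psi_hom (wreath_map_hom (X := P) band1_hom).
  move=> k kg; rewrite /=; have [-> ->] := PsiE k kg.
  split; apply: wreathP => // y; rewrite !ffunE /= ffunE regularE.
    exact: alE.
  exact: beE.
exists P, f, Psi; split=> //.
  by move=> c; have [] := redE c.
move=> c x fc; exists (s x); have /(wreath_eq1 x) := redE c.
by rewrite !ffunE /= regularE fc mulg1.
Qed.

End Tower.

(** * Powers of unitriangular matrices and the norm *)

Section Powers.
Local Open Scope ring_scope.
Context (F : finFieldType) (n p k : nat).
Local Notation N := n.+1.
Local Notation mx := 'M[F]_N.+1.
Hypotheses (p_pr : prime p) (p_char : p \in [pchar F]) (Nk : N = (p ^ k)%N)
  (cardF : #|F| = (p ^ N)%N).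

Lemma mx_pchar : p \in [pchar mx].
Proof.
apply/andP; split=> //; apply/eqP/matrixP => i j.
by rewrite -scaler_nat (pcharf0 p_char) scale0r.
Qed.

Lemma frob_mx (X : mx) m : (1 + X) ^+ (p ^ m) = 1 + X ^+ (p ^ m).
Proof.
elim: m => [|m IH]; first by rewrite expn0 !expr1.
rewrite expnSr !exprM IH -!(pFrobenius_autE mx_pchar) pFrobenius_autD_comm.
  by rewrite pFrobenius_aut1.
exact/commr_sym/commr1.
Qed.

Definition corner : mx := delta_mx ord0 ord_max.

Lemma corner_deg : deg N corner.
Proof.
move=> i c; rewrite mxE; case: eqP => [->|//] /=; rewrite add0n => ci.
by case: eqP ci => [->|//]; rewrite ltnn.
Qed.

Lemma degN_corner (X : mx) : deg N X -> X = X ord0 ord_max *: corner.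
Proof.
move=> dX; apply/matrixP => i c; rewrite !mxE.
have H (m : nat) : (0 < m)%N -> (N.+1 <= m + N)%N.
  by move=> m0; exact: (leq_add m0 (leqnn N)).
have [->|i0] := eqVneq i ord0; have [->|cN] := eqVneq c ord_max => /=;
  rewrite ?mulr1 ?mulr0// dX//.
- by rewrite add0n ltn_neqAle -ltnS ltn_ord andbT.
- by apply: leq_trans (ltn_ord _) (H i _); rewrite lt0n.
- by apply: leq_trans (ltn_ord _) (H i _); rewrite lt0n.
Qed.

(** The [N]-th power of the nilpotent part has only a corner entry, the product of the first
    superdiagonal; for the conjugates of [v] this is its norm. *)
Lemma ut_pow (A : ut F N) (v : F) :
  (forall i : 'I_N.+1, (i < N)%N -> band 1 A i = v ^+ (p ^ i)) ->
  mat (A ^+ N)%g = 1 + (\prod_(0 <= r < N) v ^+ (p ^ r)) *: corner.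
Proof.
move=> Av; rewrite matX -[mat A](subrK 1) [_ - _ + _]addrC.
rewrite (_ : (1 + _) ^+ N = 1 + (mat A - 1) ^+ N); last first.
  by have := frob_mx (mat A - 1) k; rewrite -Nk.
have dA := @mat_deg _ _ A; congr (1 + _).
rewrite (degN_corner (degX (n := N) dA)); congr (_ *: _).
rewrite (@leadX _ _ _ N)//= !big_nat; apply: eq_bigr => r /andP[_ rN].
rewrite -[RHS](_ : band 1 A (inord r) = _); last first.
  by rewrite Av inordK// ltnW.
have rE : nat_of_ord (inord r : 'I_N.+1) = r by exact: inordK (ltnW rN).
rewrite ffunE rE addn1; case: insubP => [c _ cE|]; last first.
  by rewrite ltnS rN.
by rewrite /= (_ : c = inord r.+1)//; apply/ord_inj; rewrite cE inordK.
Qed.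

(** The [p] elements of the prime field already exhaust the roots of X^p - X. *)
Lemma frob_fixed (x : F) : x ^+ p = x -> exists u : nat, x = u%:R.
Proof.
move=> xp; have [[u _ ->]|nx] := EM (exists2 u, (u < p)%N & x = u%:R).
  by exists u.
pose s := x :: [seq u%:R | u <- iota 0 p].
have p1 := prime_gt1 p_pr.
have sX : size ('X^p - 'X : {poly F}) = p.+1.
  by rewrite size_polyDl size_polyXn ?size_polyN ?size_polyX.
have X0 : 'X^p - 'X != 0 :> {poly F} by rewrite -size_poly_gt0 sX.
have Rs : all (root ('X^p - 'X)) s.
  apply/allP => y; rewrite in_cons => /predU1P[->|/mapP[u _ ->]].
    by rewrite /root !hornerE xp subrr.
  by rewrite /root !hornerE -(pFrobenius_autE p_char) pFrobenius_aut_nat subrr.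
have Us : uniq s.
  rewrite /= map_inj_in_uniq ?iota_uniq ?andbT; last first.
    move=> i j; rewrite !mem_iota !add0n /= => ip jp.
    wlog ij : i j ip jp / (i <= j)%N.
      by move=> W; case/orP: (leq_total i j) => ij; [|move=> /esym /W ->//]; exact: W.
    move=> /esym/eqP; rewrite -subr_eq0 -natrB// -(dvdn_pcharf p_char) => pji.
    apply/eqP; rewrite eqn_leq ij -subn_eq0; apply: contraTT pji => ji0.
    by rewrite gtnNdvd ?lt0n// (leq_ltn_trans (leq_subr _ _)).
  apply/mapP => -[u]; rewrite mem_iota add0n => up xu; apply: nx.
  by exists u.
by have := max_poly_roots X0 Rs Us; rewrite sX /= size_map size_iota ltnn.
Qed.

(** Frobenius permutes the factors cyclically because v^(p^N) = v, so their product lies in the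
    prime field. *)
Lemma norm_nat (v : F) : v != 0 -> exists u : nat, coprime u p /\
  \prod_(0 <= r < N) v ^+ (p ^ r) = u%:R.
Proof.
move=> v0; set x := \prod_(0 <= r < N) _.
have x0 : x != 0.
  by rewrite /x prodf_seq_neq0; apply/allP => r _; rewrite expf_neq0.
have : x ^+ p = x.
  rewrite {1}/x -prodrXl big_nat_recr//= -exprM -expnSr -cardF expf_card.
  rewrite /x big_nat_recl//= expn0 expr1 mulrC; congr (_ * _).
  by apply: eq_bigr => r _; rewrite -exprM -expnSr.
move=> /frob_fixed[u xu]; exists u; split=> //.
rewrite coprime_sym prime_coprime//; apply: contra x0.
by rewrite (dvdn_pcharf p_char) -xu.
Qed.

Lemma corner2 : corner * corner = 0.
Proof.
apply: deg_eq0; apply: deg_le (degM corner_deg corner_deg).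
by rewrite addnS ltnS leq_addr.
Qed.

(** Products of [corner] with strictly upper triangular matrices vanish for reasons of degree, so 1
    + [corner] is central. *)
Lemma central_corner : exists z : ut F N,
  [/\ forall u, mat (z ^+ u)%g = 1 + u%:R *: corner,
      forall A, (A * z = z * A)%g, (z ^+ p = 1)%g & z <> 1%g].
Proof.
have [|z zE] := @ut_of F N (1 + corner).
  rewrite addrC addKr; exact: deg_le corner_deg.
have zu u : mat (z ^+ u)%g = 1 + u%:R *: corner.
  rewrite matX zE; elim: u => [|u IH]; first by rewrite expr0 scale0r addr0.
  rewrite exprSr IH mulrDr mulr1 mulrDl mul1r -scalerAl corner2 scaler0 addr0.
  by rewrite -addrA -natr1 scalerDl scale1r.
exists z; split=> //.
- move=> A; apply: mat_inj; rewrite !matM zE mulrDr mulrDl mulr1 mul1r.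
  congr (_ + _); rewrite -[mat A](subrK 1) mulrDl mulrDr mul1r mulr1; congr (_ + _).
  have dA := @mat_deg _ _ A.
  rewrite (deg_eq0 (_ : deg N.+1 ((mat A - 1) * corner))); last first.
    exact: degM dA corner_deg.
  rewrite (deg_eq0 (_ : deg N.+1 (corner * (mat A - 1))))//.
  by apply: deg_le (degM corner_deg dA); rewrite addn1.
- by apply: mat_inj; rewrite zu (pcharf0 p_char) scale0r addr0.
- move=> z1; have /eqP := zu 1%N; rewrite expg1 z1 mat1 -subr_eq0 opprD addrA.
  rewrite subrr sub0r oppr_eq0 scale1r => /eqP/matrixP/(_ ord0 ord_max).
  by rewrite !mxE !eqxx => /eqP; rewrite oner_eq0.
Qed.

Lemma ut_pow_p (A : ut F N) : (A ^+ (p ^ k.+1) = 1)%g.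
Proof.
apply: mat_inj; rewrite matX -[mat A](subrK 1) [_ - _ + _]addrC frob_mx.
have dA : deg N.+1 ((mat A - 1) ^+ (p ^ k.+1)).
  apply: deg_le; last exact: degX (mat_deg A).
  by rewrite expnSr -Nk -{1}[N]muln1 ltn_pmul2l ?prime_gt1.
by rewrite (deg_eq0 dA) addr0 mat1.
Qed.

End Powers.

Section PrimeField.
Local Open Scope ring_scope.

(** The field has dimension [N] over its prime field, which leaves room for one basis vector per
    element of [I]. *)
Lemma indep_field (p N : nat) (I : finType) : prime p -> (0 < N)%N ->
  (#|I| <= N)%N ->
  exists (F : finFieldType) (e : I -> F), [/\ p \in [pchar F], #|F| = (p ^ N)%N &
   forall (c : I -> nat), \sum_i e i *+ c i = 0 -> forall i, (p %| c i)%N].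
Proof.
move=> p_pr N0 IN; have [F Fp cF] := pPrimePowerField p_pr N0.
pose R := pPrimeCharType Fp.
have dR : \dim {: (R : vectType 'F_p)} = N by rewrite pprimeChar_dimf (cF : #|R| = _) pfactorK.
pose B := vbasis {: (R : vectType 'F_p)}.
pose r (i : I) : 'I_(\dim {: (R : vectType 'F_p)}) :=
  cast_ord (esym dR) (widen_ord IN (enum_rank i)).
have r_inj : injective r.
  by move=> i i' /cast_ord_inj/(congr1 val) /= E; apply/enum_rank_inj/ord_inj.
have /freeP Bfree := basis_free (vbasisP {: (R : vectType 'F_p)}).
exists F, (fun i => B`_(r i) : F); split=> // c c0 i.
pose kk (j : 'I_(\dim {: (R : vectType 'F_p)})) : 'F_p := \sum_(i | r i == j) (c i)%:R.
have /(_ (r i)) : forall j, kk j = 0.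
  apply: Bfree; rewrite -[RHS]c0.
  rewrite (eq_bigr (fun j => \sum_(i | r i == j) B`_(r i) *+ c i)); last first.
    move=> j _; rewrite scaler_suml; apply: eq_bigr => i' /eqP <-.
    by rewrite scaler_nat.
  by symmetry; exact: (partition_big r xpredT).
rewrite /kk (eq_bigl (pred1 i)); last by move=> i'; rewrite (inj_eq r_inj).
rewrite big_pred1_eq => /eqP; rewrite -(dvdn_pcharf (pchar_Fp p_pr)) //.
Qed.
End PrimeField.

Section IntCoefficients.
Local Open Scope ring_scope.
Context (F : fieldType) (p : nat).
Hypotheses (p_char : p \in [pchar F]).

Lemma mulrz_pchar (x : F) (m : int) : x *~ m = x *+ `|(m %% p)%Z|%N.
Proof.
have p0 : (p != 0 :> int) by rewrite eqz_nat -lt0n prime_gt0// (pcharf_prime p_char).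
rewrite [RHS]pmulrn gez0_abs ?modz_ge0// {1}(divz_eq m p) mulrzDr mulrzA.
by rewrite -[X in X + _]pmulrn (mulrn_pchar p_char) add0r.
Qed.

End IntCoefficients.

(** * Permutations that detect the elements of order p *)

Section SinglePrime.
Local Open Scope group_scope.
Context (Gam : groupType) (g : nat) (a b : nat -> Gam).
Hypotheses (pres : presents g a b) (g_ge2 : (2 <= g)%N).
Context (Q : finGroupType) (theta : Gam -> Q).
Hypotheses (theta_hom : is_hom theta) (theta_surj : forall x, exists c, theta c = x).
Variable p : nat.
Hypothesis p_pr : prime p.

Lemma dvdz_muln (d e n : nat) (m : int) :
  (d %| n * e)%N -> (e %| m)%Z -> (d %| (m *+ n)%R)%Z.
Proof.
move=> dne em; rewrite -mulr_natr natz; apply: dvdz_trans (dvdz_mul em (dvdzz n)).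
by rewrite dvdzE abszM !absz_nat mulnC.
Qed.

Definition order_p : finType := {q : Q | #[q] == p}.

Lemma coset_lifts : exists (X : order_p -> finType) (x0 : forall q, X q)
    (eta : forall q, Gam -> wreath (addg int) (X q)),
  forall q, [/\ is_hom (eta q),
  forall c, theta c = 1 -> (eta q c).2 = 1 /\
    forall x, (p %| ((eta q c).1 x : int))%Z &
  forall c, theta c = val q -> (eta q c).2 (x0 q) = x0 q /\
    (p %| ((eta q c).1 (x0 q) - 1 : int)%R)%Z].
Proof.
pose T := {X : finType & (X * (Gam -> wreath (addg int) X))%type}.
pose R (q : order_p) (t : T) := [/\ is_hom (tagged t).2,
  forall c, theta c = 1 -> ((tagged t).2 c).2 = 1 /\
    forall x, (p %| (((tagged t).2 c).1 x : int))%Z &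
  forall c, theta c = val q -> ((tagged t).2 c).2 (tagged t).1 = (tagged t).1 /\
    (p %| (((tagged t).2 c).1 (tagged t).1 - 1 : int)%R)%Z].
have [|t tE] := @choice _ _ R.
  move=> [q /= qp]; have [X [x0 [eta]]] := coset_lift pres theta_hom theta_surj q.
  by rewrite (eqP qp) => H; exists (existT _ X (x0, eta)).
exists (fun q => tag (t q)), (fun q => (tagged (t q)).1), (fun q => (tagged (t q)).2).
exact: tE.
Qed.

Lemma wreathZX (X : finType) (w : wreath (addg int) X) n x : w.2 x = x ->
  (w ^+ n).1 x = ((w.1 x : int) *+ n)%R.
Proof. by move=> wx; have [-> _] := fix_wreathX n wx; rewrite addgX. Qed.

Lemma wreath_snd1X (G : groupType) (X : finType) (w : wreath G X) n :
  w.2 = 1 -> (w ^+ n).2 = 1.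
Proof. by move=> w1; elim: n => [//|n IH]; rewrite expgS wreathM2 w1 IH mulg1. Qed.

(** The set is the last quotient [P] times the unitriangular group; [Gam] acts by right translations
    twisted by the lift, and [z] by translation by a central element. In [M], the first [S] p-th
    powers lead into [L n] and [k] more form the [N]-th power. *)
Lemma single_prime : exists (Y : finType) (Pi : Gam -> {perm Y}) (z : {perm Y}) (M : nat),
  [/\ [/\ is_hom Pi, (0 < M)%N, forall c, Pi c * z = z * Pi c, z ^+ p = 1 &
      exists y, z y <> y],
      forall c, #[theta c] = p -> forall y, exists u,
        coprime u p /\ Pi (c ^+ (p ^ M)%N) y = (z ^+ u) y &
      forall c, theta c = 1 -> Pi (c ^+ (p ^ M.+1)%N) = 1].
Proof.
have p1 := prime_gt1 p_pr; have p0 := prime_gt0 p_pr.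
(* [N] = p^k is a power of [p] for the Frobenius identity and at least [k], to provide [k]
   independent coefficients. *)
pose k := #|order_p|; have [n nk] : exists n, n.+1 = (p ^ k)%N.
  by exists (p ^ k).-1; rewrite prednK// expn_gt0 p0.
have [|F [e [p_char cardF e_free]]] := @indep_field p n.+1 order_p p_pr (ltn0Sn _).
  by rewrite nk; exact/ltnW/ltn_expl.
have [X [x0 [eta etaE]]] := coset_lifts.
pose d := #|Q|; have d0 : (0 < d)%N by apply/card_gt0P; exists 1.
have dm : (d < p ^ d)%N by exact: ltn_expl.
have m1 : (1 < p ^ d)%N by exact: leq_ltn_trans d0 dm.
(* The modulus p^d is a power of [p], so that a p-power kills the shifts, and exceeds [d], so that
   the commutator of [d]-th powers survives. *)
have [h [h_hom hm hs2 hsd [xs hs1]]] := shift_wreath pres g_ge2 m1 d0 dm.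
(* [e0] is the p-adic valuation of the value [-d] of the commutator. In [S], [d] steps trivialise
   the shift and the rest reach the modulus that defines [L n]. *)
pose e0 := logn p d; pose S := (d + e0 + n.+1)%N.
have S0 : (0 < S)%N by rewrite /S !addnS.
(* Only the condition on [h] depends on [j]. Divisibility of the coset cocycles by p^S is imposed
   from the start, for the sake of [phi]. *)
pose L j c := theta c = 1 /\
  ((forall q, (eta q c).2 = 1 /\ forall x, ((p ^ S)%N %| ((eta q c).1 x : int))%Z) /\
   ((h c).2 = 1 /\ forall x, ((p ^ (e0 + j.+1))%N %| ((h c).1 x : int))%Z)).
have pX i : (0 < i)%N -> (1 < p ^ i)%N by move=> i0; rewrite -(exp1n i) ltn_exp2r.
have L_fin j : finker (L j).
  apply: finkerI; first exact: finker_hom.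
  apply: finkerI.
    by apply: finker_all => q; apply: finker_wreath; [case: (etaE q)|exact: pX].
  by apply: finker_wreath => //; rewrite pX// addnS.
have L_dec j c : L j.+1 c -> L j c.
  move=> [h1 [h2 [h3 h4]]]; split=> //; split=> //; split=> // x.
  apply: dvdz_trans (h4 x); rewrite dvdzE !absz_nat.
  by apply: dvdn_exp2l; rewrite leq_add2l.
have thd c : theta (c ^+ d) = 1.
  by rewrite (homX theta_hom) -[d]cardsT expg_cardG ?inE.
pose k0 := shift_comm a d.
have thk0 : theta k0 = 1.
  by rewrite /k0 /shift_comm !theta_hom !(homV theta_hom) !thd !invg1 !mulg1.
(* The cocycles are additive on the kernel of [theta], so they vanish on a commutator of elements of
   it. *)
have etak0 q x : (eta q k0).1 x = 0%R.
  have [hq hq1 _] := etaE q; rewrite /k0 /shift_comm !hq !(homV hq).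
  have [A1 _] := hq1 _ (thd (a 0)); have [B1 _] := hq1 _ (thd (a 1)).
  rewrite !wreathM1 !wreathM2 !wreathV1 !wreathV2 A1 B1 !mulg1 !invg1 !perm1.
  by rewrite mulg1 perm1 !addgM !addgV addrAC addrK subrr.
pose w j := k0 ^+ (p ^ j.+1)%N.
have hwj i x : (h (k0 ^+ i)).1 x = (((h k0).1 x : int) *+ i)%R.
  by rewrite (homX h_hom) wreathZX// hs2 perm1.
have wL' i j : (j < i)%N -> L j (k0 ^+ (p ^ i)%N).
  move=> ji; split; first by rewrite (homX theta_hom) thk0 expg1n.
  split=> [q|].
    have [hq hq1 _] := etaE q; have [e2 _] := hq1 _ thk0.
    rewrite (homX hq); split=> [|x]; first exact: wreath_snd1X.
    by rewrite wreathZX ?e2 ?perm1// etak0 mul0rn dvdz0.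
  split=> [|x]; first by rewrite (homX h_hom) wreath_snd1X.
  rewrite hwj; apply: dvdz_muln; last exact: hsd.
  rewrite expnD mulnC; apply: dvdn_mul; last exact: pfactor_dvdnn.
  exact: dvdn_exp2l.
have wL j : L j (w j) by exact: wL'.
(* At [xs] the value is -d p^(j+1), of valuation exactly e0 + j + 1. *)
have wnL j : ~ L j.+1 (w j).
  move=> [_ [_ [_ /(_ xs)]]]; rewrite hwj hs1 mulNrn -mulr_natr natz.
  rewrite dvdzE abszN abszM !absz_nat addnS -addSn expnD.
  rewrite dvdn_pmul2r ?expn_gt0 ?p0// pfactor_dvdn// /e0 ltnn.
  by [].
have wpL j : L j.+1 (w j ^+ p).
  by rewrite /w -expgM -expnSr; exact: wL'.
pose v (t : Gam) (q : order_p) : int := (((eta q t).1 (x0 q) : int) %/ (p ^ S)%N)%Z.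
pose phi (t : Gam) : F := (\sum_q e q *~ v t q)%R.
have phiM t t' : L 0 t -> L 0 t' -> phi (t * t') = (phi t + phi t')%R.
  move=> [_ [Lt _]] [_ [Lt' _]]; rewrite /phi -big_split; apply: eq_bigr => q _.
  have [hq _ _] := etaE q; have [t2 t1] := Lt q; have [_ t1'] := Lt' q.
  rewrite /v hq wreathM1 t2 perm1 addgM divzDl ?mulrzDr//; exact: t1.
(* At the base point of the cocycle for [theta c], [c] takes a value congruent to 1 modulo [p].
   Hence one coefficient of [phi] is 1 modulo [p], and independence excludes cancellation. *)
have phi_neq0 c : #[theta c] = p -> phi (c ^+ (p ^ S)%N) != 0%R.
  move=> tc; pose q0 : order_p := Sub (theta c) (introT eqP tc).
  set t := c ^+ (p ^ S)%N.
  apply/eqP => phi0; have := e_free (fun q => `|(v t q %% p)%Z|%N) _ q0.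
  have -> : (\sum_q e q *+ `|(v t q %% p)%Z|%N = 0)%R.
    by rewrite -[RHS]phi0; apply: eq_bigr => q _; rewrite -(mulrz_pchar p_char).
  move=> /(_ erefl); have [hq _ /(_ c erefl)[cx c1]] := etaE q0.
  rewrite /v /t (homX hq) wreathZX// -mulr_natr natz mulzK; last first.
    by rewrite eqz_nat -lt0n expn_gt0 p0.
  have := c1; rewrite -eqz_mod_dvd => /eqP ->.
  by rewrite modz_nat absz_nat modn_small// dvdn1 gtn_eqF.
have SE : (S = (S - d) + d)%N by rewrite subnK// /S -addnA leq_addr.
have L_of c : (forall q, (eta q (c ^+ (p ^ S)%N)).2 = 1 /\
    forall x, ((p ^ S)%N %| ((eta q (c ^+ (p ^ S)%N)).1 x : int))%Z) ->
    theta (c ^+ (p ^ S)%N) = 1 -> L n (c ^+ (p ^ S)%N).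
  move=> h1 h2; split=> //; split=> //.
  have hE : h (c ^+ (p ^ S)%N) = h (c ^+ (p ^ d)%N) ^+ (p ^ (S - d))%N.
    by rewrite -(homX h_hom) -expgM -expnD addnC -SE.
  rewrite hE; split=> [|x]; first exact: wreath_snd1X.
  rewrite wreathZX ?hm ?perm1// -mulr_natr natz dvdz_mull//.
  rewrite dvdzE !absz_nat; apply: dvdn_exp2l.
  by rewrite /S -!addnA addKn.
have LK c : theta c = 1 -> L n (c ^+ (p ^ S)%N).
  move=> tc; apply: L_of; last by rewrite (homX theta_hom) tc expg1n.
  move=> q; have [hq hq1 _] := etaE q; have [c2 _] := hq1 _ tc.
  rewrite (homX hq); split=> [|x]; first exact: wreath_snd1X.
  by rewrite wreathZX ?c2 ?perm1// -mulr_natr natz dvdz_mull.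
have Lp c : #[theta c] = p -> L n (c ^+ (p ^ S)%N).
  move=> tc; have pE : (p ^ S = p * p ^ S.-1)%N by rewrite -expnS prednK.
  have tcp : theta (c ^+ p) = 1 by rewrite (homX theta_hom) -tc expg_order.
  apply: L_of; last first.
    by rewrite pE expgM (homX theta_hom) tcp expg1n.
  move=> q; have [hq hq1 _] := etaE q; have [c2 c1] := hq1 _ tcp.
  rewrite pE expgM (homX hq); split=> [|x]; first exact: wreath_snd1X.
  rewrite wreathZX ?c2 ?perm1// -mulr_natr natz.
  by rewrite PoszM dvdz_mul.
pose psi (t : Gam) : {ffun 'I_n.+2 -> F} :=
  [ffun i : 'I_n.+2 => if (i < n.+1)%N then (phi t ^+ (p ^ i)%N)%R else 0%R].
have psiM x y : L 0 x -> L 0 y -> psi (x * y) = (psi x + psi y)%R.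
  move=> Lx Ly; apply/ffunP => i; rewrite !ffunE; case: ifP => _; last by rewrite addr0.
  by rewrite phiM// exprDn_pchar// pnatX (pnatE _ p_pr) p_char.
have psiN x : psi x ord_max = 0%R by rewrite ffunE ltnn.
have [P [f [Psi [hf hPsi fk Psi2 Psi1]]]] := lift_tower pres p_pr p_char
  L_fin L_dec wL wnL wpL psiM psiN.
have [z [zE zC zp z1]] := central_corner n p_char.
pose T := (P * ut F n.+1)%type.
pose act (c : Gam) (t : T) : T := (t.1 * f c, t.2 * (Psi c).1 t.1).
have act_inj c : injective (act c).
  move=> [x s] [y s'] E; have xy : x = y.
    by apply: (mulIg (f c)); exact: (congr1 fst E).
  by have := congr1 snd E; rewrite /act /= -xy => /mulIg <-.
have zact_inj : injective (fun t : T => (t.1, t.2 * z) : T).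
  by move=> [x s] [y s'] E; congr pair;
    [exact: (congr1 fst E)|apply: (mulIg z); exact: (congr1 snd E)].
pose Pi c : {perm T} := perm (@act_inj c); pose zz : {perm T} := perm zact_inj.
have zzX u x s : (zz ^+ u) (x, s) = (x, s * z ^+ u).
  elim: u s => [|u IH] s; first by rewrite !expg0 perm1 mulg1.
  by rewrite expgS permM permE IH expgS mulgA.
have hPi : is_hom Pi.
  move=> c c'; apply/permP => -[x s]; rewrite permM !permE /act /= hf hPsi.
  by rewrite wreathM1 Psi2 regularE !mulgA.
have PiL c x s i : L n c -> Pi (c ^+ i) (x, s) = (x, s * (Psi c).1 x ^+ i).
  move=> /fk fc; rewrite permE /act /= (homX hf) fc expg1n mulg1 (homX hPsi).
  have wx : (Psi c).2 x = x by rewrite Psi2 regularE fc mulg1.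
  by have [-> _] := fix_wreathX i wx.
exists T, Pi, zz, (S + k)%N; split.
- split=> //; first by rewrite ltn_addr.
  + by move=> c; apply/permP => -[x s]; rewrite !permM !permE /act /= -!mulgA zC.
  + by apply/permP => -[x s]; rewrite zzX zp mulg1 perm1.
  + exists (1, 1); rewrite permE /= mul1g => -[]; exact: z1.
- move=> c tc [x s]; have Lc := Lp c tc; have fc := (fk _).1 Lc.
  have [dd bd] := Psi1 _ x fc.
  (* A conjugate of [c] again has an image of order [p], so the value is nonzero at every point,
     whatever the conjugator. *)
  have vn0 : phi (dd * c ^+ (p ^ S)%N * dd^-1) != 0%R.
    have -> : dd * c ^+ (p ^ S)%N * dd^-1 = (dd * c * dd^-1) ^+ (p ^ S)%N.
      elim: (p ^ S)%N => [|i IH]; first by rewrite !expg0 mulg1 mulgV.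
      by rewrite !expgS -IH !mulgA mulgKV.
    apply: phi_neq0; rewrite !theta_hom (homV theta_hom) -tc.
    by rewrite -[RHS](orderJ (theta c) ((theta dd)^-1)) conjgE invgK mulgA.
  have [u [up uE]] := norm_nat p_pr p_char cardF vn0.
  exists u; split=> //; rewrite expnD expgM PiL// zzX; congr (_, _ * _).
  apply: (@mat_inj F n.+1); rewrite zE -nk -uE; apply: (ut_pow p_pr p_char nk).
  by move=> i iN; rewrite bd ffunE iN.
- move=> c tc; apply/permP => -[x s]; have Lc := LK c tc.
  rewrite -addnS expnD expgM PiL// perm1.
  by rewrite (ut_pow_p p_pr p_char nk) mulg1.
Qed.
End SinglePrime.

(** * Torsion affine representations *)


Section CommonDenominator.
Local Open Scope ring_scope.

Lemma common_denominator n (v : 'I_n -> rat) :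
  exists2 d : int, d != 0 & exists w : 'I_n -> int, forall i, d%:~R * v i = (w i)%:~R.
Proof.
exists (\prod_i denq (v i)); first by apply/prodf_neq0 => i _; rewrite denq_neq0.
exists (fun i => (\prod_(j | j != i) denq (v j)) * numq (v i)) => i.
rewrite (bigD1 i)//= !rmorphM /= numqE mulrAC mulrC; congr (_ * _).
exact: mulrC.
Qed.

End CommonDenominator.

Section Kernel.
Local Open Scope ring_scope.
Context (Y : finType) (op : (Y -> int) -> Y -> int).
Hypothesis opB : forall f h, op (fun y => f y - h y) =1 fun y => op f y - op h y.
Hypothesis op_neq0 : exists f y, op f y <> 0.

Lemma op_ext f h : f =1 h -> op f =1 op h.
Proof. by move=> /funext ->. Qed.

Lemma op0 : op (fun=> 0) =1 fun=> 0.
Proof.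
move=> y; have := opB (fun=> 0) (fun=> 0) y; rewrite [RHS]subrr => E; rewrite -[RHS]E.
by apply: op_ext => z; rewrite subrr.
Qed.

Lemma opN f : op (fun y => - f y) =1 fun y => - op f y.
Proof.
move=> y; have := opB (fun=> 0) f y; rewrite op0 [RHS]sub0r => E; rewrite -[RHS]E.
by apply: op_ext => z; rewrite sub0r.
Qed.

Lemma opD f h : op (fun y => f y + h y) =1 fun y => op f y + op h y.
Proof.
move=> y; have := opB f (fun y => - h y) y; rewrite opN opprK => E; rewrite -[RHS]E.
by apply: op_ext => z; rewrite opprK.
Qed.

Lemma op_sum (I : Type) (r : seq I) (F : I -> Y -> int) :
  op (fun y => \sum_(i <- r) F i y) =1 fun y => \sum_(i <- r) op (F i) y.
Proof.
elim: r => [|i r IH] y.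
  by rewrite big_nil -[RHS](op0 y); apply: op_ext => z; rewrite big_nil.
by rewrite big_cons -IH -opD; apply: op_ext => z; rewrite big_cons.
Qed.

Lemma opMz f (m : int) : op (fun y => f y * m) =1 fun y => op f y * m.
Proof.
have opMn (n : nat) y : op (fun y => f y *+ n) y = op f y *+ n.
  elim: n y => [|n IH] y.
    by rewrite mulr0n -[RHS](op0 y); apply: op_ext => z; rewrite mulr0n.
  by rewrite mulrS -IH -opD; apply: op_ext => z; rewrite mulrS.
move=> y; case: m => n.
  rewrite -[in RHS]natz mulr_natr -opMn; apply: op_ext => z.
  by rewrite -natz mulr_natr.
rewrite NegzE mulrN -[in RHS]natz mulr_natr -opMn -opN; apply: op_ext => z.
by rewrite mulrN -natz mulr_natr.
Qed.

Let n := #|Y|.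
Let row_of (f : Y -> int) : 'rV[rat]_n := \row_i (f (enum_val i))%:~R.
Let B : 'M[rat]_n := \matrix_(i, j)
  (op (fun y => (y == enum_val i)%:Z) (enum_val j))%:~R.
Let C (c : Y -> Y) : 'M[rat]_n := \matrix_(i, j) (c (enum_val j) == enum_val i)%:R.

Lemma sum_enum (V : nmodType) (F : Y -> V) : \sum_(i < n) F (enum_val i) = \sum_y F y.
Proof. by rewrite -big_enum_val. Qed.

Lemma row_op f : row_of (op f) = row_of f *m B.
Proof.
apply/rowP => j; rewrite !mxE.
rewrite (eq_bigr (fun i => (f (enum_val i) *
    op (fun y => (y == enum_val i)%:Z) (enum_val j))%:~R)); last first.
  by move=> i _; rewrite !mxE rmorphM.
rewrite -rmorph_sum /= (sum_enum (fun z => f z *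
  op (fun y => (y == z)%:Z) (enum_val j))).
congr (_%:~R); transitivity (op (fun y => \sum_z f z * (y == z)%:Z) (enum_val j)).
  apply: op_ext => y.
  rewrite (bigD1 y)//= eqxx mulr1 big1 ?addr0// => z zy.
  by rewrite eq_sym (negPf zy) mulr0.
rewrite op_sum; apply: eq_bigr => z _; rewrite mulrC -opMz.
by apply: op_ext => y; rewrite mulrC.
Qed.

Lemma row_comp f c : row_of (fun y => f (c y)) = row_of f *m C c.
Proof.
apply/rowP => j; rewrite !mxE.
rewrite (eq_bigr (fun i => (f (enum_val i) * (c (enum_val j) == enum_val i)%:Z)%:~R)).
  rewrite -rmorph_sum /= (sum_enum (fun z => f z * (c (enum_val j) == z)%:Z)).
  rewrite (bigD1 (c (enum_val j)))//= eqxx mulr1 big1 ?addr0// => z zy.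
  by rewrite eq_sym (negPf zy) mulr0.
by move=> i _; rewrite !mxE rmorphM.
Qed.

Lemma row_inj f h : row_of f = row_of h -> f =1 h.
Proof.
move=> /rowP E y; have := E (enum_rank y); rewrite !mxE enum_rankK.
by move/eqP; rewrite eqr_int => /eqP.
Qed.

(** A rank count over the rationals: the condition factors through the matrix [B] of [op], so its
    rank is at most that of [B], while the pair of values of [op] has twice that rank. Some solution
    therefore has a nonzero value; its denominators are then cleared. *)
Lemma op_kernel (c1 c2 c3 c4 : Y -> Y) : exists f f',
  op (fun y => f (c1 y) - f (c2 y) + (f' (c3 y) - f' (c4 y))) =1 (fun=> 0) /\
  exists y, op f y <> 0 \/ op f' y <> 0.
Proof.
pose E : 'M[rat]_(n + n, n) := col_mx ((C c1 - C c2) *m B) ((C c3 - C c4) *m B).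
pose BB : 'M[rat]_(n + n, n + n) := block_mx B 0 0 B.
have rE : (\rank E <= \rank B)%N.
  by apply/mxrankS; rewrite col_mx_sub !submxMl.
have rBB : (\rank BB = \rank B + \rank B)%N by rewrite rank_diag_block_mx.
have rB : (0 < \rank B)%N.
  rewrite lt0n mxrank_eq0; apply/eqP => B0.
  have [f [y fy]] := op_neq0; apply: fy.
  have := row_op f; rewrite B0 mulmx0 => /rowP/(_ (enum_rank y)).
  by rewrite !mxE enum_rankK => /eqP; rewrite intr_eq0 => /eqP.
have : kermx E *m BB != 0.
  apply/eqP => K0; have /mxrankS : (kermx E <= kermx BB)%MS by apply/sub_kermxP.
  rewrite !mxrank_ker rBB; have := rank_leq_row B; lia.
move=> /matrix0Pn[i [j K1]]; pose v := row i (kermx E).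
have vE : v *m E = 0 by rewrite -row_mul mulmx_ker row0.
have [d d0 [w wE]] := common_denominator (fun k => v 0 k).
pose f y := w (lshift n (enum_rank y)); pose f' y := w (rshift n (enum_rank y)).
have dv : d%:~R *: v = row_mx (row_of f) (row_of f').
  apply/rowP => k; rewrite mxE wE; case: (split_ordP k) => l ->.
    by rewrite row_mxEl mxE /f enum_valK.
  by rewrite row_mxEr mxE /f' enum_valK.
exists f, f'; split.
  apply: row_inj; rewrite row_op; transitivity (d%:~R *: v *m E); last first.
    by rewrite -scalemxAl vE scaler0; apply/rowP => k; rewrite !mxE.
  rewrite dv mul_row_col !mulmxA -mulmxDl; congr (_ *m B).
  rewrite !mulmxBr -!row_comp; apply/rowP => k; rewrite !mxE.
  by rewrite !rmorphD /= !rmorphN.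
have dBB : (row_mx (row_of (op f)) (row_of (op f'))) 0 j != 0.
  have -> : row_mx (row_of (op f)) (row_of (op f')) = d%:~R *: v *m BB.
    by rewrite dv mul_row_block !mulmx0 addr0 add0r !row_op.
  by rewrite -scalemxAl mxE mulf_neq0 ?intr_eq0// -row_mul mxE.
move: dBB; case: (split_ordP j) => l ->; rewrite ?row_mxEl ?row_mxEr mxE intr_eq0.
  by move=> /eqP H; exists (enum_val l); left.
by move=> /eqP H; exists (enum_val l); right.
Qed.
End Kernel.

Section AffineMatrix.
Local Open Scope classical_set_scope.
Local Open Scope ring_scope.
Context (Y : finType).
Local Notation W := (wreath (addg int) Y).
Local Notation d := #|{: option Y}|.

(** Affine maps made linear by one more coordinate: the column of [None] holds the translation. *)
Definition affine_entry (w : W) (u v : option Y) : int :=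
  match u, v with
  | Some y, Some y' => (w.2 y == y')%:Z
  | Some y, None => w.1 y
  | None, Some _ => 0
  | None, None => 1
  end.

Definition affine_mx (w : W) : 'M[int]_d :=
  \matrix_(i, j) affine_entry w (enum_val i) (enum_val j).

Lemma affine_mxM (w w' : W) : affine_mx (w * w')%g = affine_mx w *m affine_mx w'.
Proof.
apply/matrixP => i j; rewrite !mxE.
rewrite (eq_bigr (fun l => affine_entry w (enum_val i) (enum_val l) *
   affine_entry w' (enum_val l) (enum_val j))); last by move=> l _; rewrite !mxE.
rewrite (sum_enum (fun l : option Y => affine_entry w (enum_val i) l *
   affine_entry w' l (enum_val j))).
case: (enum_val i) (enum_val j) => [y|] v /=.
  rewrite (bigD1 (Some (w.2 y)))//= eqxx mul1r (bigD1 None)//= big1 ?addr0.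
    case: v => [y'|] /=; first by rewrite permM mulr0 addr0.
    by rewrite ffunE mulr1 addrC.
  case=> [y'|]; last by rewrite andbF.
  by rewrite (inj_eq Some_inj) eq_sym => /andP[/negPf -> _] /=; rewrite mul0r.
rewrite (bigD1 None)//= mul1r big1 ?addr0; last by case=> // y _; rewrite mul0r.
by case: v.
Qed.

Lemma affine_mx1 : affine_mx 1%g = 1%:M.
Proof.
apply/matrixP => i j; rewrite !mxE -(inj_eq enum_val_inj).
case: (enum_val i) (enum_val j) => [y|] [y'|] //=; last by rewrite ffunE.
by rewrite perm1 (inj_eq Some_inj); case: eqP.
Qed.

Lemma affine_mx_inj : injective affine_mx.
Proof.
move=> w w' /matrixP E.
have EE u v : affine_entry w u v = affine_entry w' u v.
  by have := E (enum_rank u) (enum_rank v); rewrite !mxE !enum_rankK.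
apply: wreathP => [y|]; first exact: (EE (Some y) None).
apply/permP => y; have /= := EE (Some y) (Some (w.2 y)); rewrite eqxx.
by case: eqP => // ->.
Qed.

Lemma affine_mxX w n : affine_mx (w ^+ n)%g = affine_mx w ^+ n.
Proof.
elim: n => [|n IH]; first by rewrite expg0 affine_mx1.
by rewrite expgS affine_mxM IH exprS.
Qed.

Lemma affine_mx_unit w : affine_mx w \in unitmx.
Proof.
have /mulmx1_unit[] // : affine_mx w *m affine_mx w^-1%g = 1%:M.
by rewrite -affine_mxM mulgV affine_mx1.
Qed.

Lemma affine_rep (Gam : groupType) (eta : Gam -> W) (A : Gam -> Prop) : is_hom eta ->
  infinite_set (range eta) ->
  (forall x, A x -> exists n : nat, (0 < n)%N /\ (eta x ^+ n = 1)%g) ->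
  exists (n : nat) (rho : Gam -> 'M[int]_n), [/\ (1 <= n)%N,
        forall x, rho x \in unitmx,
        forall x y, rho (x * y)%g = rho x *m rho y,
        infinite_set (range rho) &
        forall x, A x -> exists n : nat, (0 < n)%N /\ rho x ^+ n = 1%:M].
Proof.
move=> eta_hom inf tor; exists d, (affine_mx \o eta); split.
- by apply/card_gt0P; exists None.
- by move=> x; exact: affine_mx_unit.
- by move=> x y; rewrite /= eta_hom affine_mxM.
- apply: contra_not inf => fin.
  have [G GK] : exists G : 'M[int]_d -> W, cancel affine_mx G.
    have H (M : 'M[int]_d) : exists w : W, forall w', affine_mx w' = M -> w' = w.
      have [[w <-]|nw] := EM (exists w, affine_mx w = M).
        by exists w => w' /affine_mx_inj.
      by exists 1%g => w' w'M; case: nw; exists w'.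
    by have [G GE] := choice H; exists G => w; rewrite -(GE _ w).
  have -> : range eta = G @` range (affine_mx \o eta).
    by rewrite image_comp; congr (_ @` _); apply/funext => x; rewrite /= GK.
  exact: finite_image.
- move=> x /tor[n [n0 xn]]; exists n; split=> //.
  by rewrite -affine_mxX xn affine_mx1.
Qed.

End AffineMatrix.

(** * Combining the primes *)

Section Combine.
Local Open Scope group_scope.
Context (Gam : groupType) (g : nat) (a b : nat -> Gam).
Hypotheses (pres : presents g a b) (g_ge2 : (2 <= g)%N).
Context (Q : finGroupType) (theta : Gam -> Q).
Hypotheses (theta_hom : is_hom theta) (theta_surj : forall x, exists c, theta c = x).

(* B kills the image of ker theta; when theta c has order p, a translation by a
   vector in the range of op averages to 0 over the powers of c. *)
Definition good (D : seq nat) : Prop :=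
  exists (Y : finType) (Pi : Gam -> {perm Y}) (op : (Y -> int) -> Y -> int) (B : nat),
  [/\ is_hom Pi,
      forall f h, op (fun y => f y - h y)%R =1 (fun y => op f y - op h y)%R,
      forall c f, op (fun y => f (Pi c y)) =1 fun y => op f (Pi c y),
      exists f y, op f y <> 0%R &
  [/\ (forall q, prime q -> q %| B -> q \in D)%N,
      forall c, theta c = 1 -> Pi (c ^+ B) = 1 &
      forall p, p \in D -> exists j, (p %| j)%N /\
        forall c, #[theta c] = p -> forall t, coprime t p -> forall f y,
        (\sum_(i < p) op f (Pi (c ^+ (j * t * i)%N)%g y) = 0)%R]].

Lemma good_nil : good [::].
Proof.
exists bool, (fun=> 1), id, 1%N; split.
- by move=> c d; rewrite mulg1.
- by [].
- by [].
- by exists (fun=> 1%R), true.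
split=> // q /prime_gt1 q1; rewrite dvdn1 => /eqP q1'.
by rewrite q1' in q1.
Qed.

Lemma sum_cyclic (p v : nat) (F : nat -> int) : (forall i, F (i + p) = F i)%N ->
  (\sum_(i < p) F (i + v)%N = \sum_(i < p) F i)%R.
Proof.
move=> Fp; elim: v => [|v IH]; first by apply: eq_bigr => i _; rewrite addn0.
rewrite -IH; case: p Fp {IH} => [|p] Fp; first by rewrite !big_ord0.
rewrite big_ord_recr big_ord_recl /= addrC add0n; congr (_ + _)%R.
  by rewrite -(Fp v); congr F; rewrite addnS addnC addnS.
by apply: eq_bigr => i _; rewrite /bump /= add1n addSnnS.
Qed.

(** [z] is a power [v] of [z ^+ u], so the second sum is the first with its index shifted by [v]
    around a cycle of length [p]. *)
Lemma sum_twist (Y : finType) (z : {perm Y}) p u (f : Y -> int) y :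
  prime p -> z ^+ p = 1 -> coprime u p ->
  (\sum_(i < p) (f ((z ^+ (u * i)%N)%g y) - f (z ((z ^+ (u * i)%N)%g y))) = 0)%R.
Proof.
move=> p_pr zp up; rewrite sumrB.
pose v := expg_invn <[z]> u.
have zv : (z ^+ u) ^+ v = z.
  apply: (expgK (G := <[z]>%G)); last exact: cycle_id.
  by apply: (@coprime_dvdl _ p); [rewrite order_dvdn zp|rewrite coprime_sym].
rewrite [X in (_ - X)%R](eq_bigr (fun i : 'I_p => f ((z ^+ (u * (i + v))%N) y))).
  rewrite (@sum_cyclic p v (fun i => f ((z ^+ (u * i)%N) y))) ?subrr// => i.
  by rewrite mulnDr expgnDr (mulnC u p) (expgM z p u) zp expg1n mulg1.
by move=> i _; rewrite mulnDr expgnDr permM expgM zv.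
Qed.

(** The new operator is the tensor product of [op] with 1 - z on the product of the two sets. *)
Lemma good_cons p D : prime p -> all prime D -> p \notin D -> good D -> good (p :: D).
Proof.
move=> p_pr D_pr pD [Y [Pi [op [B [hPi opB opPi [f0 [y0 fy0]] [BD KB Dj]]]]]].
have [Y' [Pi' [z [M [[hPi' M0 zC zp [y1 zy1]] Mp MK]]]]] :=
  single_prime pres g_ge2 theta_hom theta_surj p_pr.
have op1 f h : f =1 h -> op f =1 op h by exact: op_ext.
pose T := (Y * Y')%type.
pose act c (t : T) : T := (Pi c t.1, Pi' c t.2).
have act_inj c : injective (act c).
  move=> [x s] [y s'] E; congr pair; apply: perm_inj.
    exact: (congr1 fst E).
  exact: (congr1 snd E).
pose PP c : {perm T} := perm (@act_inj c).
have PPE c x s : PP c (x, s) = (Pi c x, Pi' c s) by rewrite permE.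
pose op' (f : T -> int) (t : T) : int :=
  (op (fun y => f (y, t.2)) t.1 - op (fun y => f (y, z t.2)) t.1)%R.
have zCX u c s : (z ^+ u) (Pi' c s) = Pi' c ((z ^+ u) s).
  by rewrite -!permM; congr (fun_of_perm _ s); apply: commuteX => //; exact: zC.
have pB : coprime B p.
  rewrite coprime_sym prime_coprime//; apply: contra pD => pB.
  exact: BD.
exists T, PP, op', (B * p ^ M.+1)%N; split.
- move=> c d; apply/permP => -[x s]; rewrite permM !PPE hPi hPi' !permM.
  by [].
- move=> f h [y s]; rewrite /op' /= !opB; lia.
- move=> c f [y s]; rewrite /op' PPE /=; congr (_ - _)%R.
    by rewrite -opPi; apply: op1 => x; rewrite PPE.
  rewrite -opPi; apply: op1 => x; rewrite PPE.
  by have := zCX 1%N c s; rewrite expg1 => ->.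
(* The test function is supported over [y1], which [z] moves, so the subtracted term vanishes
   there. *)
- exists (fun t : T => if t.2 == y1 then f0 t.1 else 0%R), (y0, y1).
  rewrite /op' /= eqxx; have /negPf -> : z y1 != y1 by apply/eqP.
  by rewrite (op0 opB) subr0.
split.
- move=> q q_pr; rewrite Euclid_dvdM// in_cons => /orP[/BD ->//|].
    by rewrite orbT.
  by rewrite Euclid_dvdX// => /andP[qp _]; rewrite (dvdn_prime2 q_pr p_pr) in qp *; rewrite qp.
- move=> c tc; apply/permP => -[x s]; rewrite PPE perm1; congr pair.
    by rewrite expgM (homX hPi) KB// expg1n perm1.
  by rewrite mulnC expgM (homX hPi') MK// expg1n perm1.
move=> p'; rewrite in_cons => /predU1P[->|p'D].
  (* The power of [p] leads into the kernel of [theta], where [B] kills the action on [Y]. On [Y']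
     there remain powers of [z], with exponents prime to [p] because [p] does not divide [B]. *)
  exists (p ^ M * B)%N; split; first by rewrite dvdn_mulr// dvdn_exp.
  move=> c tc t tp f [y s].
  have tcM : theta (c ^+ (p ^ M)%N) = 1.
    by rewrite (homX theta_hom) -(prednK M0) expnS expgM -{1}tc expg_order expg1n.
  have [u [up uE]] := Mp c tc s.
  have PE i : PP (c ^+ (p ^ M * B * t * i)%N) (y, s) = (y, (z ^+ (u * (B * t) * i)%N) s).
    rewrite PPE -!mulnA expgM; congr pair.
      by rewrite expgM (homX hPi) KB// expg1n perm1.
    move: (B * (t * i))%N => m.
    elim: m => [|m IH]; first by rewrite expg0 muln0 expg0 (hom1 hPi') !perm1.
    by rewrite expgSr hPi' permM IH -zCX uE -permM -expgnDr mulnS.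
  under eq_bigr do rewrite PE /op' /=.
  apply: (@sum_twist Y' z p (u * (B * t)) (fun s => op (fun y => f (y, s)) y) s) => //.
  by rewrite coprimeMl up coprimeMl pB.
(* For an old prime, [j] already leads into the kernel of [theta], so p^(M+1) kills the action on
   [Y']; on [Y] this factor is absorbed by the parameter [t] of [good]. *)
have [j [p'j jE]] := Dj p' p'D; exists (j * p ^ M.+1)%N; split; first exact: dvdn_mulr.
move=> c tc t tp f [y s].
have tcj : theta (c ^+ j) = 1.
  by have /dvdnP[m ->] := p'j; rewrite (homX theta_hom) mulnC expgM -tc expg_order expg1n.
have p'p : p' != p by apply: contraNneq pD => <-.
have p'_pr : prime p' by exact: (allP D_pr).
have tp' : coprime (p ^ M.+1 * t) p'.
  by rewrite coprimeMl tp andbT coprimeXl// prime_coprime// dvdn_prime2// eq_sym.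
have PE i : PP (c ^+ (j * p ^ M.+1 * t * i)%N) (y, s) =
    (Pi (c ^+ (j * (p ^ M.+1 * t) * i)%N) y, s).
  rewrite PPE !mulnA; congr pair.
  by rewrite -!mulnA expgM expgM (homX hPi') MK// expg1n perm1.
under eq_bigr do rewrite PE /op' /=.
by rewrite sumrB jE// jE// subrr.
Qed.
End Combine.

Section Representation.
Local Open Scope classical_set_scope.
Local Open Scope group_scope.
Context (Gam : groupType) (g : nat) (a b : nat -> Gam).
Hypotheses (pres : presents g a b) (g_ge2 : (2 <= g)%N).
Context (Q : finGroupType) (theta : Gam -> Q).
Hypotheses (theta_hom : is_hom theta) (theta_surj : forall x, exists c, theta c = x).

Lemma good_primes : good theta (primes #|Q|).
Proof.
have : all prime (primes #|Q|) by apply/allP => p; rewrite mem_primes => /and3P[].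
have := primes_uniq #|Q|.
elim: (primes #|Q|) => [_ _|p s IH]; first exact: good_nil.
by move=> /= /andP[ps us] /andP[p_pr s_pr]; apply: (good_cons pres) => //; exact: IH.
Qed.

(** Serves the case of trivial [theta], in which no torsion is demanded. *)
Lemma infinite_int_wreath (Y : finType) : exists eta : Gam -> wreath (addg int) Y,
  is_hom eta /\ forall y : Y, infinite_set (range eta).
Proof.
have [rel gen univ] := pres.
pose one : addg int := (1 : int)%R.
pose A k : wreath (addg int) Y := if k == 0 then wr (fun=> one) 1 else 1.
have [eta [eta_hom etaE]] := univ _ A (fun=> 1) (relator_b1 _ _).
exists eta; split=> // y; have [a0 _] := etaE 0 (ltnW g_ge2).
apply: (contra_not _ infinite_nat) => fin.
apply: (sub_finite_set _ (finite_image (fun w : wreath (addg int) Y => `|w.1 y : int|%N) fin)).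
move=> n _ /=; exists (eta (a 0 ^+ n)); first by exists (a 0 ^+ n).
rewrite (homX eta_hom) a0 /A eqxx wreathZX; last by rewrite perm1.
by rewrite ffunE -[(1 *+ n)%R]/(n%:R)%R natz absz_nat.
Qed.

Lemma wreath_sum (Y : finType) (w : wreath (addg int) Y) n y :
  (w ^+ n).1 y = (\sum_(i < n) (w.1 ((w.2 ^+ i)%g y) : int))%R.
Proof.
elim: n y => [|n IH] y; first by rewrite big_ord0 expg0 wreath11.
rewrite expgSr wreathM1 IH big_ord_recr addgM; congr (_ + w.1 (_ : Y))%R.
by have /= -> := homX (@wreath_snd_hom (addg int) Y) w n.
Qed.

Lemma wr_perm_hom (Y : finType) (Pi : Gam -> {perm Y}) : is_hom Pi ->
  is_hom (fun c => wr (fun=> 1) (Pi c) : wreath (addg int) Y).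
Proof.
move=> hPi c d; apply: wreathP => [y|]; last exact: hPi.
by rewrite wreathM1 !ffunE mulg1.
Qed.

Lemma affine_action : exists (Y : finType) (eta : Gam -> wreath (addg int) Y),
  [/\ is_hom eta, infinite_set (range eta) &
      forall x, theta x <> 1 -> exists n : nat, (0 < n)%N /\ eta x ^+ n = 1].
Proof.
have [rel gen univ] := pres.
have [triv|] := EM (forall k, (k < g)%N -> theta (a k) = 1 /\ theta (b k) = 1).
  have [eta [eta_hom inf]] := infinite_int_wreath bool.
  exists bool, eta; split=> //; first exact: inf true.
  move=> x; case; move: x; apply: (eq_hom gen) => //.
  by move=> c d; rewrite mulg1.
move=> /existsNP[k0 /not_implyP[k0g k0E]].
have [k kg kk0] : exists2 k, (k < g)%N & k != k0.
  by case: (k0) => [|m]; [exists 1%N|exists 0 => //; exact: ltnW].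
have [Y [Pi [op [B [hPi opB opPi op_neq0 [BD KB Dj]]]]]] := good_primes.
pose pure (c : Gam) : wreath (addg int) Y := wr (fun=> 1) (Pi c).
have pure_hom : is_hom pure by exact: wr_perm_hom.
pose u := relator k a b; pose v := u * (a k * b k * (a k)^-1).
pose u' := u * a k; pose v' := relator k.+1 a b.
(* The four prefixes are those of [relator_updl] and [relator_updr], so [ker] is the vanishing of
   the translation part of the relator. *)
have [f [f' [ker [y0 ff']]]] := op_kernel opB op_neq0 (Pi u) (Pi v) (Pi u') (Pi v').
pose ze (h : Y -> int) : wreath (addg int) Y := wr (op h : Y -> addg int) 1.
pose A := upd (pure \o a) k (ze f * pure (a k)).
pose B' := upd (pure \o b) k (ze f' * pure (b k)).
have eqU : relator k (pure \o a) B' = pure u.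
  rewrite (hom_relator pure_hom); apply: eq_relator => i ik; split=> //.
  by rewrite /B' /upd ltn_eqF.
have AB : relator g A B' = 1.
  apply: wreathP => [y|]; last first.
    rewrite (hom_relator (@wreath_snd_hom (addg int) Y)) -[RHS](hom1 hPi) -rel.
    rewrite (hom_relator hPi); apply: eq_relator => i ig.
    by rewrite /A /B' /upd /=; split; case: eqP => [->|//]; rewrite /= mul1g.
  rewrite /A relator_updl// [relator g _ B']relator_updr// eqU.
  rewrite -(hom_relator pure_hom g) rel (hom1 pure_hom) mulg1.
  have cj (x z : addg int) : x * z * x^-1 = z.
    by rewrite !addgM addgV addrAC subrr add0r.
  have cjp (p q : wreath (addg int) Y) h : let w := p * ze h * p^-1 * (q * (ze h)^-1 * q^-1) in
      w.1 y = (op h (p.2 y) - op h (q.2 y))%R /\ w.2 y = y.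
    rewrite /ze wr1V; split.
      by rewrite wreathM1 wreathJ2 perm1 !wreathJ1 !cj.
    by rewrite wreathM2 !wreathJ2 mulg1 perm1.
  have [E1 E2] := cjp (pure u) (pure u * ((pure \o a) k * B' k * ((pure \o a) k)^-1)) f.
  have [E3 _] := cjp (relator k (pure \o a) (pure \o b) * (pure \o a) k)
    (relator k.+1 (pure \o a) (pure \o b)) f'.
  rewrite wreath11 wreathM1 E1 E2 E3 addgM.
  rewrite -[RHS](ker y) (opD opB) !opB !opPi; congr (_ - _ + (_ - _))%R.
  - by rewrite /v !hPi (homV hPi) /B' /upd eqxx /= mul1g.
  - by rewrite -(hom_relator pure_hom k) /u' hPi.
  - by rewrite -(hom_relator pure_hom k.+1).
have [eta [eta_hom etaE]] := univ _ _ _ AB.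
have eta2 : (fun c => (eta c).2) =1 Pi.
  apply: (eq_hom gen) => //; first by move=> c d; rewrite eta_hom.
  move=> i ig; have [-> ->] := etaE i ig.
  by rewrite /A /B' /upd /=; split; case: eqP => [->|//]; rewrite /= mul1g.
pose in_op (w : wreath (addg int) Y) := exists h, forall y, w.1 y = op h y.
have eta1 c : in_op (eta c).
  move: c; apply: gen.
  - move=> i ig; have [-> ->] := etaE i ig; rewrite /A /B' /upd.
    have in_pure c : in_op (pure c).
      by exists (fun=> 0%R) => y; rewrite (op0 opB) ffunE.
    have in_ze h c : in_op (ze h * pure c).
      by exists h => y; rewrite wreathM1 !ffunE mulg1.
    by split; case: ifP => _; [exact: in_ze|exact: in_pure
      |exact: in_ze|exact: in_pure].
  - by exists (fun=> 0%R) => y; rewrite (hom1 eta_hom) wreath11 (op0 opB).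
  - move=> c d [h hE] [h' h'E]; exists (fun y => h y + h' (Pi c y))%R => y.
    by rewrite eta_hom wreathM1 hE h'E eta2 (opD opB) opPi.
  - move=> c [h hE]; exists (fun y => - h (Pi (c^-1)%g y))%R => y.
    rewrite (homV eta_hom) wreathV1 hE addgV (opN opB) opPi; congr (- op _ _)%R.
    by rewrite eta2 (homV hPi).
have prime_power x : theta x <> 1 -> exists e p, [/\ (0 < e)%N, (0 < p)%N &
    forall h y, (\sum_(i < p) op h (Pi ((x ^+ e) ^+ i)%g y) = 0)%R].
  move=> tx; pose o := #[theta x]; pose p := pdiv o.
  have o1 : (1 < o)%N by rewrite order_gt1; apply/eqP.
  have p_pr : prime p by exact: pdiv_prime.
  have po : p %| o by exact: pdiv_dvd.
  have pD : p \in primes #|Q|.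
    rewrite mem_primes p_pr -cardsT cardG_gt0 /=.
    by apply: dvdn_trans po _; apply: order_dvdG; rewrite inE.
  have [j [pj jE]] := Dj p pD; pose x' := x ^+ (o %/ p)%N.
  have op0' : (0 < o %/ p)%N by rewrite divn_gt0 ?prime_gt0// dvdn_leq// ltnW.
  have x'p : #[theta x'] = p.
    rewrite (homX theta_hom) orderXdiv ?dvdn_div// -/o.
    by rewrite -{1}(divnK po) mulKn.
  (* [good] allows j = 0, but then its sums read p times [op h y], which cannot vanish for every [h]
     and [y]. *)
  have [j0|j0] := posnP j.
    have [h [y hy]] := op_neq0; case: hy.
    have := jE x' x'p 1%N (coprime1n _) h y.
    rewrite (eq_bigr (fun=> op h y)); last first.
      by move=> i _; rewrite j0 !mul0n expg0 (hom1 hPi) perm1.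
    rewrite sumr_const card_ord => /eqP; rewrite mulrn_eq0 gtn_eqF ?prime_gt0//=.
    by move/eqP.
  exists (o %/ p * j)%N, p; split=> [||h y]; [by rewrite muln_gt0 op0'|exact: prime_gt0|].
  rewrite -[RHS](jE x' x'p 1%N (coprime1n _) h y).
  by apply: eq_bigr => i _; rewrite muln1 /x' -!expgM mulnA.
exists Y, eta; split=> //.
- move=> /finite_seqP[r rE]; pose s := undup r.
  have sE w : (w \in s) <-> exists c, eta c = w.
    have wE : (w \in r) <-> range eta w by rewrite rE.
    rewrite mem_undup wE; split=> [[c _ cw]|[c cw]]; by exists c.
  have su : uniq s by exact: undup_uniq.
  pose V y : int := (\sum_(w <- s) (w.1 y : int))%R.
  (* Left multiplication by [eta c] permutes the finite image. *)
  have VE c y : V y = (((eta c).1 y : int) *+ size s + V (Pi c y))%R.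
    pose s2 := [seq eta c * w | w <- s].
    have -> : V y = (\sum_(w <- s2) (w.1 y : int))%R.
      apply: perm_big; apply: uniq_perm => //.
        by rewrite map_inj_uniq//; exact: mulgI.
      move=> w; apply/idP/mapP => [/sE[d <-]|[w' /sE[d <-] ->]].
        exists (eta (c^-1 * d)); first by apply/sE; exists (c^-1 * d).
        by rewrite -eta_hom mulKVg.
      by apply/sE; exists (c * d); rewrite eta_hom.
    rewrite big_map (eq_bigr (fun w : wreath (addg int) Y =>
      ((eta c).1 y + w.1 (Pi c y) : int)%R)).
      by rewrite big_split /= big_const_seq count_predT iter_addr addr0.
    by move=> w _; rewrite wreathM1 addgM eta2.
  have Vop : exists h, forall y, V y = op h y.
    have H0 (w : wreath (addg int) Y) : exists h, w \in s -> forall y, w.1 y = op h y.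
      have [/sE[c <-]|ws] := boolP (w \in s); last by exists (fun=> 0%R).
      by have [h hE] := eta1 c; exists h.
    have [H HE] := choice H0; exists (fun y => \sum_(w <- s) H w y)%R => y.
    rewrite (op_sum opB) /V big_seq [RHS]big_seq; apply: eq_bigr => w ws.
    exact: HE.
  have [h hE] := Vop.
  have [c0 tc0 c00] : exists2 c0, theta c0 <> 1 & forall y, (eta c0).1 y = 1.
    have [ak bk] := etaE k0 k0g; rewrite /A /B' /upd eq_sym (negPf kk0) in ak bk.
    have [ta|ta] := EM (theta (a k0) = 1).
      exists (b k0) => [tb|y]; last by rewrite bk ffunE.
      exact: k0E.
    by exists (a k0) => // y; rewrite ak ffunE.
  have Vfix n y : V (Pi (c0 ^+ n) y) = V y.
    elim: n y => [|n IH] y; first by rewrite (hom1 hPi) perm1.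
    by rewrite expgS hPi permM IH [RHS](VE c0) c00 mul0rn add0r.
  have [e [p [e0 p0 ep]]] := prime_power c0 tc0.
  (* [V] is invariant under [c0] and in the range of [op], so [p] times [V] is one of the vanishing
     sums. *)
  have V0 y : V y = 0%R.
    have /eqP := ep h y; rewrite (eq_bigr (fun=> V y)).
      by rewrite sumr_const card_ord mulrn_eq0 gtn_eqF//= => /eqP.
    by move=> i _; rewrite -expgM -hE Vfix.
  have s0 : size s != 0.
    have : eta 1 \in s by apply/sE; exists 1.
    by case: (s).
  have eta0 c y : (eta c).1 y = (0%R : int).
    have /eqP := VE c y; rewrite !V0 addr0 eq_sym mulrn_eq0 (negPf s0) /=.
    by move/eqP.
  have [ak bk] := etaE k kg; rewrite /A /B' /upd eqxx in ak bk.
  case: ff' => H; apply: H.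
    by have := eta0 (a k) y0; rewrite ak wreathM1 !ffunE mulg1.
  by have := eta0 (b k) y0; rewrite bk wreathM1 !ffunE mulg1.
- move=> x tx; have [e [p [e0 p0 ep]]] := prime_power x tx.
  have [h hE] := eta1 (x ^+ e).
  have w1 : forall y, (eta (x ^+ e) ^+ p).1 y = 1.
    move=> y; rewrite wreath_sum -[RHS]/(0%R : int) -[RHS](ep h y).
    apply: eq_bigr => i _; rewrite hE eta2; congr (op _ (fun_of_perm _ _)).
    by rewrite -(homX hPi).
  (* After [e * p] steps only a permutation is left; its order finishes. *)
  exists (e * p * #[Pi (x ^+ (e * p)%N)])%N; rewrite !muln_gt0 e0 p0 order_gt0; split=> //.
  rewrite expgM; apply: wreathP => [y|].
    rewrite wreath11 wreath_sum big1// => i _.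
    by rewrite expgM -(homX eta_hom) w1.
  have := homX (@wreath_snd_hom (addg int) Y) (eta x ^+ (e * p)%N) #[Pi (x ^+ (e * p)%N)].
  by rewrite /= => ->; rewrite -(homX eta_hom) eta2 expg_order.
Qed.

Lemma torsion_off_kernel : exists (n : nat) (rho : Gam -> 'M[int]_n),
  [/\ (1 <= n)%N,
      forall x, rho x \in unitmx,
      forall x y, rho (x * y)%g = (rho x *m rho y)%R,
      infinite_set (range rho) &
      forall x, theta x <> 1%g ->
        exists n : nat, (0 < n)%N /\ (rho x ^+ n)%R = (1%:M)%R].
Proof.
have [Y [eta [eta_hom inf tor]]] := affine_action.
exact: affine_rep eta_hom inf tor.
Qed.

End Representation.

(** * Transport along paths *)


Section Cousin.
Local Open Scope classical_set_scope.
Local Open Scope ring_scope.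
Context (R : realType).

Lemma near_dist (t : R) (P : R -> Prop) : (\forall s \near t, P s) ->
  exists2 e : R, 0 < e & forall s, `|s - t| < e -> P s.
Proof.
move=> /nbhs_ballP[e e0 eP]; exists e => // s st; apply: eP.
by rewrite /ball /= distrC.
Qed.

(** Cousin's lemma: the supremum of the endpoints reached from [a] is itself reached, and local
    validity would carry the property beyond it unless it is [b]. *)
Lemma cousin (P : R -> R -> Prop) (a b : R) : a <= b ->
  (forall x y z, x <= y -> y <= z -> P x y -> P y z -> P x z) ->
  (forall t, a <= t <= b -> exists2 e : R, 0 < e & forall u v,
     a <= u <= t -> t <= v <= b -> t - u < e -> v - t < e -> P u v) ->
  P a b.
Proof.
move=> ab Padd Ploc; pose S : set R := [set t | a <= t <= b /\ P a t].
have aab : a <= a <= b by rewrite lexx.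
have Sa : S a.
  split=> //; have [e e0 H] := Ploc a aab.
  by apply: H; rewrite ?lexx ?subrr.
have supS : has_sup S by split; [exists a|exists b => t [/andP[]]].
pose c := sup S.
have ac : a <= c by apply: ub_le_sup => //; case: supS.
have cb : c <= b by apply: ge_sup; [exists a|move=> t [/andP[]]].
have [|e e0 H] := Ploc c; first by rewrite ac cb.
have [t [/andP[t1 t2] Pt] ct] := sup_adherent e0 supS; rewrite -/c in ct.
have tc : t <= c by apply: ub_le_sup; [case: supS|split=> //; rewrite t1 t2].
pose v := Num.min b (c + e / 2).
have cv : c <= v by rewrite le_min cb lerDl divr_ge0// ltW.
have vb : v <= b by rewrite ge_min lexx.
have Pv : P a v.
  apply: (Padd _ _ _ t1 (le_trans tc cv) Pt); apply: H.
  - by rewrite t1 tc.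
  - by rewrite cv vb.
  - by rewrite ltrBlDr -ltrBlDl.
  - by rewrite ltrBlDl (le_lt_trans (_ : v <= c + e / 2)) ?ge_min ?lexx ?orbT// ltrD2l gtr_pMr// invf_lt1// ltr1n.
have vc : v <= c.
  by apply: ub_le_sup; [case: supS|split=> //; rewrite vb (le_trans ac cv)].
have [be|/ltW be] := leP b (c + e / 2); first by move: Pv; rewrite /v min_l.
move: vc; rewrite /v min_r// gerDl => e2; have := divr_gt0 e0 (ltr0n R 2).
by rewrite ltNge e2.
Qed.

End Cousin.

Section Transport.
Local Open Scope classical_set_scope.
Local Open Scope ring_scope.
Context (R : realType) (X : topologicalType) (G : groupType) (J : Type).
Context (U : J -> set X) (c : J -> X -> G).
Hypotheses (U_open : forall j, open (U j)) (U_cover : forall x, exists j, U j x).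
Hypothesis c_const : forall j k x, U j x -> U k x ->
  \forall y \near x, (c j y * (c k y)^-1 = c j x * (c k x)^-1)%g.

(* sg is a flat section along gm of the bundle with transition functions
   c j * (c k)^-1: in the chart j it reads c j (gm t) * sg t. *)
Definition section_on (gm : R -> X) (sg : R -> G) (a b : R) : Prop :=
  forall t, a <= t <= b -> forall j, U j (gm t) -> exists2 e, 0 < e &
    forall s, a <= s <= b -> `|s - t| < e ->
      (c j (gm s) * sg s = c j (gm t) * sg t)%g.

Lemma stay (gm : R -> X) t j : continuous gm -> U j (gm t) ->
  exists2 e, 0 < e & forall s, `|s - t| < e -> U j (gm s).
Proof.
move=> cg Ut; apply: near_dist; apply: (cg t); apply: open_nbhs_nbhs.
by split.
Qed.

Lemma section_sub gm sg a b a' b' : a <= a' -> b' <= b ->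
  section_on gm sg a b -> section_on gm sg a' b'.
Proof.
move=> aa bb H t /andP[t1 t2] j Ut.
have [|e e0 He] := H t _ j Ut; first by rewrite (le_trans aa)// (le_trans t2).
exists e => // s /andP[s1 s2]; apply: He.
by rewrite (le_trans aa)// (le_trans s2).
Qed.

(** In a chart a section is determined near a point by its value there, so the quotient of two
    sections is locally constant. *)
Lemma section_eq gm sg sg' a b : a <= b -> section_on gm sg a b ->
  section_on gm sg' a b ->
  (sg b * (sg a)^-1 = sg' b * (sg' a)^-1)%g.
Proof.
move=> ab H H'.
suff E : ((sg a)^-1 * sg' a = (sg b)^-1 * sg' b)%g.
  have -> : sg' b = (sg b * ((sg a)^-1 * sg' a))%g by rewrite E mulKVg.
  by rewrite !mulgA mulgK.
apply: (@cousin R (fun u v => ((sg u)^-1 * sg' u = (sg v)^-1 * sg' v)%g)) => //.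
  by move=> x y z _ _ ->.
move=> t tab; have [j Ut] := U_cover (gm t).
have [e e0 He] := H t tab j Ut; have [e' e'0 He'] := H' t tab j Ut.
exists (Num.min e e') => [|u v]; first by rewrite lt_min e0.
move=> /andP[au ut] /andP[tv vb]; rewrite !lt_min => /andP[ue ue'] /andP[ve ve'].
have loc s : a <= s <= b -> `|s - t| < e -> `|s - t| < e' ->
    ((sg s)^-1 * sg' s = (sg t)^-1 * sg' t)%g.
  move=> sab se se'; apply: (mulgI (c j (gm s) * sg s)%g).
  by rewrite {2}(He s sab se) !mulgA !mulgK He'.
case/andP: tab => at' tb.
have uE : `|u - t| = t - u by rewrite distrC ger0_norm// subr_ge0.
have vE : `|v - t| = v - t by rewrite ger0_norm// subr_ge0.
rewrite (loc u) ?uE// ?au ?(le_trans ut)//.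
by rewrite (loc v) ?vE// vb (le_trans at').
Qed.

Lemma section_cat gm sg sg' a b d : a <= b -> b <= d ->
  section_on gm sg a b -> section_on gm sg' b d -> sg b = sg' b ->
  section_on gm (fun t => if t <= b then sg t else sg' t) a d.
Proof.
move=> ab bd H H' E t /andP[at' td] j Ut.
have [tb|bt|tb] := ltgtP t b.
- have [|e e0 He] := H t _ j Ut; first by rewrite at' ltW.
  exists (Num.min e (b - t)) => [|s /andP[s1 s2]]; first by rewrite lt_min e0 subr_gt0.
  rewrite lt_min => /andP[se sb]; have sb' : s <= b.
    by move: sb; rewrite ltr_norml => /andP[_]; lra.
  by rewrite sb'; apply: He; rewrite ?s1.
- have [|e e0 He] := H' t _ j Ut; first by rewrite (ltW bt).
  exists (Num.min e (t - b)) => [|s /andP[s1 s2]]; first by rewrite lt_min e0 subr_gt0.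
  rewrite lt_min => /andP[se sb]; have sb' : b < s.
    by move: sb; rewrite ltr_norml => /andP[]; lra.
  by rewrite leNgt sb' /=; apply: He; rewrite ?(ltW sb').
- rewrite tb in Ut *; have [|e e0 He] := H b _ j Ut; first by rewrite ab lexx.
  have [|e' e'0 He'] := H' b _ j Ut; first by rewrite bd lexx.
  exists (Num.min e e') => [|s /andP[s1 s2]]; first by rewrite lt_min e0.
  rewrite lt_min => /andP[se se']; case: leP => sb; first by apply: He; rewrite ?s1.
  by rewrite E; apply: He'; rewrite ?(ltW sb).
Qed.

Lemma section_mulr gm sg a b h : section_on gm sg a b ->
  section_on gm (fun t => sg t * h)%g a b.
Proof.
move=> H t tab j Ut; have [e e0 He] := H t tab j Ut; exists e => // s sab se.
by rewrite !mulgA He.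
Qed.

(** The inverse of [c j] is a section inside a chart; a right factor makes consecutive pieces
    agree. *)
Lemma section_ex gm a b : continuous gm -> a <= b -> exists sg, section_on gm sg a b.
Proof.
move=> cg ab.
apply: (@cousin R (fun u v => exists sg, section_on gm sg u v)) => //.
  move=> x y z xy yz [sg H] [sg' H'].
  exists (fun t => if t <= y then sg t else (sg' t * ((sg' y)^-1 * sg y))%g).
  by apply: section_cat => //; [exact: section_mulr|rewrite mulKVg].
move=> t tab; have [j Ut] := U_cover (gm t).
have [e e0 He] := stay cg Ut; exists e => // u v /andP[au ut] /andP[tv vb] ue ve.
exists (fun s => (c j (gm s))^-1)%g => s /andP[us sv] k Us.
have Ujs : U j (gm s).
  by apply: He; rewrite ltr_norml; apply/andP; split; lra.
have [e' e'0 He'] := near_dist (cg s _ (c_const Us Ujs)).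
by exists e' => // s' _ ss; exact: He'.
Qed.

(** Independent of the section by [section_eq]; 1 is a default for want of a section. *)
Definition transport (gm : R -> X) (a b : R) : G :=
  if pselect (exists sg, section_on gm sg a b) is left e
  then (projT1 (cid e) b * (projT1 (cid e) a)^-1)%g else 1%g.

Lemma transportE gm sg a b : a <= b -> section_on gm sg a b ->
  transport gm a b = (sg b * (sg a)^-1)%g.
Proof.
move=> ab H; rewrite /transport; case: pselect => [e|[]]; last by exists sg.
case: cid => sg' H'; exact: (section_eq ab H' H).
Qed.

Lemma transport_cat gm a b d : continuous gm -> a <= b -> b <= d ->
  transport gm a d = (transport gm b d * transport gm a b)%g.
Proof.
move=> cg ab bd; have [sg H] := section_ex cg (le_trans ab bd).
rewrite (transportE _ H) ?(le_trans ab)//.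
rewrite (transportE bd (section_sub ab (lexx _) H)).
by rewrite (transportE ab (section_sub (lexx _) bd H)) mulgA mulgKV.
Qed.

Lemma transport_chart gm a b j : continuous gm -> a <= b ->
  (forall t, a <= t <= b -> U j (gm t)) ->
  transport gm a b = ((c j (gm b))^-1 * c j (gm a))%g.
Proof.
move=> cg ab Uj; rewrite (@transportE _ (fun s => (c j (gm s))^-1)%g)// ?invgK//.
move=> s sab k Us; have [e' e'0 He'] := near_dist (cg s _ (c_const Us (Uj s sab))).
by exists e' => // s' _ ss; exact: He'.
Qed.

Lemma transport_const x a b : a <= b -> transport (fun=> x) a b = 1%g.
Proof.
move=> ab; have [j Ux] := U_cover x.
rewrite (@transport_chart _ a b j)// ?mulVg//.
exact: cst_continuous.
Qed.

Lemma transport_comp gm gm' (phi : R -> R) a b a' b' : continuous gm ->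
  continuous phi -> a' <= b' -> a <= b -> phi a' = a -> phi b' = b ->
  (forall t, a' <= t <= b' -> a <= phi t <= b) ->
  (forall t, a' <= t <= b' -> gm' t = gm (phi t)) ->
  transport gm' a' b' = transport gm a b.
Proof.
move=> cg cphi ab' ab pa pb pab E; have [sg H] := section_ex cg ab.
rewrite (transportE ab H) (@transportE _ (sg \o phi))//= ?pa ?pb//.
move=> t tab j; rewrite E// => Ut; have [e e0 He] := H (phi t) (pab t tab) j Ut.
have [|e' e'0 He'] := @near_dist R t (fun s => `|phi s - phi t| < e).
  by have /cvgr_dist_lt/(_ e e0) := cphi t; apply: filterS => s; rewrite distrC.
by exists e' => // s sab st; rewrite E//; apply: He; [exact: pab|exact: He'].
Qed.

Definition commuting_square (h : R * R -> X) (a b u v : R) : Prop :=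
  (transport (fun s => h (b, s)) u v * transport (fun t => h (t, u)) a b =
   transport (fun t => h (t, v)) a b * transport (fun s => h (a, s)) u v)%g.

(** Commuting squares can be juxtaposed in both directions, so two nested uses of [cousin] reduce to
    small squares inside one chart, where transport depends only on the endpoints. *)
Lemma square_commutes h : continuous h -> commuting_square h 0 1 0 1.
Proof.
move=> ch.
have ch1 s : continuous (fun t => h (t, s)).
  by apply: (continuous_compose _ ch); apply: continuous_pair;
    [move=> ?; exact: cvg_id|exact: cst_continuous].
have ch2 t : continuous (fun s => h (t, s)).
  by apply: (continuous_compose _ ch); apply: continuous_pair;
    [exact: cst_continuous|move=> ?; exact: cvg_id].
apply: (@cousin R (fun a b => commuting_square h a b 0 1)) => //.
  move=> x y z xy yz Hxy Hyz; rewrite /commuting_square.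
  rewrite !(@transport_cat (fun t => h (t, _)) x y z)//.
  by rewrite mulgA Hyz -mulgA Hxy mulgA.
move=> t0 _; apply: (@cousin R (fun u v => exists2 e, 0 < e & forall a b,
    0 <= a <= t0 -> t0 <= b <= 1 -> t0 - a < e -> b - t0 < e ->
    commuting_square h a b u v)) => //.
  move=> x y z xy yz [e e0 He] [e' e'0 He'].
  exists (Num.min e e') => [|a b ha hb]; first by rewrite lt_min e0.
  rewrite !lt_min => /andP[ae ae'] /andP[be be'].
  have H1 := He a b ha hb ae be; have H2 := He' a b ha hb ae' be'.
  rewrite /commuting_square !(@transport_cat (fun s => h (_, s)) x y z)//.
  by rewrite -mulgA H1 mulgA H2 mulgA.
move=> s0 _; have [j Uj] := U_cover (h (t0, s0)).
have /(ch (t0, s0))/nbhs_ballP[e e0 He] : nbhs (h (t0, s0)) (U j).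
  by apply: open_nbhs_nbhs; split.
exists e => // u v /andP[_ us] /andP[sv _] ue ve; exists e => // a b.
move=> /andP[_ at0] /andP[tb _] ae be.
have Uh t s : a <= t <= b -> u <= s <= v -> U j (h (t, s)).
  move=> /andP[t1 t2] /andP[s1 s2]; apply: He; split; rewrite /ball /= ltr_norml;
    by apply/andP; split; lra.
have ab : a <= b by lra.
have uv : u <= v by lra.
rewrite /commuting_square.
rewrite !(@transport_chart (fun s => h (_, s)) u v j)//; do ?[by move=> *; apply: Uh; rewrite ?lexx ?ab].
rewrite !(@transport_chart (fun t => h (t, _)) a b j)//; do ?[by move=> *; apply: Uh; rewrite ?lexx ?uv].
by rewrite !mulgA !mulgK.
Qed.

End Transport.

(** * The polygon in polar coordinates *)


Section Angles.
Local Open Scope ring_scope.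
Context (R : realType).

Lemma cos_2pi : cos (2 * pi) = 1 :> R.
Proof. by rewrite mulr_natl cos2pi. Qed.

Lemma sin_2pi : sin (2 * pi) = 0 :> R.
Proof. by rewrite mulr_natl mulr2n sinDpi sinpi oppr0. Qed.

Lemma cos_eq1 (x : R) : 0 <= x < 2 * pi -> cos x = 1 -> x = 0.
Proof.
move=> /andP[x0 x2] cx; have p0 := pi_ge0 R.
have [xp|px] := leP x pi.
  apply: cos_inj; rewrite ?cos0// in_itv /= ?x0 ?xp ?lexx ?p0//.
suff: 2 * pi - x = 0 by lra.
apply: cos_inj; rewrite ?in_itv /= ?lexx ?p0//; first by apply/andP; split; lra.
by rewrite cos0 cosB cx cos_2pi sin_2pi mulr1 mul0r addr0.
Qed.

Lemma angle_periodZ (k : int) (x : R) :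
  cos (x + k%:~R * (2 * pi)) = cos x /\ sin (x + k%:~R * (2 * pi)) = sin x.
Proof.
have P n y : cos (y + n%:R * (2 * pi)) = cos y :> R /\
    sin (y + n%:R * (2 * pi)) = sin y :> R.
  elim: n => [|n [IHc IHs]]; first by rewrite mul0r addr0.
  by rewrite -natr1 mulrDl mul1r addrA {2 4}[2 * pi]mulr_natl cosD2pi sinD2pi.
case: k => n; first exact: P.
have [] := P n.+1 (x - n.+1%:R * (2 * pi)); rewrite subrK => -> ->.
by rewrite NegzE mulrNz mulNr.
Qed.

Lemma angle_unique (x y : R) : cos x = cos y -> sin x = sin y ->
  exists k : int, y = x + k%:~R * (2 * pi).
Proof.
move=> Ec Es; have p0 := pi_gt0 R; pose k := Num.floor ((y - x) / (2 * pi)).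
exists k; suff: y - x - k%:~R * (2 * pi) = 0 by lra.
apply: cos_eq1.
  have /andP[] := floor_itv ((y - x) / (2 * pi)); rewrite -/k intrD.
  by rewrite ler_pdivlMr ?ltr_pdivrMr; [lra|lra|lra].
have [+ _] := angle_periodZ (- k) (y - x); rewrite mulrNz mulNr => ->.
by rewrite cosB Ec Es -!expr2 cos2Dsin2.
Qed.

Lemma angle_exists (a b : R) : a ^+ 2 + b ^+ 2 = 1 ->
  exists2 x, 0 <= x <= 2 * pi & a = cos x /\ b = sin x.
Proof.
move=> E; have p0 := pi_gt0 R; have := sqr_ge0 b; have := sqr_ge0 a => a0 b0.
have a1 : -1 <= a <= 1 by apply/andP; split; nra.
have ca := acosK a1; have ge0 := acos_ge0 a1; have lepi := acos_lepi a1.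
have sb : sin (acos a) = `|b|.
  by rewrite sin_acos// -sqrtr_sqr; congr Num.sqrt; lra.
have [b1|b1] := leP 0 b.
  by exists (acos a); [lra|rewrite ca sb ger0_norm].
exists (2 * pi - acos a); first lra.
rewrite cosB sinB cos_2pi sin_2pi ca sb ltr0_norm//; split; lra.
Qed.

End Angles.

Section PlaneMap.
Local Open Scope classical_set_scope.
Local Open Scope ring_scope.
Local Open Scope quotient_scope.
Context (R : realType) (g : nat) (g_gt0 : (0 < g)%N).
Local Notation X := (closed_surface R g).
Local Notation N := ((4 * g)%:R : R).

(** Clamping defines the polar map on the whole plane, so that any two lifts can be joined by a
    segment. *)
Definition radius (r : R) : R := uval (clamp r).

Lemma radius_itv r : 0 <= radius r <= 1. Proof. exact: uval_itv. Qed.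

Lemma radius_id r : 0 <= r <= 1 -> radius r = r. Proof. exact: clampE. Qed.

Lemma radius_le0 r : r <= 0 -> radius r = 0.
Proof.
move=> r0; rewrite /radius uval_clamp min_l; last lra.
by rewrite max_l.
Qed.

Lemma radius_ge1 r : 1 <= r -> radius r = 1.
Proof. by move=> r1; rewrite /radius uval_clamp min_r// max_r. Qed.

Lemma radius_gt0 r : (0 < radius r) = (0 < r).
Proof.
by have [r0|r0] := leP r 0; rewrite /radius uval_clamp lt_max ltxx lt_min ltr01 andbT //= ltNge r0.
Qed.

Lemma radius_lt1 r : (radius r < 1) = (r < 1).
Proof. by rewrite /radius uval_clamp gt_max ltr01 gt_min ltxx orbF. Qed.

Lemma radius_continuous : continuous radius.
Proof. exact: continuous_compose (@clamp_continuous R) (@uval_continuous R). Qed.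

Lemma N_gt0 : 0 < N.
Proof. by rewrite ltr0n muln_gt0. Qed.

Lemma boundary_period (k : int) (t : R) : boundary_point g (t + N * k%:~R) = boundary_point g t.
Proof.
have N0 := lt0r_neq0 N_gt0.
rewrite /boundary_point (_ : 2 * pi * (t + N * k%:~R) / N = 2 * pi * t / N + k%:~R * (2 * pi)); last first.
  by move: (pi : R) => q; field; rewrite pnatr_eq0 -lt0n.
by have [-> ->] := angle_periodZ k (2 * pi * t / N).
Qed.

Lemma boundary_unique t t' : boundary_point g t = boundary_point g t' ->
  exists k : int, t' = t + N * k%:~R.
Proof.
have N0 := lt0r_neq0 N_gt0; have p0 := lt0r_neq0 (pi_gt0 R).
case=> Ec Es; have [k E] := angle_unique Ec Es; exists k.
have P0 : 2 * pi != 0 :> R by rewrite mulf_neq0.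
apply: (mulfI P0); apply: (@mulIf _ N^-1); first by rewrite invr_neq0.
by rewrite E; move: (pi : R) => q; field; rewrite pnatr_eq0 -lt0n.
Qed.

(** The angle is measured in arcs of the polygon, so its period is [N]. *)
Definition polar (u : R * R) : R * R :=
  (radius u.1 * (boundary_point g u.2).1, radius u.1 * (boundary_point g u.2).2).

Lemma polar_norm u : (polar u).1 ^+ 2 + (polar u).2 ^+ 2 = radius u.1 ^+ 2.
Proof. by rewrite /polar /= !exprMn -mulrDr cos2Dsin2 mulr1. Qed.

Lemma polar_in_disc u : polar u \in @closed_disc R.
Proof.
rewrite inE /closed_disc /= polar_norm; have /andP[r0 r1] := radius_itv u.1.
by rewrite expr_le1.
Qed.

Definition disc_point (u : R * R) : @closed_disc R :=
  exist (fun z => z \in @closed_disc R) _ (polar_in_disc u).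

Definition plane (u : R * R) : X := \pi_X (disc_point u).

Lemma boundary_continuous : continuous (boundary_point g : R -> R * R).
Proof.
have ca : continuous (fun t : R => 2 * pi * t / N).
  move=> t; apply: cvgM; last exact: cvg_cst.
  by apply: cvgM; [exact: cvg_cst|exact: cvg_id].
apply: continuous_pair.
  exact: continuous_compose ca (@continuous_cos R).
exact: continuous_compose ca (@continuous_sin R).
Qed.

Lemma polar_continuous : continuous polar.
Proof.
have c1 : continuous (fun u : R * R => radius u.1).
  exact: continuous_compose (@continuous_fst _ _) radius_continuous.
have c2 : continuous (fun u : R * R => boundary_point g u.2).
  exact: continuous_compose (@continuous_snd _ _) boundary_continuous.
have c21 : continuous (fun u : R * R => (boundary_point g u.2).1).
  exact: continuous_compose c2 (@continuous_fst _ _).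
have c22 : continuous (fun u : R * R => (boundary_point g u.2).2).
  exact: continuous_compose c2 (@continuous_snd _ _).
by apply: continuous_pair => u; [apply: (cvgM (c1 u) (c21 u))|apply: (cvgM (c1 u) (c22 u))].
Qed.

Lemma plane_continuous : continuous plane.
Proof.
apply: continuous_compose (@pi_continuous _ _).
by apply: continuous_comp_initial; exact: polar_continuous.
Qed.

Lemma polar_surj z : @closed_disc R z ->
  exists u, [/\ 0 <= u.1 <= 1, 0 <= u.2 <= N & polar u = z].
Proof.
case: z => a b; rewrite /closed_disc /= => ab.
have N0 := N_gt0; have p0 := pi_gt0 R.
pose r := Num.sqrt (a ^+ 2 + b ^+ 2).
have s0 : 0 <= a ^+ 2 + b ^+ 2 by rewrite addr_ge0 ?sqr_ge0.
have r0 : 0 <= r by exact: sqrtr_ge0.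
have rE : r ^+ 2 = a ^+ 2 + b ^+ 2 by rewrite sqr_sqrtr.
have r1 : r <= 1 by rewrite -(expr_le1 (n:=2)) // rE.
have [re|rn0] := eqVneq r 0.
  exists (0, 0); rewrite /= lexx ler01 ltW// /polar radius_id ?lexx ?ler01//= !mul0r; split=> //.
  move: rE; rewrite re expr0n /= => /esym/eqP; rewrite paddr_eq0 ?sqr_ge0// !sqrf_eq0.
  by move=> /andP[/eqP-> /eqP->].
have [|x /andP[x0 x2] [ac bs]] := @angle_exists R (a / r) (b / r).
  by rewrite !exprMn -mulrDl -rE -exprMn divff// expr1n.
exists (r, N * (x / (2 * pi))); rewrite /= r0 r1; split=> //.
  have p2 : 0 < 2 * pi :> R by lra.
  have q0 : 0 <= x / (2 * pi) by rewrite divr_ge0// ltW.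
  have q1 : x / (2 * pi) <= 1 by rewrite ler_pdivrMr// mul1r.
  by rewrite mulr_ge0 ?(ltW N0)//= ger_pMr.
rewrite /polar /= radius_id ?r0// (_ : 2 * pi * _ / N = x) -?ac -?bs.
  by rewrite ![r * _]mulrC !mulfVK.
have q0 := lt0r_neq0 p0; move: (pi : R) q0 => q q0.
by field; rewrite q0 andbT pnatr_eq0 -lt0n.
Qed.

Lemma plane_surj x : exists u, plane u = x.
Proof.
elim/quotW: x => z; have [u [_ _ E]] := polar_surj (set_valP z).
by exists u; rewrite /plane (_ : disc_point u = z)//; apply: val_inj.
Qed.

(** A compact rectangle already covers the disc, so the polar map restricted to it is closed and
    therefore a quotient map. *)
Lemma plane_open (O : set X) : open (plane @^-1` O) -> open O.
Proof.
move=> oO; pose K : set (R * R) := `[0, 1] `*` `[0, N].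
have cK : compact (polar @` (K `&` plane @^-1` (~` O))).
  apply: continuous_compact.
    by apply: continuous_subspaceT; exact: polar_continuous.
  apply: compact_closedI.
    by apply: compact_setX; exact: segment_compact.
  by rewrite preimage_setC; exact: open_closedC.
have {}cK := compact_closed (@norm_hausdorff _ _) cK.
have oW := closed_openC cK.
exists (~` (polar @` (K `&` plane @^-1` (~` O)))) => //.
apply/seteqP; split => z /=.
  move=> H; apply: contrapT => nO; apply: H.
  have [u [u1 u2 E]] := polar_surj (set_valP z).
  exists u => //; split; first by split; rewrite /= in_itv.
  by rewrite /= /plane (_ : disc_point u = z)//; apply: val_inj.
move=> Oz [u [_ nO] E]; apply: nO; rewrite /= /plane (_ : disc_point u = z)//.
exact: val_inj.
Qed.

(* An arc identified with its partner starts at an integer congruent to 0 or 1 modulo 4. *)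
Definition glued_arc (n : nat) : bool := (n < 4 * g)%N && (n %% 4 < 2)%N.

Lemma polar_rim (t : R) : polar (1, t) = boundary_point g t.
Proof. by rewrite /polar /= radius_ge1// !mul1r. Qed.

(** Both pairings, 4k + s with 4k + 3 - s and 4k + 1 + s with 4k + 4 - s, have the form n + s with n
    + 3 - s. *)
Lemma arc_glued n (s : R) : glued_arc n -> 0 <= s <= 1 ->
  plane (1, n%:R + s) = plane (1, n%:R + 3 - s).
Proof.
move=> /andP[n4 nm] s01; apply/eqmodP/asboolP; apply: rst_step.
have [k kg E] : exists2 k, (k < g)%N & n = (4 * k)%N \/ n = (4 * k + 1)%N.
  by exists (n %/ 4)%N; lia.
exists k, s; split=> //; rewrite /disc_point /set_val /= !polar_rim -natrD.
by case: E => ->; [left|right]; rewrite -?addnA.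
Qed.

Section Fibres.
Variable E : R * R -> R * R -> Prop.
Hypothesis E_refl : forall u, E u u.
Hypothesis E_sym : forall u v, E u v -> E v u.
Hypothesis E_trans : forall u v w, E u v -> E v w -> E u w.
Hypothesis E_centre : forall r r' t t', r <= 0 -> r' <= 0 -> E (r, t) (r', t').
Hypothesis E_rim : forall r r' t, 1 <= r -> 1 <= r' -> E (r, t) (r', t).
Hypothesis E_period : forall r t, E (r, t) (r, t + N).
Hypothesis E_arc : forall n s, glued_arc n -> 0 <= s <= 1 ->
  E (1, n%:R + s) (1, n%:R + 3 - s).

Lemma polar_fibre u w : polar u = polar w -> E u w.
Proof.
case: u w => [r t] [r' t'] eqp; have re : radius r = radius r'.
  have /eqP := polar_norm (r, t); rewrite eqp polar_norm /= eqrXn2//.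
    by move/eqP.
  by case/andP: (radius_itv r').
  by case/andP: (radius_itv r).
have [r0|r0] := leP r 0.
  apply: E_centre => //; rewrite leNgt -radius_gt0 -re radius_le0//.
  by rewrite ltxx.
have r'0 : 0 < r' by rewrite -radius_gt0 -re radius_gt0.
have [k ->] : exists k : int, t' = t + N * k%:~R.
  apply: boundary_unique; move: eqp; rewrite /polar /= re => -[e1 e2].
  have rn : radius r' != 0 by rewrite lt0r_neq0// radius_gt0.
  by congr (_, _); [exact: mulfI e1|exact: mulfI e2].
have E1 v : E (r, v) (r', v).
  have [r1|r1] := ltP r 1.
    have r'1 : r' < 1 by rewrite -radius_lt1 -re radius_lt1.
    by move: re; rewrite !radius_id ?(ltW r0) ?(ltW r1) ?(ltW r'0) ?(ltW r'1)// => ->.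
  by apply: E_rim => //; rewrite leNgt -radius_lt1 -re radius_lt1 -leNgt.
have EN n v : E (r, v) (r, v + N * n%:R).
  elim: n => [|n IH]; first by rewrite mulr0 addr0.
  apply: E_trans IH _; rewrite -natr1 mulrDr mulr1 addrA; exact: E_period.
apply: E_trans (E1 _); case: k => n; first exact: EN.
rewrite NegzE mulrNz mulrN; apply: E_sym.
by rewrite -{2}(subrK (N * n.+1%:R) t); exact: EN.
Qed.

(** An induction principle for points with the same image: an equivalence relation containing the
    elementary identifications contains all of them. *)
Lemma plane_fibre u w : plane u = plane w -> E u w.
Proof.
move=> /eqmodP/asboolP H.
suff {u w H} P z z' : clos_refl_sym_trans _ (@side_pairing R g) z z' ->
    forall u w, polar u = set_val z -> polar w = set_val z' -> E u w.
  exact: P H _ _ erefl erefl.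
elim.
- move=> {}z {}z' [k [s [kg s01 zz]]] u w uz wz.
  suff [n [ng nz nz']] : exists n, [/\ glued_arc n,
      set_val z = boundary_point g (n%:R + s) &
      set_val z' = boundary_point g (n%:R + 3 - s)].
    apply: E_trans (E_trans (E_arc ng s01) _).
      by apply: polar_fibre; rewrite polar_rim uz.
    by apply: polar_fibre; rewrite polar_rim wz.
  case: zz => -[-> ->]; [exists (4 * k)%N|exists (4 * k + 1)%N]; split=> //.
  + by rewrite /glued_arc ltn_pmul2l// kg modnMr.
  + by rewrite natrD.
  + rewrite /glued_arc mulnC modnMDl andbT; move: kg; lia.
  + by rewrite -natrD -addnA.
- move=> {}z u w uz wz; apply: polar_fibre; by rewrite uz.
- move=> {}z {}z' _ IH u w uz wz; apply: E_sym; exact: IH.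
- move=> x y z0 _ IH _ IH' u w ux wz.
  have [v [_ _ vy]] := polar_surj (set_valP y).
  exact: E_trans (IH _ _ ux vy) (IH' _ _ vy wz).
Qed.

End Fibres.

End PlaneMap.

(** * Classes of paths with lifted endpoints *)


Section LoopClasses.
Local Open Scope classical_set_scope.
Local Open Scope ring_scope.
Local Open Scope quotient_scope.
Context (R : realType) (X : topologicalType).
Local Notation I := (unit_interval R).

Definition path_between (x : X) (p : I -> X) (y : X) : Prop :=
  [/\ continuous p, p zero = x & p one = y].

Lemma path_cst x : path_between x (cst x) x.
Proof. by split=> //; exact: cst_continuous. Qed.

Lemma path_concat x p y q z : path_between x p y -> path_between y q z ->
  path_between x (concat p q) z.
Proof.
move=> [cp p0 p1] [cq q0 q1]; split; rewrite ?concat0 ?concat1//.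
by apply: concat_continuous => //; rewrite p1.
Qed.

Lemma path_reverse x p y : path_between x p y -> path_between y (reverse p) x.
Proof.
by move=> [cp p0 p1]; split; rewrite ?reverse0 ?reverse1//; exact: reverse_continuous.
Qed.

Lemma concat_cstl x p y : path_between x p y -> homotopic (concat (cst x) p) p.
Proof. by case=> cp <- _; exact: concat1p_homotopic. Qed.

Lemma concat_cstr x p y : path_between x p y -> homotopic (concat p (cst y)) p.
Proof. by case=> cp _ <-; exact: concatp1_homotopic. Qed.

Lemma concat_homl x p y p' q z : path_between x p y -> path_between y q z ->
  homotopic p p' -> homotopic (concat p q) (concat p' q).
Proof.
move=> [_ _ p1] [cq q0 _] pp; apply: concat_homotopic => //; first by rewrite p1 q0.
exact: homotopic_refl.
Qed.

Lemma concat_homr x p y q q' z : path_between x p y -> path_between y q z ->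
  homotopic q q' -> homotopic (concat p q) (concat p q').
Proof.
move=> [cp _ p1] [_ q0 _] pp; apply: concat_homotopic => //; first by rewrite p1 q0.
exact: homotopic_refl.
Qed.

Lemma concatA_hom x p y q z r w : path_between x p y -> path_between y q z ->
  path_between z r w ->
  homotopic (concat (concat p q) r) (concat p (concat q r)).
Proof.
by move=> [? _ p1] [? q0 q1] [? r0 _]; apply: concatA_homotopic; rewrite ?p1 ?q1.
Qed.

Lemma concat_Vp x b y q z : path_between y b x -> path_between x q z ->
  homotopic (concat (reverse b) (concat b q)) q.
Proof.
move=> hb hq; have hbV := path_reverse hb.
apply: homotopic_trans (homotopic_sym (concatA_hom hbV hb hq)) _.
have hVb : homotopic (concat (reverse b) b) (cst x).
  have := concatpV_homotopic (reverse_continuous (let: And3 c _ _ := hb in c)).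
  by rewrite reverseK reverse0; case: hb => _ _ ->.
apply: homotopic_trans (concat_homl (path_concat hbV hb) hq hVb) _.
exact: concat_cstl hq.
Qed.

Section Based.
Variable x0 : X.
Local Notation pi1 := (fundamental_group R x0).

Definition loop_class (p : I -> X) : pi1 :=
  if pselect (path_between x0 p x0) is left h
  then let: And3 c h0 h1 := h in \pi_pi1 (mk_path c h0 h1) else 1%g.

Lemma loop_class_repr p : path_between x0 p x0 ->
  homotopic (repr (loop_class p)) p.
Proof.
by move=> h; rewrite /loop_class; case: pselect => // -[c h0 h1]; exact: pi1_repr.
Qed.

Lemma loop_class_repr_id (x : pi1) : path_between x0 (repr x) x0.
Proof. by split; [exact: loop_continuous|exact: path_zero|exact: path_one]. Qed.

Lemma loop_class_eq p (x : pi1) : path_between x0 p x0 -> homotopic p (repr x) ->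
  loop_class p = x.
Proof.
move=> hp px; rewrite -(reprK (loop_class p)) -(reprK x); apply/pi1_eqP.
exact: homotopic_trans (loop_class_repr hp) px.
Qed.

Lemma loop_class_hom p q : path_between x0 p x0 -> path_between x0 q x0 ->
  homotopic p q -> loop_class p = loop_class q.
Proof.
move=> hp hq pq; apply: loop_class_eq => //.
exact: homotopic_trans pq (homotopic_sym (loop_class_repr hq)).
Qed.

Lemma loop_class_concat p q : path_between x0 p x0 -> path_between x0 q x0 ->
  loop_class (concat p q) = (loop_class p * loop_class q)%g.
Proof.
move=> hp hq; apply: loop_class_eq; first exact: path_concat hp hq.
apply: homotopic_trans _ (homotopic_sym
  (pi1_repr (loop_concat (repr (loop_class p)) (repr (loop_class q))))).
case: (hp) => _ _ p1; case: (hq) => _ q0 _.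
apply: concat_homotopic; first by rewrite p1.
  exact: homotopic_sym (loop_class_repr hp).
exact: homotopic_sym (loop_class_repr hq).
Qed.

Lemma loop_class_cst : loop_class (cst x0) = 1%g.
Proof.
apply: loop_class_eq; first exact: path_cst.
exact: homotopic_sym (pi1_repr (loop_cst R x0)).
Qed.

End Based.
End LoopClasses.

Section Homotopies.
Local Open Scope classical_set_scope.
Local Open Scope ring_scope.
Context (R : realType).
Local Notation I := (unit_interval R).

Definition line (u w : R * R) (s : I) : R * R :=
  (u.1 + uval s * (w.1 - u.1), u.2 + uval s * (w.2 - u.2)).

Lemma continuous_line (Y : topologicalType) (u w : Y -> R * R) (s : Y -> I) :
  continuous u -> continuous w -> continuous s ->
  continuous (fun y => line (u y) (w y) (s y)).
Proof.
move=> cu cw cs.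
have c1 (v : Y -> R * R) : continuous v -> continuous (fun y => (v y).1).
  by move=> cv; exact: continuous_compose cv (@continuous_fst _ _).
have c2 (v : Y -> R * R) : continuous v -> continuous (fun y => (v y).2).
  by move=> cv; exact: continuous_compose cv (@continuous_snd _ _).
have cs' : continuous (fun y => uval (s y)).
  exact: continuous_compose cs (@uval_continuous R).
apply: continuous_pair => y.
  apply: cvgD; first exact: c1.
  by apply: cvgM; [exact: cs'|apply: cvgB; exact: c1].
apply: cvgD; first exact: c2.
by apply: cvgM; [exact: cs'|apply: cvgB; exact: c2].
Qed.

Lemma line0 u w : line u w zero = u.
Proof. by rewrite /line uval0 !mul0r !addr0 -surjective_pairing. Qed.

Lemma line1 u w : line u w one = w.
Proof. by rewrite /line uval1 !mul1r ![_ + (_ - _)]addrC !subrK -surjective_pairing. Qed.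

Lemma line_cst u s : line u u s = u.
Proof. by rewrite /line !subrr !mulr0 !addr0 -surjective_pairing. Qed.

(** The plane is convex, so the lifts are joined by segments. *)
Lemma plane_homotopic (X : topologicalType) (f : R * R -> X) (a b : I -> R * R) :
  continuous f -> continuous a -> continuous b ->
  a zero = b zero -> a one = b one -> homotopic (f \o a) (f \o b).
Proof.
move=> cf ca cb ab0 ab1; exists (fun z => f (line (a z.1) (b z.1) z.2)); split => /=.
- apply: continuous_compose cf; apply: continuous_line.
  + exact: continuous_compose (@continuous_fst _ _) ca.
  + exact: continuous_compose (@continuous_fst _ _) cb.
  + exact: continuous_snd.
- by move=> s; rewrite line0.
- by move=> s; rewrite line1.
- by move=> t; rewrite ab0 line_cst.
- by move=> t; rewrite ab1 line_cst.
Qed.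

Lemma comp_concat (X Y : topologicalType) (f : X -> Y) (p q : I -> X) :
  f \o concat p q = concat (f \o p) (f \o q).
Proof. by apply/funext => s; rewrite /= /concat; case: ifP. Qed.

Lemma concat_cst (X : topologicalType) (x : X) : concat (cst x : I -> X) (cst x) = cst x.
Proof. by apply/funext => s; rewrite /concat; case: ifP. Qed.

Lemma square_homotopic (X : topologicalType) (H : I * I -> X) : continuous H ->
  homotopic (concat (fun s => H (zero, s)) (fun s => H (s, one)))
            (concat (fun s => H (s, zero)) (fun s => H (one, s))).
Proof.
move=> cH; pose f u := H (clamp u.1, clamp u.2).
have cf : continuous f.
  apply: continuous_compose cH; apply: continuous_pair.
    exact: continuous_compose (@continuous_fst _ _) (@clamp_continuous R).
  exact: continuous_compose (@continuous_snd _ _) (@clamp_continuous R).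
have cl (u w : R * R) : continuous (line u w).
  by apply: continuous_line; [exact: cst_continuous..|move=> ?; exact: cvg_id].
rewrite (_ : (fun s => H (zero, s)) = f \o line (0, 0) (0, 1)); last first.
  by apply/funext => s; rewrite /f /= /line /= subrr subr0 mulr0 mulr1 !add0r uvalK.
rewrite (_ : (fun s => H (s, one)) = f \o line (0, 1) (1, 1)); last first.
  by apply/funext => s; rewrite /f /= /line /= subrr subr0 mulr0 mulr1 add0r addr0 uvalK.
rewrite (_ : (fun s => H (s, zero)) = f \o line (0, 0) (1, 0)); last first.
  by apply/funext => s; rewrite /f /= /line /= subrr subr0 mulr0 mulr1 !add0r uvalK.
rewrite (_ : (fun s => H (one, s)) = f \o line (1, 0) (1, 1)); last first.
  by apply/funext => s; rewrite /f /= /line /= subrr subr0 mulr0 mulr1 add0r addr0 uvalK.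
rewrite -!comp_concat; apply: plane_homotopic => //.
- by apply: concat_continuous; rewrite ?line0 ?line1.
- by apply: concat_continuous; rewrite ?line0 ?line1.
- by rewrite !concat0 !line0.
- by rewrite !concat1 !line1.
Qed.

End Homotopies.

Section PlaneClasses.
Local Open Scope classical_set_scope.
Local Open Scope ring_scope.
Local Open Scope quotient_scope.
Context (R : realType) (X : topologicalType) (f : R * R -> X).
Hypothesis f_cont : continuous f.
Variable u0 : R * R.
Local Notation I := (unit_interval R).
Local Notation pi1 := (fundamental_group R (f u0)).

Lemma line_path u w : path_between (f u) (f \o line u w) (f w).
Proof.
split; rewrite /= ?line0 ?line1//; apply: continuous_compose f_cont.
by apply: continuous_line; [exact: cst_continuous..|move=> ?; exact: cvg_id].
Qed.

(* The arguments u and w are lifts of the endpoints of p: they select the paths from and back to the base point. *)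
Definition tailed (u : R * R) (p : I -> X) (w : R * R) : I -> X :=
  concat (f \o line u0 u) (concat p (reverse (f \o line u0 w))).

Definition cl u p w : pi1 := loop_class (f u0) (tailed u p w).

Lemma tailed_path u p w : path_between (f u) p (f w) ->
  path_between (f u0) (tailed u p w) (f u0).
Proof.
move=> hp; apply: path_concat (line_path u0 u) _; apply: path_concat hp _.
exact: path_reverse (line_path u0 w).
Qed.

Lemma cl_hom u p q w : path_between (f u) p (f w) -> path_between (f u) q (f w) ->
  homotopic p q -> cl u p w = cl u q w.
Proof.
move=> hp hq pq; apply: loop_class_hom; [exact: tailed_path..|].
have hV := path_reverse (line_path u0 w).
apply: concat_homr (line_path u0 u) (path_concat hp hV) _.
exact: concat_homl hp hV pq.
Qed.

Lemma cl_mul u p w q v : path_between (f u) p (f w) -> path_between (f w) q (f v) ->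
  (cl u p w * cl w q v)%g = cl u (concat p q) v.
Proof.
move=> hp hq; rewrite -loop_class_concat; [|exact: tailed_path..].
have hu := line_path u0 u; have hw := line_path u0 w; have hv := line_path u0 v.
have hwV := path_reverse hw; have hvV := path_reverse hv.
apply: loop_class_hom.
- by apply: path_concat; exact: tailed_path.
- by apply: tailed_path; exact: path_concat hp hq.
have hqv := path_concat hq hvV.
apply: homotopic_trans (concatA_hom hu (path_concat hp hwV) (path_concat hw hqv)) _.
apply: concat_homr hu (path_concat (path_concat hp hwV) (path_concat hw hqv)) _.
apply: homotopic_trans (concatA_hom hp hwV (path_concat hw hqv)) _.
apply: homotopic_trans (concat_homr hp (path_concat hwV (path_concat hw hqv)) (concat_Vp hw hqv)) _.
exact: homotopic_sym (concatA_hom hp hq hvV).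
Qed.

(** The tails are images of segments, so the whole loop lifts to the plane and contracts there. *)
Lemma cl_plane (a : I -> R * R) : continuous a -> cl (a zero) (f \o a) (a one) = 1%g.
Proof.
move=> ca; rewrite -(loop_class_cst R (f u0)).
have pa : path_between (f (a zero)) (f \o a) (f (a one)).
  by split=> //; exact: continuous_compose ca f_cont.
apply: loop_class_hom; [exact: tailed_path|exact: path_cst|].
have cl u w : continuous (@line R u w).
  by apply: continuous_line; [exact: cst_continuous..|move=> ?; exact: cvg_id].
rewrite /tailed -[reverse _]/(f \o reverse (line u0 (a one))) -!comp_concat.
rewrite -[cst (f u0)]/(f \o cst u0).
apply: plane_homotopic => //.
- apply: concat_continuous => //; last by rewrite concat0 line1.
  by apply: concat_continuous; rewrite ?reverse0 ?line1//; exact: reverse_continuous.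
- exact: cst_continuous.
- by rewrite concat0 line0.
- by rewrite !concat1 reverse1 line0.
Qed.

(** The loop goes out to [u] and returns from [w], another lift of the same point. As liftable paths
    are trivial, such loops are the candidates for generators. *)
Definition jump u w : pi1 := cl u (cst (f u)) w.

Lemma jump_path u w : f u = f w -> path_between (f u) (cst (f u) : I -> X) (f w).
Proof. by move=> uw; split=> //; exact: cst_continuous. Qed.

Lemma jump_mul u w v : f u = f w -> f w = f v -> (jump u w * jump w v)%g = jump u v.
Proof.
move=> uw wv; rewrite /jump cl_mul; do ?[exact: jump_path].
by rewrite -uw concat_cst.
Qed.

Lemma jump_refl u : jump u u = 1%g.
Proof. by have := @cl_plane (cst u); apply; exact: cst_continuous. Qed.

Lemma jump_sym u w : f u = f w -> jump w u = (jump u w)^-1%g.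
Proof.
by move=> uw; apply: (mulgI (jump u w)); rewrite mulgV jump_mul// jump_refl.
Qed.

(** The endpoints may move during the homotopy, provided that they follow liftable paths, whose
    classes are trivial. *)
Lemma cl_square (H : I * I -> X) (a b : I -> R * R) : continuous H ->
  continuous a -> continuous b ->
  (forall s, H (zero, s) = f (a s)) -> (forall s, H (one, s) = f (b s)) ->
  (cl (a zero) (fun s => H (s, zero)) (b zero) =
   cl (a one) (fun s => H (s, one)) (b one))%g.
Proof.
move=> cH ca cb Ha Hb.
have ch s : continuous (fun t => H (t, s)).
  apply: continuous_compose cH; apply: continuous_pair; last exact: cst_continuous.
  by move=> ?; exact: cvg_id.
have hb s : path_between (f (a s)) (fun t => H (t, s)) (f (b s)) by split.
have pa : path_between (f (a zero)) (f \o a) (f (a one)).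
  by split=> //; exact: continuous_compose ca f_cont.
have pb : path_between (f (b zero)) (f \o b) (f (b one)).
  by split=> //; exact: continuous_compose cb f_cont.
rewrite -[LHS]mulg1 -(cl_plane cb) cl_mul// -[RHS]mul1g -(cl_plane ca) cl_mul//.
apply: cl_hom; [exact: path_concat (hb _) pb|exact: path_concat pa (hb _)|].
have := homotopic_sym (square_homotopic cH).
by rewrite (funext Ha : _ = f \o a) (funext Hb : _ = f \o b).
Qed.

Lemma jump_move (a b : I -> R * R) : continuous a -> continuous b ->
  (forall s, f (a s) = f (b s)) -> jump (a zero) (b zero) = jump (a one) (b one).
Proof.
move=> ca cb ab.
apply: (@cl_square (fun z => f (a z.2)) a b) => //.
apply: continuous_compose f_cont; exact: continuous_compose (@continuous_snd _ _) ca.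
Qed.

Lemma cl_base (x : pi1) : cl u0 (repr x) u0 = x.
Proof.
have hx := loop_class_repr_id x.
apply: loop_class_eq; first exact: tailed_path.
have E : f \o line u0 u0 = cst (f u0) by apply/funext => s; rewrite /= line_cst.
rewrite /tailed E; have hx1 := path_concat hx (path_cst R (f u0)).
exact: homotopic_trans (concat_cstl hx1) (concat_cstr hx).
Qed.

End PlaneClasses.

(** * Charts that contract, and generation by jumps *)

Section Contraction.
Local Open Scope classical_set_scope.
Local Open Scope ring_scope.
Local Open Scope quotient_scope.
Context (R : realType) (X : topologicalType) (f : R * R -> X).
Hypotheses (f_cont : continuous f) (f_surj : forall x, exists u, f u = x).
Hypothesis f_open : forall O : set X, open (f @^-1` O) -> open O.
Variable u0 : R * R.
Local Notation I := (unit_interval R).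
Local Notation pi1 := (fundamental_group R (f u0)).
Local Notation jump := (jump f u0).
Local Notation cl := (cl f u0).

(** A deformation given on lifts and compatible with [f]. At time 0 its image is only locally
    constant, because a chart may have several components. *)
Definition contraction (V : set (R * R)) (k : (R * R) * R -> R * R) : Prop :=
  [/\ open V, forall u w, f u = f w -> V u -> V w,
      forall u s, V u -> {for (u, s), continuous k},
      forall u w s, V u -> f u = f w -> f (k (u, s)) = f (k (w, s)) &
      forall u, V u -> k (u, 1) = u /\ \forall w \near u, f (k (w, 0)) = f (k (u, 0))].

Section Chart.
Variables (V : set (R * R)) (k : (R * R) * R -> R * R).
Hypothesis kV : contraction V k.

Let V_open : open V. Proof. by case: kV. Qed.
Let V_sat u w : f u = f w -> V u -> V w. Proof. by case: kV => _ H _ _ _; exact: H. Qed.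
Let k_cont u s : V u -> {for (u, s), continuous k}.
Proof. by case: kV => _ _ H _ _; exact: H. Qed.
Let k_fibre u w s : V u -> f u = f w -> f (k (u, s)) = f (k (w, s)).
Proof. by case: kV => _ _ _ H _; exact: H. Qed.
Let k1 u : V u -> k (u, 1) = u. Proof. by case: kV => _ _ _ _ H /H[]. Qed.
Let k0 u : V u -> \forall w \near u, f (k (w, 0)) = f (k (u, 0)).
Proof. by case: kV => _ _ _ _ H /H[]. Qed.

Definition lift (x : X) : R * R := projT1 (cid (f_surj x)).

Lemma liftE x : f (lift x) = x.
Proof. by rewrite /lift; case: cid. Qed.

Definition slide (z : X * R) : X := f (k (lift z.1, z.2)).

Lemma slideE u s : V u -> slide (f u, s) = f (k (u, s)).
Proof.
by move=> Vu; rewrite /slide /=; apply/esym/k_fibre => //; rewrite liftE.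
Qed.

(* Whitehead: f times the identity of a compact interval is again a quotient map. *)
Lemma slide_continuous u s : V u -> {for (f u, s), continuous slide}.
Proof.
move=> Vu; move=> O' /=; rewrite slideE// nbhsE => -[ O [oO Ous] sOO'].
apply: filterS sOO' _; have cfk w s' : V w -> {for (w, s'), continuous (f \o k)}.
  move=> Vw; apply: continuous_comp; [exact: k_cont|exact: f_cont].
have Onear w s' : V w -> O (f (k (w, s'))) -> \forall z \near (w, s'), O (f (k z)).
  by move=> Vw Ow; apply: (cfk w s' Vw); exact: open_nbhs_nbhs.
have [e e0 He] : exists2 e, 0 < e & forall s', s - e <= s' <= s + e -> O (f (k (u, s'))).
  have /nbhs_ballP[e /= e0 He] := Onear u s Vu Ous.
  exists (e / 2); first by rewrite divr_gt0.
  move=> s' /andP[s1 s2]; apply: (He (u, s')); split; first exact: ballxx.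
  rewrite /ball /= ltr_distlC; apply/andP; split; lra.
pose W : set X := [set x | exists w, [/\ f w = x, V w &
  forall s', s - e <= s' <= s + e -> O (f (k (w, s')))]].
have WE w : W (f w) -> V w /\ forall s', s - e <= s' <= s + e -> O (f (k (w, s'))).
  move=> [w' [ww Vw' H]]; have Vw := V_sat ww Vw'; split=> // s' hs'.
  by rewrite -(k_fibre _ Vw' ww); exact: H.
have oW : open W.
  apply: f_open; rewrite openE => w /= /WE[Vw H].
  have := @segment_compact R (s - e) (s + e) => /compact_near_coveringP cJ.
  have := cJ _ (nbhs w) (fun w' s' => O (f (k (w', s')))) (nbhs_filter w).
  have H' : forall s', `[s - e, s + e]%classic s' ->
      \forall s2 \near s' & w' \near w, O (f (k (w', s2))).
    move=> s' /=; rewrite in_itv /= => /H /(Onear w s' Vw).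
    move=> [[A B] /= [nA nB] AB]; exists (B, A) => // -[s2 w'] /= [Bs Aw].
    exact: (AB (w', s2)).
  move=> /(_ H') Hn; have nV : nbhs w V by exact: open_nbhs_nbhs.
  change (nbhs w (f @^-1` W)); apply: filterS2 Hn nV => w' /= H1 Vw'.
  by exists w'; split=> // s' hs'; apply: H1; rewrite /= in_itv.
have HW : \forall z \near (f u, s), O (slide z); last exact: HW.
exists (W, [set s' | `|s' - s| < e]); last first.
  move=> [x s'] [/= [w [<- Vw H]] hs']; rewrite slideE//; apply: H.
  by move: hs'; rewrite ltr_norml => /andP[]; lra.
split=> /=.
  by apply: open_nbhs_nbhs; split=> //; exists u.
by apply/nbhs_ballP; exists e => //= s'; rewrite /ball /= distrC.
Qed.

(** The deformation shrinks a path in [N] to a constant one while its ends follow liftable paths, so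
    [cl_square] turns its class into a jump. *)
Lemma contraction_local u : V u -> exists2 N, open N /\ N (f u) &
  forall u1 (p : I -> X) u2, path_between (f u1) p (f u2) -> (forall s, N (p s)) ->
    f (k (u1, 0)) = f (k (u2, 0)) /\ cl u1 p u2 = jump (k (u1, 0)) (k (u2, 0)).
Proof.
move=> Vu; pose N := [set x | exists w,
  [/\ f w = x, V w & f (k (w, 0)) = f (k (u, 0))]].
have NE w : N (f w) -> V w /\ f (k (w, 0)) = f (k (u, 0)).
  move=> [w' [ww Vw' H]]; split; first exact: V_sat ww Vw'.
  by rewrite -(k_fibre _ Vw' ww).
exists N.
  split; last by exists u.
  apply: f_open; rewrite openE => w /= /NE[Vw E].
  have nV : nbhs w V by exact: open_nbhs_nbhs.
  change (nbhs w (f @^-1` N)); apply: filterS2 (k0 Vw) nV => w' /= H1 Vw'.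
  by exists w'; rewrite H1.
move=> u1 p u2 hp Np; have [cp p0 p1] := hp.
have V1 : V u1 by have := Np zero; rewrite p0 => /NE[].
have V2 : V u2 by have := Np one; rewrite p1 => /NE[].
have E1 : f (k (u1, 0)) = f (k (u, 0)) by have := Np zero; rewrite p0 => /NE[].
have E2 : f (k (u2, 0)) = f (k (u, 0)) by have := Np one; rewrite p1 => /NE[].
split; first by rewrite E1.
pose H (z : I * I) := slide (p z.1, uval z.2).
have cH : continuous H.
  move=> z; apply: (@continuous_comp _ _ _ (fun z : I * I => (p z.1, uval z.2)) slide).
    have c1 : continuous (fun z : I * I => p z.1).
      exact: continuous_compose (@continuous_fst _ _) cp.
    exact: (continuous_pair c1 (@continuous_uval2 R)).
  by have [w [<- Vw _]] := Np z.1; exact: slide_continuous.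
have ck w : V w -> continuous (fun s : I => k (w, uval s)).
  move=> Vw s; apply: (@continuous_comp _ _ _ (fun s : I => (w, uval s)) k); last exact: k_cont.
  exact: (continuous_pair (@cst_continuous _ _ w) (@uval_continuous R)).
have Ha s : H (zero, s) = f (k (u1, uval s)) by rewrite /H /= p0 slideE.
have Hb s : H (one, s) = f (k (u2, uval s)) by rewrite /H /= p1 slideE.
have := cl_square f_cont u0 cH (ck _ V1) (ck _ V2) Ha Hb.
rewrite /= uval0 uval1 !k1//.
rewrite (_ : (fun s => H (s, zero)) = cst (f (k (u1, 0)))); last first.
  by apply/funext => s; rewrite /H /= uval0; have [w [<- Vw E]] := Np s; rewrite slideE// E E1.
rewrite (_ : (fun s => H (s, one)) = p); last first.
  by apply/funext => s; rewrite /H /= uval1; have [w [<- Vw _]] := Np s; rewrite slideE// k1.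
by [].
Qed.

End Chart.

Section Generation.
Variable P : pi1 -> Prop.
Hypothesis P_mul : forall x y, P x -> P y -> P (x * y)%g.
Hypothesis P_jump : forall u w, f u = f w -> P (jump u w).
Hypothesis charts : forall u, exists V k, contraction V k /\ V u.

(** Classes multiply along a subdivision, so [cousin] reduces a loop to pieces short enough for
    [contraction_local]. *)
Lemma generated_by_jumps x : P x.
Proof.
pose p := repr x; have [cp p0 p1] := loop_class_repr_id x; rewrite -/p in cp p0 p1.
pose sub a b (s : I) := p (clamp ((b - a) * uval s + a)).
have hsub a b u w : p (clamp a) = f u -> p (clamp b) = f w ->
    path_between (f u) (sub a b) (f w).
  move=> au bw; split.
  - apply: continuous_compose cp; apply: continuous_clamp; exact: uval_continuous.
  - by rewrite /sub uval0 mulr0 add0r.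
  - by rewrite /sub uval1 mulr1 subrK.
suff H : forall u w, p (clamp 0) = f u -> p (clamp 1) = f w -> P (cl u (sub 0 1) w).
  rewrite -(cl_base f_cont x) -/p.
  have -> : p = sub 0 1 :> (I -> X).
    by apply/funext => s; rewrite /sub subr0 mul1r addr0 uvalK.
  by apply: H; rewrite -/zero -/one ?p0 ?p1.
pose Q a b := forall u w, p (clamp a) = f u -> p (clamp b) = f w -> P (cl u (sub a b) w).
apply: (@cousin R Q) => //.
  move=> a b d ab bd Qab Qbd u w au dw.
  have [v vb] := f_surj (p (clamp b)).
  have hab := hsub a b _ _ au (esym vb); have hbd := hsub b d _ _ (esym vb) dw.
  have := P_mul (Qab u v au (esym vb)) (Qbd v w (esym vb) dw).
  rewrite cl_mul// (@cl_hom _ _ _ f_cont _ _ _ (sub a d))//.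
  + exact: path_concat hab hbd.
  + exact: hsub.
  (* The concatenation runs through [a, b] and [b, d] at different speeds; it is a piecewise affine
     reparametrisation of [sub a d]. *)
  pose h (s : I) := if uval s <= 2^-1 then (2 * (b - a)) * uval s + a
    else (2 * (d - b)) * uval s + (b - (d - b)).
  rewrite (_ : concat _ _ = fun s => p (clamp (h s))); last first.
    apply/funext => s; rewrite /h /concat /sub; have := uval_itv s.
    case: ifP => s2 /andP[s0 s1]; rewrite clampE; do ?[congr (p (clamp _)); ring].
      by apply/andP; split; lra.
    by apply/andP; split; lra.
  have ca := @continuous_affine R I.
  apply: reparam_homotopic => //.
  + apply: if_le_continuous; do ?[exact: ca (@uval_continuous R)].
      exact: uval_continuous.
    by move=> s /= ->; field.
  + exact: ca (@uval_continuous R).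
  + by rewrite /h uval0 !mulr0 invr_ge0 ler0n add0r.
  + rewrite /h uval1 ifF; first by ring.
    by apply/negbTE; rewrite -ltNge; lra.
move=> t _; have [u ut] := f_surj (p (clamp t)).
have [V [k [kV Vu]]] := charts u.
have [N [oN Nu] HN] := contraction_local kV Vu.
have [e e0 He] : exists2 e : R, 0 < e & forall s, `|s - t| < e -> N (p (clamp s)).
  apply: near_dist; have cpc := continuous_compose (@clamp_continuous R) cp.
  by apply: (cpc t); apply: open_nbhs_nbhs; split=> //; rewrite -ut.
exists e => // a b /andP[_ at'] /andP[tb _] ae be u1 u2 a1 b2.
have [|E ->] := HN u1 (sub a b) u2 (hsub _ _ _ _ a1 b2).
  move=> s; apply: He; have /andP[s0 s1] := uval_itv s.
  by rewrite ltr_norml; apply/andP; split; nra.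
exact: P_jump.
Qed.

End Generation.
End Contraction.

(** * Generators and relator *)


Section RimCharts.
Local Open Scope classical_set_scope.
Local Open Scope ring_scope.
Context (R : realType).

Lemma floor_between (x : R) (m : int) : m%:~R < x < m%:~R + 1 ->
  Num.floor x = m /\ (Num.floor x)%:~R < x.
Proof.
move=> /andP[mx xm]; suff -> : Num.floor x = m by [].
by apply: floor_def; rewrite (ltW mx) intrD.
Qed.

Lemma floor_inside (x : R) (m : int) : (Num.floor x)%:~R < x ->
  m%:~R <= x <= m%:~R + 1 -> Num.floor x = m /\ m%:~R < x < m%:~R + 1.
Proof.
move=> fx /andP[mx xm]; have /andP[_ xf] := floor_itv x.
suff E : Num.floor x = m by rewrite -E fx -[1]/(1%:~R) -intrD.
have : (Num.floor x)%:~R < (m + 1)%:~R :> R by rewrite intrD (lt_le_trans fx).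
have : m%:~R < (Num.floor x + 1)%:~R :> R by exact: le_lt_trans xf.
by rewrite !ltr_int; lia.
Qed.

Lemma near_floor (t : R) : (Num.floor t)%:~R < t ->
  \forall t' \near t, Num.floor t' = Num.floor t /\ (Num.floor t')%:~R < t'.
Proof.
move=> ft; have /andP[_ tf] := floor_itv t.
have [n1 n2] : (\forall t' \near t, (Num.floor t)%:~R < t') /\
    (\forall t' \near t, t' < (Num.floor t + 1)%:~R).
  by split; [exact: lt_nbhsr|exact: lt_nbhsl].
apply: filterS2 n1 n2 => t' t1 t2.
suff -> : Num.floor t' = Num.floor t by [].
by apply/floor_def; rewrite (ltW t1).
Qed.

Section RimChart.
Variable d : R.
Hypothesis d01 : d = 0 \/ d = 2^-1.

(* For d = 0, the open arcs, which retract to their midpoints; for d = 1/2, the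
   star of the vertex. *)
Definition rim_chart : set (R * R) :=
  [set u | 0 < u.1 /\ (Num.floor (u.2 + d))%:~R < u.2 + d].
Definition rim_centre (t : R) : R := (Num.floor (t + d))%:~R + 2^-1 - d.
Definition rim_slide (z : (R * R) * R) : R * R :=
  (1 + radius z.2 * (z.1.1 - 1),
   rim_centre z.1.2 + radius z.2 * (z.1.2 - rim_centre z.1.2)).

(** The gluing matches the centre n + c with the centre n + 3 - c of the partner. For d = 1/2, [c]
    is 0 or 1 according to the half of the arc that contains [s]. *)
Lemma rim_arc n (s : R) : 0 <= s <= 1 ->
  (Num.floor (n%:R + s + d))%:~R < n%:R + s + d ->
  exists2 c, 0 <= c <= 1 & rim_centre (n%:R + s) = n%:R + c /\
    rim_centre (n%:R + 3 - s) = n%:R + 3 - c /\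
    (Num.floor (n%:R + 3 - s + d))%:~R < n%:R + 3 - s + d.
Proof.
move=> /andP[s0 s1] F; rewrite /rim_centre.
have floors (i j : nat) c : Num.floor (n%:R + s + d) = (n + i)%:Z ->
    (n + j)%:R < n%:R + 3 - s + d < (n + j)%:R + 1 -> 0 <= c <= 1 ->
    c = i%:R + 2^-1 - d -> 3 - c = j%:R + 2^-1 - d ->
    exists2 c, 0 <= c <= 1 & (Num.floor (n%:R + s + d))%:~R + 2^-1 - d = n%:R + c /\
    (Num.floor (n%:R + 3 - s + d))%:~R + 2^-1 - d = n%:R + 3 - c /\
    (Num.floor (n%:R + 3 - s + d))%:~R < n%:R + 3 - s + d.
  move=> E1; rewrite !pmulrn => /floor_between[-> F2] c01 ci cj; exists c => //.
  by rewrite E1 -!pmulrn !natrD; split; [lra|split; [lra|]]; rewrite -natrD pmulrn.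
have inside (m : nat) : m%:R <= n%:R + s + d <= m%:R + 1 ->
    Num.floor (n%:R + s + d) = m%:Z /\ m%:R < n%:R + s + d < m%:R + 1.
  by rewrite !pmulrn; exact: floor_inside.
case: d01 => de.
  have [|E /andP[h1 h2]] := inside n; first by apply/andP; split; lra.
  by apply: (floors 0%N 2%N 2^-1); rewrite ?addn0 ?natrD//; lra.
have [s2|s2] := leP s 2^-1.
  have [|E /andP[h1 h2]] := inside n; first by apply/andP; split; lra.
  by apply: (floors 0%N 3%N 0); rewrite ?addn0 ?natrD//; lra.
have [|E /andP[h1 h2]] := inside (n + 1)%N; first by rewrite natrD; apply/andP; split; lra.
by move: h1 h2; rewrite natrD => h1 h2; apply: (floors 1%N 2%N 1); rewrite ?natrD//; lra.
Qed.

Lemma rim_arc' n (s : R) : 0 <= s <= 1 ->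
  (Num.floor (n%:R + 3 - s + d))%:~R < n%:R + 3 - s + d ->
  (Num.floor (n%:R + s + d))%:~R < n%:R + s + d.
Proof.
move=> /andP[s0 s1] F.
have inside (m : nat) : m%:R <= n%:R + 3 - s + d <= m%:R + 1 ->
    m%:R < n%:R + 3 - s + d < m%:R + 1.
  by rewrite !pmulrn => /(floor_inside F)[].
have between (m : nat) : m%:R < n%:R + s + d < m%:R + 1 ->
    (Num.floor (n%:R + s + d))%:~R < n%:R + s + d.
  by rewrite pmulrn => /floor_between[].
case: d01 => de.
  have := inside (n + 2)%N; rewrite natrD => /(_ _)/andP[|h1 h2]; first by apply/andP; split; lra.
  by apply: (between n); apply/andP; split; lra.
have [s2|s2] := leP s 2^-1.
  have := inside (n + 3)%N; rewrite natrD => /(_ _)/andP[|h1 h2]; first by apply/andP; split; lra.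
  by apply: (between n); apply/andP; split; lra.
have := inside (n + 2)%N; rewrite natrD => /(_ _)/andP[|h1 h2]; first by apply/andP; split; lra.
by apply: (between (n + 1)%N); rewrite natrD; apply/andP; split; lra.
Qed.

End RimChart.
End RimCharts.

Section SurfaceCharts.
Local Open Scope classical_set_scope.
Local Open Scope ring_scope.
Context (R : realType) (g : nat) (g_gt0 : (0 < g)%N).
Local Notation N := ((4 * g)%:R : R).
Local Notation f := (@plane R g).
Local Notation I := (unit_interval R).

Lemma plane_radius (r r' t : R) : radius r = radius r' -> f (r, t) = f (r', t).
Proof.
move=> rr; rewrite /plane (_ : disc_point g (r, t) = disc_point g (r', t))//.
by apply: val_inj; rewrite /= /polar /= rr.
Qed.

Lemma plane_centre (r r' t t' : R) : r <= 0 -> r' <= 0 -> f (r, t) = f (r', t').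
Proof.
move=> r0 r0'; rewrite /plane (_ : disc_point g (r, t) = disc_point g (r', t'))//.
by apply: val_inj; rewrite /= /polar /= !radius_le0// !mul0r.
Qed.

Lemma plane_rim (r r' t : R) : 1 <= r -> 1 <= r' -> f (r, t) = f (r', t).
Proof. by move=> r1 r1'; apply: plane_radius; rewrite !radius_ge1. Qed.

Lemma plane_period (r t : R) : f (r, t) = f (r, t + N).
Proof.
rewrite /plane (_ : disc_point g (r, t) = disc_point g (r, t + N))//.
apply: val_inj; change (polar g (r, t) = polar g (r, t + N)).
have E : boundary_point g (r, t + N).2 = boundary_point g (r, t).2.
  by rewrite -(boundary_period g_gt0 1 t) mulr1.
by rewrite /polar E.
Qed.

Definition inner_chart : set (R * R) := [set u | u.1 < 1].
Definition inner_slide (z : (R * R) * R) : R * R := (radius z.2 * z.1.1, z.1.2).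

Lemma inner_contraction : contraction f inner_chart inner_slide.
Proof.
pose E u w := (inner_chart u <-> inner_chart w) /\ (inner_chart u ->
  forall s, f (inner_slide (u, s)) = f (inner_slide (w, s))).
have EP u w : f u = f w -> E u w.
  apply: (plane_fibre g_gt0); rewrite /E /inner_chart /inner_slide /=.
  - by [].
  - by move=> {}u v [[H1 H2] H]; split=> // /H2 /H{}H s; rewrite H.
  - move=> {}u v {}w [[H1 H2] H] [[H3 H4] H']; split; first by split=> ?; auto.
    by move=> u1 s; rewrite H// H'//; exact: H1.
  - move=> r r' t t' r0 r0'; split; first by split=> _; lra.
    by move=> _ s; apply: plane_centre; have /andP[] := radius_itv s; nra.
  - by move=> r r' t r1 r1'; split; [split|]; lra.
  - by move=> r t; split=> // _ s; exact: plane_period.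
  - by move=> n s _ _; split=> //; rewrite ltxx.
split.
- rewrite (_ : inner_chart = fst @^-1` [set r : R | r < 1])//.
  have /continuousP := @continuous_fst R R; apply; exact: open_lt.
- by move=> u w /EP[[]].
- move=> u s _; have c1 := @continuous_fst R R; have c2 := @continuous_snd R R.
  have c3 := @continuous_fst (R * R)%type R.
  have c4 := continuous_compose (@continuous_snd (R * R)%type R) (@radius_continuous R).
  have c5 : continuous (fun z : (R * R) * R => radius z.2 * z.1.1).
    by move=> z; apply: cvgM; [exact: c4|exact: (continuous_compose c3 c1)].
  exact: (continuous_pair c5 (continuous_compose c3 c2)).
- by move=> u w s Vu /EP[_]; exact.
move=> u Vu; rewrite /inner_slide /= radius_id ?ler01 ?lexx// mul1r -surjective_pairing.
split=> //; apply: (@filterE _ (nbhs u)) => w; rewrite radius_le0// !mul0r; exact: plane_centre.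
Qed.

Section RimContraction.
Variable d : R.
Hypothesis d01 : d = 0 \/ d = 2^-1.
Local Notation rim_chart := (rim_chart d).
Local Notation rim_slide := (rim_slide d).
Local Notation rim_centre := (rim_centre d).

Lemma floor_period t : Num.floor (t + N + d) = Num.floor (t + d) + (4 * g)%:Z.
Proof.
apply: floor_def; have /andP[] := floor_itv (t + d).
by rewrite !intrD -!pmulrn => *; apply/andP; split; lra.
Qed.

(** A point and its partner slide symmetrically to corresponding centres, so the deformation
    respects the gluing. *)
Lemma rim_contraction : contraction f rim_chart rim_slide.
Proof.
pose E u w := (rim_chart u <-> rim_chart w) /\ (rim_chart u ->
  forall s, f (rim_slide (u, s)) = f (rim_slide (w, s))).
have fN := floor_period.
have EP u w : f u = f w -> E u w.
  apply: (plane_fibre g_gt0); rewrite /E /rim_chart /rim_slide /=.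
  - by [].
  - by move=> {}u v [[H1 H2] H]; split=> // /H2 /H{}H s; rewrite H.
  - move=> {}u v {}w [[H1 H2] H] [[H3 H4] H']; split; first by split=> ?; auto.
    by move=> u1 s; rewrite H// H'//; exact: H1.
  - by move=> r r' t t' r0 r0'; split=> [|[]]; [split=> -[]|]; lra.
  - move=> r r' t r1 r1'; split.
      by split=> -[_ ?]; split=> //; lra.
    by move=> _ s; apply: plane_rim; have /andP[] := radius_itv s; nra.
  - move=> r t; rewrite /rim_centre !fN !intrD -!pmulrn; split.
      by rewrite -addrA [N + d]addrC addrA ltrD2r.
    move=> _ s; rewrite plane_period; congr (f (_, _)); move: (radius s) => q; ring.
  - move=> n s ng s01; split.
      split=> -[_]; first by case/(rim_arc d01 s01)=> c _ [_ [_ ?]].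
      by move=> /(rim_arc' d01 s01).
    move=> -[_ /(rim_arc d01 s01)[c /andP[c0 c1] [-> [-> _]]]] x; case/andP: s01 => s0 s1.
    rewrite subrr mulr0 addr0; have /andP[q0 q1] := radius_itv x.
    move: (radius x) q0 q1 => q q0 q1.
    rewrite (_ : n%:R + c + _ = n%:R + (c + q * (s - c))); last by ring.
    rewrite (arc_glued g_gt0 ng); last by apply/andP; split; nra.
    by congr (f (_, _)); ring.
have nearV u : rim_chart u -> \forall w \near u, rim_chart w /\
    rim_centre w.2 = rim_centre u.2.
  move=> [u1 u2]; have n1 : \forall w \near u, 0 < w.1.
    exact: (@continuous_fst R R u _ (lt_nbhsr u1)).
  have cd : continuous (fun w : R * R => w.2 + d).
    by move=> w; apply: cvgD; [exact: continuous_snd|exact: cvg_cst].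
  have n2 := cd u _ (near_floor u2).
  by apply: filterS2 n1 n2 => w w1 [w2 w3]; rewrite /rim_centre w2.
split.
- by rewrite openE => u Vu; apply: filterS (nearV u Vu) => w [].
- by move=> u w /EP[[]].
- move=> u s Vu; have c1 := @continuous_fst R R; have c2 := @continuous_snd R R.
  have c3 := @continuous_fst (R * R)%type R.
  have c4 := continuous_compose (@continuous_snd (R * R)%type R) (@radius_continuous R).
  pose m := rim_centre u.2.
  have c5 : continuous (fun z : (R * R) * R => 1 + radius z.2 * (z.1.1 - 1)).
    move=> z; apply: cvgD; first exact: cvg_cst.
    apply: cvgM; first exact: c4.
    by apply: cvgB; [exact: (continuous_compose c3 c1)|exact: cvg_cst].
  have c6 : continuous (fun z : (R * R) * R => m + radius z.2 * (z.1.2 - m)).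
    move=> z; apply: cvgD; first exact: cvg_cst.
    apply: cvgM; first exact: c4.
    by apply: cvgB; [exact: (continuous_compose c3 c2)|exact: cvg_cst].
  have c7 := continuous_pair c5 c6.
  apply: cvg_trans (c7 (u, s)); apply: near_eq_cvg.
  have := c3 (u, s) _ (nearV u Vu); apply: (@filterS _ (nbhs (u, s))) => z [_ zE].
  by rewrite /rim_slide zE.
- by move=> u w s Vu /EP[_]; exact.
move=> u Vu; split.
  rewrite /rim_slide /= radius_id ?ler01 ?lexx// !mul1r.
  rewrite (_ : 1 + (u.1 - 1) = u.1); last by ring.
  by rewrite [_ + (u.2 - _)]addrC subrK -surjective_pairing.
apply: filterS (nearV u Vu) => w [_ wE]; rewrite /rim_slide /= wE radius_le0// !mul0r !addr0.
by [].
Qed.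

End RimContraction.

Lemma charts_cover (u : R * R) :
  [\/ inner_chart u, rim_chart 0 u | rim_chart 2^-1 u].
Proof.
case: u => r t; have [r1|r1] := ltP r 1; first by apply: Or31.
have r0 : 0 < r by exact: lt_le_trans ltr01 r1.
have /andP[ft tf] := floor_itv t; rewrite intrD in tf.
have [tn|tn] := ltP (Num.floor t)%:~R t.
  by apply: Or32; split=> //=; rewrite addr0.
apply: Or33; have [|_ F] := @floor_between R (t + 2^-1) (Num.floor t); last by split.
by apply/andP; split; lra.
Qed.

End SurfaceCharts.

Section SurfaceJumps.
Local Open Scope classical_set_scope.
Local Open Scope ring_scope.
Context (R : realType) (g : nat) (g_gt0 : (0 < g)%N) (u0 : R * R).
Local Notation N := ((4 * g)%:R : R).
Local Notation f := (@plane R g).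
Local Notation I := (unit_interval R).
Local Notation pi1 := (fundamental_group R (f u0)).
Local Notation jump := (jump f u0).
Let f_cont := @plane_continuous R g.

(* Go to the midpoint of the arc n and come back from the midpoint of its partner. *)
Definition crossing (n : nat) : pi1 := jump (1, n%:R + 2^-1) (1, n%:R + 3 - 2^-1).

Lemma line_cont (u w : R * R) : continuous (@line R u w).
Proof.
by apply: continuous_line; [exact: cst_continuous..|move=> ?; exact: cvg_id].
Qed.

Lemma jump_line u w : (forall s, f (line u w s) = f u) -> jump u w = 1%g.
Proof.
move=> E; have := cl_plane f_cont u0 (@line_cont u w).
by rewrite line0 line1 (_ : f \o _ = cst (f u))//; apply/funext.
Qed.

Lemma jump_lines u w u' w' : (forall s, f (line u u' s) = f (line w w' s)) ->
  jump u w = jump u' w'.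
Proof.
move=> E; have := jump_move f_cont u0 (@line_cont u u') (@line_cont w w') E.
by rewrite !line0 !line1.
Qed.

Lemma jump_centre (r r' t t' : R) : r <= 0 -> r' <= 0 -> jump (r, t) (r', t') = 1%g.
Proof.
move=> r0 r0'; apply: jump_line => s; apply: plane_centre => //=.
by have /andP[] := uval_itv s; nra.
Qed.

Lemma jump_rim (r r' t : R) : 1 <= r -> 1 <= r' -> jump (r, t) (r', t) = 1%g.
Proof.
move=> r1 r1'; apply: jump_line => s; rewrite /line /= subrr mulr0 addr0.
by apply: plane_rim => //; have /andP[] := uval_itv s; nra.
Qed.

(** Moving both lifts along their radii to the centre keeps the jump, and at the centre the angle is
    irrelevant. *)
Lemma jump_period (r t : R) : jump (r, t) (r, t + N) = 1%g.
Proof.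
rewrite -(@jump_centre 0 0 t (t + N))//; apply: jump_lines => s.
by rewrite /line /= !subrr !mulr0 !addr0 plane_period.
Qed.

Lemma jump_arc n (s : R) : glued_arc g n -> 0 <= s <= 1 ->
  jump (1, n%:R + s) (1, n%:R + 3 - s) = crossing n.
Proof.
move=> ng /andP[s0 s1]; apply: jump_lines => x; have /andP[x0 x1] := uval_itv x.
rewrite /line /= !subrr !mulr0 !addr0; move: (uval x) x0 x1 => q q0 q1.
rewrite (_ : n%:R + s + _ = n%:R + (s + q * (2^-1 - s))); last by ring.
rewrite (arc_glued g_gt0 ng); last by apply/andP; split; nra.
by congr (f (_, _)); ring.
Qed.

(** [plane_fibre] decomposes a jump into elementary identifications, of which only the paired arcs
    give a nontrivial class. *)
Lemma surface_jumps (P : pi1 -> Prop) : P 1%g ->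
  (forall x y, P x -> P y -> P (x * y)%g) -> (forall x, P x -> P x^-1%g) ->
  (forall n, glued_arc g n -> P (crossing n)) ->
  forall u w, f u = f w -> P (jump u w).
Proof.
move=> P1 PM PV PA u w uw.
suff [] : f u = f w /\ P (jump u w) by [].
apply: (@plane_fibre R g g_gt0 (fun u w => f u = f w /\ P (jump u w)) _ _ _ _ _ _ _ u w uw) => {u w uw}.
- by move=> u; rewrite (jump_refl f_cont).
- move=> u w [uw Pu]; split=> //; rewrite (jump_sym f_cont u0 uw); exact: PV.
- move=> u w v [uw Pu] [wv Pw]; split; first by rewrite uw.
  rewrite -(jump_mul f_cont u0 uw wv); exact: PM.
- by move=> r r' t t' r0 r0'; rewrite jump_centre//; split=> //; exact: plane_centre.
- by move=> r r' t r1 r1'; rewrite jump_rim//; split=> //; exact: plane_rim.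
- by move=> r t; rewrite jump_period; split=> //; exact: plane_period.
- move=> n s ng s01; split; first exact: arc_glued.
  by rewrite jump_arc//; exact: PA.
Qed.

Definition loop_a (k : nat) : pi1 := crossing (4 * k).
(** The inverse is what makes the jumps around the corners of a block compose to a commutator. *)
Definition loop_b (k : nat) : pi1 := (crossing (4 * k + 1))^-1%g.

Lemma glued_a k : (k < g)%N -> glued_arc g (4 * k).
Proof. by rewrite /glued_arc; lia. Qed.

Lemma glued_b k : (k < g)%N -> glued_arc g (4 * k + 1).
Proof. by rewrite /glued_arc; lia. Qed.

Lemma surface_generated : generates g loop_a loop_b.
Proof.
move=> P Pg P1 PM PV; apply: (generated_by_jumps f_cont _ _ PM).
- exact: plane_surj.
- exact: plane_open.
- apply: surface_jumps => // n /andP[n4 nm].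
  have [k kg [->|->]] : exists2 k, (k < g)%N & n = (4 * k)%N \/ n = (4 * k + 1)%N.
    by exists (n %/ 4)%N; lia.
  + by have [] := Pg k kg.
  + by have [_ /PV] := Pg k kg; rewrite invgK.
move=> u; case: (charts_cover u) => Vu.
- by exists (@inner_chart R), (@inner_slide R); split=> //; exact: inner_contraction.
- by exists (rim_chart 0), (rim_slide 0); split=> //; apply: rim_contraction => //; left.
- by exists (rim_chart 2^-1), (rim_slide 2^-1); split=> //; apply: rim_contraction => //; right.
Qed.

Let V (i : nat) : R * R := (1, i%:R).

Lemma jump_corners n : glued_arc g n ->
  [/\ f (V n) = f (V (n + 3)), f (V (n + 1)) = f (V (n + 2)),
      jump (V n) (V (n + 3)) = crossing n & jump (V (n + 1)) (V (n + 2)) = crossing n].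
Proof.
move=> ng; have h0 : 0 <= (0 : R) <= 1 by rewrite lexx ler01.
have h1 : 0 <= (1 : R) <= 1 by rewrite lexx ler01.
have := arc_glued g_gt0 ng h0; have := arc_glued g_gt0 ng h1.
have := jump_arc ng h0; have := jump_arc ng h1; rewrite addr0 subr0.
rewrite (_ : n%:R + 3 - 1 = n%:R + 2); last by ring.
by rewrite /V !natrD.
Qed.

(** The letters of the [k]-th commutator jump from corner 4k to 4k + 3, 4k + 2, 4k + 1 and 4k + 4 in
    turn, so the product telescopes. *)
Lemma relator_jump k : (k <= g)%N ->
  f (V 0) = f (V (4 * k)) /\ relator k loop_a loop_b = jump (V 0) (V (4 * k)).
Proof.
elim: k => [|k IH] kg /=; first by rewrite (jump_refl f_cont).
have [E0 ->] := IH (ltnW kg).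
have [a1 a2 a3 a4] := jump_corners (glued_a kg).
have [b1 b2 b3 b4] := jump_corners (glued_b kg).
have e i : (4 * k + 1 + i = 4 * k + i.+1)%N by lia.
rewrite !e in b1 b2 b3 b4.
have -> : (4 * k.+1 = 4 * k + 4)%N by lia.
have E1 : f (V (4 * k)) = f (V (4 * k + 4)) by rewrite a1 -b2 -a2 b1.
split; first by rewrite E0.
rewrite -(jump_mul f_cont u0 E0 E1); congr (_ * _)%g.
rewrite /loop_a /loop_b invgK -{1}a3 -{1}b4 -a4 -b3.
rewrite -(jump_sym f_cont u0 b2) -(jump_sym f_cont u0 a2).
by rewrite !(jump_mul f_cont)// ?a1 -?b2 -?a2.
Qed.

Lemma surface_relator : relator g loop_a loop_b = 1%g.
Proof.
have [_ ->] := relator_jump (leqnn g).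
by have := jump_period 1 0; rewrite add0r.
Qed.

End SurfaceJumps.

(** * Holonomy and the universal property *)


Section Holonomy.
Local Open Scope classical_set_scope.
Local Open Scope ring_scope.
Local Open Scope quotient_scope.
Context (R : realType) (X : topologicalType) (G : groupType) (J : Type).
Context (U : J -> set X) (c : J -> X -> G).
Hypotheses (U_open : forall j, open (U j)) (U_cover : forall x, exists j, U j x).
Hypothesis c_const : forall j k x, U j x -> U k x ->
  \forall y \near x, (c j y * (c k y)^-1 = c j x * (c k x)^-1)%g.
Local Notation I := (unit_interval R).

Definition hol (p : I -> X) : G := transport U c (fun t => p (clamp t)) 0 1.

Lemma hol_cst x : hol (cst x) = 1%g.
Proof. by rewrite /hol (transport_const U_cover c_const)// ler01. Qed.

Lemma hol_concat x p y q z : path_between x p y -> path_between y q z ->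
  hol (concat p q) = (hol q * hol p)%g.
Proof.
move=> hp hq; have [cp p0 p1] := hp; have [cq q0 q1] := hq.
have cont (r : I -> X) : continuous r -> continuous (fun t => r (clamp t)).
  by move=> cr; exact: continuous_compose (@clamp_continuous R) cr.
have [cpq _ _] := path_concat hp hq.
have aff (a b : R) : continuous (fun t : R => a * t + b).
  by apply: continuous_affine => t; exact: cvg_id.
have h0 : 0 <= 2^-1 :> R by lra.
have h1 : 2^-1 <= 1 :> R by lra.
rewrite /hol (transport_cat U_open U_cover c_const (cont _ cpq) h0 h1).
have t01 : (0:R) <= 1 by exact: ler01.
congr (_ * _)%g.
  apply: (transport_comp U_open U_cover c_const (cont _ cq) (aff 2 (-1)) h1 t01).
  - lra.
  - lra.
  - by move=> t /andP[a b]; apply/andP; split; lra.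
  move=> t /andP[a b]; have [t2|t2|->] := ltgtP t 2^-1; [by move: a; rewrite leNgt t2| |].
    by rewrite concat_r//; apply/andP; split.
  by rewrite concat_l ?h0 ?lexx// divff// subrr -/zero -/one p1 q0.
apply: (transport_comp U_open U_cover c_const (cont _ cp) (aff 2 0) h0 t01).
- lra.
- lra.
- by move=> t /andP[a b]; apply/andP; split; lra.
by move=> t tab; rewrite concat_l// addr0.
Qed.

Lemma hol_homotopic p q : homotopic p q -> hol p = hol q.
Proof.
move=> [H [cH H0 H1 Hz Ho]]; pose h (z : R * R) := H (clamp z.1, clamp z.2).
have ch : continuous h.
  apply: continuous_compose cH; apply: continuous_pair.
    exact: continuous_compose (@continuous_fst _ _) (@clamp_continuous R).
  exact: continuous_compose (@continuous_snd _ _) (@clamp_continuous R).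
have := square_commutes U_open U_cover c_const ch.
have cst01 x : transport U c (fun=> x : X) (0 : R) 1 = 1%g.
  by rewrite (transport_const U_cover c_const)// ler01.
rewrite /commuting_square (_ : (fun s => h (1, s)) = fun=> p one); last first.
  by apply/funext => s; rewrite /h /= -/one Ho.
rewrite (_ : (fun s => h (0, s)) = fun=> p zero); last first.
  by apply/funext => s; rewrite /h /= -/zero Hz.
rewrite !cst01 mul1g mulg1 (_ : (fun t => h (t, 0)) = fun t => p (clamp t)); last first.
  by apply/funext => s; rewrite /h /= -/zero H0.
rewrite (_ : (fun t => h (t, 1)) = fun t => q (clamp t)) //.
by apply/funext => s; rewrite /h /= -/one H1.
Qed.

Lemma hol_reverse x p y : path_between x p y -> hol (reverse p) = (hol p)^-1%g.
Proof.
move=> hp; have [cp _ _] := hp; apply: (mulIg (hol p)).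
rewrite mulVg -(hol_concat hp (path_reverse hp)) (hol_homotopic (concatpV_homotopic cp)).
exact: hol_cst.
Qed.

(** Transport reverses the order of concatenation, whence the inverse. *)
Lemma hol_hom x0 : is_hom (fun x : fundamental_group R x0 => (hol (repr x))^-1%g).
Proof.
move=> x y; rewrite -invgM; congr (_^-1)%g.
rewrite -(hol_concat (loop_class_repr_id x) (loop_class_repr_id y)).
exact: hol_homotopic (pi1_repr (loop_concat (repr x) (repr y))).
Qed.

Lemma hol_class x0 p : path_between x0 p x0 -> hol (repr (loop_class x0 p)) = hol p.
Proof. by move=> hp; apply: hol_homotopic; exact: loop_class_repr. Qed.

Lemma hol_cl (f : R * R -> X) u0 u p w : continuous f -> path_between (f u) p (f w) ->
  hol (repr (cl f u0 u p w)) =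
  ((hol (f \o line u0 w))^-1 * hol p * hol (f \o line u0 u))%g.
Proof.
move=> cf hp; rewrite hol_class; last exact: tailed_path.
have hu := line_path cf u0 u; have hw := path_reverse (line_path cf u0 w).
rewrite (hol_concat hu (path_concat hp hw)) (hol_concat hp hw).
by rewrite (hol_reverse (line_path cf u0 w)).
Qed.

End Holonomy.

Section Sheets.
Local Open Scope classical_set_scope.
Local Open Scope ring_scope.
Context (R : realType) (g : nat) (g_gt0 : (0 < g)%N).
Local Notation N := ((4 * g)%:R : R).
Local Notation f := (@plane R g).
Local Notation I := (unit_interval R).
(** [lab false m] belongs to the open arc [m] and [lab true m] to the star of the corner [m];
    passing from arc [n] to its partner multiplies every label on the left by the inverse of
    [D n]. *)
Variables (G : groupType) (D : nat -> G) (lab : bool -> int -> G).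
Hypothesis lab_period : forall b m, lab b (m + (4 * g)%:Z) = lab b m.
Hypothesis lab_edge : forall n, glued_arc g n ->
  lab false (n + 2)%N = ((D n)^-1 * lab false n)%g.
Hypothesis lab_start : forall n, glued_arc g n ->
  lab true (n + 3)%N = ((D n)^-1 * lab true n)%g.
Hypothesis lab_end : forall n, glued_arc g n ->
  lab true (n + 2)%N = ((D n)^-1 * lab true (n + 1)%N)%g.

Let offset (b : bool) : R := if b then 2^-1 else 0.

Let offsetP b : offset b = 0 \/ offset b = 2^-1.
Proof. by case: b; [right|left]. Qed.

Definition chart_domain (j : option bool) : set (R * R) :=
  if j is Some b then rim_chart (offset b) else @inner_chart R.

Definition sheet (j : option bool) (u : R * R) : G :=
  if j is Some b then lab b (Num.floor (u.2 + offset b)) else 1%g.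

Lemma sheet_near j u : chart_domain j u ->
  \forall w \near u, chart_domain j w /\ sheet j w = sheet j u.
Proof.
case: j => [b|] /=; last first.
  move=> u1; have [oV _ _ _ _] := @inner_contraction R g g_gt0.
  have nV : nbhs u (@inner_chart R) by exact: open_nbhs_nbhs.
  by apply: filterS nV.
move=> [u1 u2]; have n1 : \forall w \near u, 0 < w.1.
  exact: (@continuous_fst R R u _ (lt_nbhsr u1)).
have cd : continuous (fun w : R * R => w.2 + offset b).
  by move=> w; apply: cvgD; [exact: continuous_snd|exact: cvg_cst].
have n2 := cd u _ (near_floor u2).
by apply: filterS2 n1 n2 => w w1 [w2 w3]; rewrite w2.
Qed.

(** Changing the lift multiplies all sheets by a common left factor, so their quotients descend to
    transition functions on the surface. *)
Lemma sheet_fibre u w : f u = f w ->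
  (forall j, chart_domain j u <-> chart_domain j w) /\
  exists z, forall j, chart_domain j u -> sheet j w = (z * sheet j u)%g.
Proof.
apply: (@plane_fibre R g g_gt0 (fun u w =>
  (forall j, chart_domain j u <-> chart_domain j w) /\
  exists z, forall j, chart_domain j u -> sheet j w = (z * sheet j u)%g)).
- by move=> {}u; split=> //; exists 1%g => j _; rewrite mul1g.
- move=> {}u v [H [z Hz]]; split=> [j|]; first by split=> /H.
  by exists z^-1%g => j /H /Hz ->; rewrite mulKg.
- move=> {}u v {}w [H [z Hz]] [H' [z' Hz']]; split=> [j|].
    by split=> [/H/H'|/H'/H].
  by exists (z' * z)%g => j uj; rewrite (Hz' _ (iffLR (H j) uj)) Hz// mulgA.
- move=> r r' t t' r0 r0'; split.
    by case=> [b|] /=; [split=> -[] /=|rewrite /inner_chart /=]; lra.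
  exists 1%g => -[b|] /=; last by rewrite mul1g.
  by case=> /= rp; move: r0; rewrite leNgt rp.
- move=> r r' t r1 r1'; split.
    case=> [b|] /=; last by rewrite /inner_chart /=; lra.
    by split=> -[/= _ F]; split=> //=; lra.
  by exists 1%g => -[b|] /= _; rewrite mul1g.
- move=> r t; split.
    case=> [b|] //=; rewrite /rim_chart /= floor_period intrD -pmulrn.
    by rewrite addrAC ltrD2r.
  by exists 1%g => -[b|] /= _; rewrite mul1g// floor_period lab_period.
- move=> n s ng s01; split.
    case=> [b|] /=; last by rewrite /inner_chart /=; lra.
    split=> -[/= _ F]; split=> //=.
      by have [c _ [_ []]] := rim_arc (offsetP b) s01 F.
    exact (rim_arc' (offsetP b) s01 F).
  exists (D n)^-1%g => -[b|] /=; last by rewrite /inner_chart /= ltxx.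
  move=> [/= _ F]; have [c /andP[c0 c1] [E1 [E2 _]]] := rim_arc (offsetP b) s01 F.
  move: E1 E2; rewrite /rim_centre.
  set i := Num.floor _; set k := Num.floor _; case: b @i @k {F} => i k /= E1 E2.
    have sum : i + k = n%:Z + n%:Z + 3.
      by apply: (@intr_inj R); rewrite !intrD -!pmulrn; lra.
    have lo : n%:Z <= i by rewrite -(ler_int R) -pmulrn; lra.
    have hi : i <= n%:Z + 1 by rewrite -(ler_int R) intrD -pmulrn; lra.
    have : i = n%:Z /\ k = (n + 3)%N \/ i = (n + 1)%N /\ k = (n + 2)%N by lia.
    by case=> -[-> ->]; [exact: lab_start|exact: lab_end].
  have sum : i + k = n%:Z + n%:Z + 2.
    by apply: (@intr_inj R); rewrite !intrD -!pmulrn; lra.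
  have lo : n%:Z - 1 < i by rewrite -(ltr_int R) intrB -pmulrn; lra.
  have hi : i < n%:Z + 1 by rewrite -(ltr_int R) intrD -pmulrn; lra.
  have [-> ->] : i = n%:Z /\ k = (n + 2)%N by lia.
  exact: lab_edge.
Qed.

Section Bundle.
Variable u0 : R * R.
Let f_surj := @plane_surj R g g_gt0.
Let f_cont := @plane_continuous R g.
Local Notation pi1 := (fundamental_group R (f u0)).
Let U j : set (closed_surface R g) := [set x | chart_domain j (lift f_surj x)].
Let c j (x : closed_surface R g) : G := ((sheet j (lift f_surj x))^-1)%g.

Let UE j u : U j (f u) <-> chart_domain j u.
Proof.
have [H _] := @sheet_fibre (lift f_surj (f u)) u (liftE f_surj (f u)).
exact: H.
Qed.

Let U_open j : open (U j).
Proof.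
apply: (plane_open g_gt0); rewrite openE => u /UE Vu.
by apply: filterS (sheet_near Vu) => w [/UE].
Qed.

Let U_cover x : exists j, U j x.
Proof.
have [u <-] := f_surj x; case: (charts_cover u) => Vu.
- by exists None; apply/UE.
- by exists (Some false); apply/UE.
- by exists (Some true); apply/UE.
Qed.

(* Compares u with the chosen lift of the same point of the surface. *)
Definition gauge (u : R * R) : G :=
  projT1 (cid (@sheet_fibre u (lift f_surj (f u)) (esym (liftE f_surj (f u)))).2).

Let gaugeE u j : chart_domain j u -> c j (f u) = ((gauge u * sheet j u)^-1)%g.
Proof. by rewrite /c /gauge; case: cid => z /= H uj; rewrite H. Qed.

Let c_const j k x : U j x -> U k x ->
  \forall y \near x, (c j y * (c k y)^-1 = c j x * (c k x)^-1)%g.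
Proof.
have [u <-] := f_surj x => /UE uj /UE uk.
pose W := [set y | [/\ U j y, U k y &
  (c j y * (c k y)^-1 = c j (f u) * (c k (f u))^-1)%g]].
have tE w : chart_domain j w -> chart_domain k w ->
    (c j (f w) * (c k (f w))^-1 = (sheet j w)^-1 * sheet k w)%g.
  by move=> wj wk; rewrite !gaugeE// invgK invgM mulgA mulgKV.
have oW : open W.
  apply: (plane_open g_gt0); rewrite openE => w [/UE wj /UE wk E].
  apply: filterS2 (sheet_near wj) (sheet_near wk) => w' [vj ej] [vk ek].
  split; [exact/UE|exact/UE|].
  by rewrite -E !tE// ej ek.
have Wu : W (f u) by split=> //; exact/UE.
by apply: filterS (open_nbhs_nbhs (conj oW Wu)) => y [].
Qed.

Local Notation hol := (hol U c).

(** The gauge is a flat section along a path that lifts to the plane. *)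
Let hol_plane (a : I -> R * R) : continuous a ->
  hol (f \o a) = (gauge (a one) * (gauge (a zero))^-1)%g.
Proof.
move=> ca; have ca' : continuous (fun t => a (clamp t)).
  exact: continuous_compose (@clamp_continuous R) ca.
apply: (@transportE _ _ _ _ _ _ U_cover _ (fun t => gauge (a (clamp t)))) => //.
move=> t _ j /UE aj.
have [e e0 He] := near_dist (ca' t _ (sheet_near aj)).
exists e => // s _ /He[sj se]; rewrite /= !gaugeE//.
by rewrite se !invgM !mulgKV.
Qed.

Definition sheet_hom (x : pi1) : G := ((gauge u0)^-1 * (hol (repr x))^-1 * gauge u0)%g.

Lemma sheet_hom_hom : is_hom sheet_hom.
Proof.
move=> x y; rewrite /sheet_hom (hol_hom U_open U_cover c_const x y).
by rewrite !mulgA mulgK.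
Qed.

(** Along the tails the holonomy is a quotient of gauges, and at the midpoint of the arc the gauges
    of the two lifts differ by [D n]. *)
Lemma sheet_hom_crossing n : glued_arc g n -> sheet_hom (crossing g u0 n) = D n.
Proof.
move=> ng; have h2 : 0 <= (2^-1 : R) <= 1 by apply/andP; split; lra.
have E := arc_glued g_gt0 ng h2.
rewrite /sheet_hom /crossing /jump (hol_cl U_open U_cover c_const u0 f_cont (jump_path E)).
rewrite (hol_cst R U_cover c_const) mulg1 !hol_plane ?line0 ?line1;
  do ?exact: line_cont.
set u := (1, n%:R + 2^-1); set w := (1, _ - _).
have hj (m : nat) : m%:R < m%:R + (2^-1 : R) < m%:R + 1 by apply/andP; split; lra.
have F (m : nat) : chart_domain (Some false) (1, m%:R + 2^-1) /\
    sheet (Some false) (1, m%:R + 2^-1) = lab false m.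
  rewrite /= /rim_chart /= addr0; have := hj m; rewrite !pmulrn => /floor_between[].
  by rewrite -pmulrn => {3}-> fm; split.
have wE : w = (1, (n + 2)%:R + 2^-1) by rewrite /w natrD; congr (_, _); lra.
have [uj su] := F n; have [wj sw] := F (n + 2)%N; rewrite -wE in wj sw.
have := gaugeE uj; rewrite E -/w (gaugeE wj) su sw lab_edge// => /invg_inj H.
have {}H : gauge u = (gauge w * (D n)^-1)%g.
  by apply: (mulIg (lab false n)); rewrite -H mulgA.
by rewrite H !invgM !invgK !mulgA !(mulgK, mulgKV) mulVg mul1g.
Qed.

End Bundle.
End Sheets.

Section Labels.
Local Open Scope group_scope.
Variables (G : groupType) (g : nat) (x y : nat -> G).

(** The inverse appears because [loop_b] is the inverse of a crossing. *)
Definition side_label (n : nat) : G :=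
  if n %% 4 == 0 then x (n %/ 4) else (y (n %/ 4))^-1.

(* Solves the gluing equations corner after corner around the polygon: after one
   turn, the value is multiplied by the inverse of the relator. *)
Definition corner_label (n : nat) : G :=
  let k := (n %/ 4)%N in let q := (relator k x y)^-1 in
  match (n %% 4)%N with
  | 0 => q
  | 1 => x k * (y k)^-1 * (x k)^-1 * q
  | 2 => (y k)^-1 * (x k)^-1 * q
  | _ => (x k)^-1 * q
  end.

(** Arcs are normalised to 1 on the partner side, which solves the edge equation; reducing modulo 4g
    gives the period. *)
Definition sheet_label (b : bool) (m : int) : G :=
  let n := `|(m %% (4 * g)%:Z)%Z|%N in
  if b then corner_label n else if (n %% 4 < 2)%N then side_label n else 1.

Lemma sheet_label_period b m : sheet_label b (m + (4 * g)%:Z)%R = sheet_label b m.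
Proof. by rewrite /sheet_label modzDr. Qed.

Lemma sheet_label_small b (n : nat) : (n < 4 * g)%N -> sheet_label b n =
  if b then corner_label n else if (n %% 4 < 2)%N then side_label n else 1.
Proof. by move=> ng; rewrite /sheet_label modz_nat modn_small. Qed.

Lemma mod4E k i : (i < 4)%N -> ((4 * k + i) %/ 4 = k)%N /\ ((4 * k + i) %% 4 = i)%N.
Proof. by move=> i4; lia. Qed.

Lemma side_labelE k : side_label (4 * k) = x k /\ side_label (4 * k + 1) = (y k)^-1.
Proof.
have [d1 m1] := @mod4E k 1 isT.
by rewrite /side_label mulKn// modnMr /= d1 m1.
Qed.

Lemma corner_labelE k : let q := (relator k x y)^-1 in
  [/\ corner_label (4 * k) = q,
      corner_label (4 * k + 1) = x k * (y k)^-1 * (x k)^-1 * q,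
      corner_label (4 * k + 2) = (y k)^-1 * (x k)^-1 * q &
      corner_label (4 * k + 3) = (x k)^-1 * q].
Proof.
have [d1 m1] := @mod4E k 1 isT; have [d2 m2] := @mod4E k 2 isT.
have [d3 m3] := @mod4E k 3 isT.
by rewrite /corner_label mulKn// modnMr d1 m1 d2 m2 d3 m3.
Qed.

Lemma sheet_label_edge n : glued_arc g n ->
  sheet_label false (n + 2)%N = (side_label n)^-1 * sheet_label false n.
Proof.
move=> /andP[ng nm]; rewrite !sheet_label_small ?nm ?mulVg; [|lia..].
by rewrite ifF//; lia.
Qed.

Hypothesis xy1 : relator g x y = 1.

(** The corner 4g is the corner 0, and their labels agree exactly because the relator is 1. *)
Lemma sheet_label_corner (n : nat) : (n <= 4 * g)%N ->
  sheet_label true n = corner_label n.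
Proof.
rewrite leq_eqVlt => /orP[/eqP->|/(sheet_label_small true)//].
rewrite /sheet_label modz_nat modnn /corner_label /= mulKn// modnMr /= xy1.
by rewrite invg1.
Qed.

Lemma sheet_label_start n : glued_arc g n ->
  sheet_label true (n + 3)%N = (side_label n)^-1 * sheet_label true n /\
  sheet_label true (n + 2)%N = (side_label n)^-1 * sheet_label true (n + 1)%N.
Proof.
move=> /andP[ng nm]; rewrite !sheet_label_corner; [|lia..].
have [k E] : exists k, n = (4 * k)%N \/ n = (4 * k + 1)%N.
  by exists (n %/ 4)%N; lia.
have [c0 c1 c2 c3] := corner_labelE k; have [s0 s1] := side_labelE k.
case: E => ->; first by rewrite s0 c0 c1 c2 c3 -!mulgA mulKg.
have e i : (4 * k + 1 + i = 4 * k + i.+1)%N by lia.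
rewrite !e s1 c1 c2 c3 (_ : (4 * k + 4 = 4 * k.+1)%N); last by lia.
have [-> _ _ _] := corner_labelE k.+1.
by rewrite /= !invgM !invgK !mulgA mulgV mul1g.
Qed.

End Labels.

Section Presentation.
Local Open Scope classical_set_scope.
Local Open Scope ring_scope.
Context (R : realType) (g : nat) (g_gt0 : (0 < g)%N).

Lemma surface_presentation (x0 : closed_surface R g) :
  exists a b : nat -> fundamental_group R x0, presents g a b.
Proof.
have [u0 <-] := plane_surj g_gt0 x0.
exists (loop_a g u0), (loop_b g u0); split.
- exact: surface_relator.
- exact: surface_generated.
move=> G x y xy1.
have lp := @sheet_label_period G g x y.
have le := @sheet_label_edge G g x y.
have ls n ng := (@sheet_label_start G g x y xy1 n ng).1.
have lf n ng := (@sheet_label_start G g x y xy1 n ng).2.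
exists (sheet_hom g_gt0 lp le ls lf (u0 := u0)); split; first exact: sheet_hom_hom.
move=> k kg; have h := @sheet_hom_crossing R g g_gt0 G _ _ lp le ls lf u0.
have hV := homV (sheet_hom_hom g_gt0 lp le ls lf (u0 := u0)).
have [s0 s1] := side_labelE x y k; split; first by rewrite /loop_a h ?glued_a.
by rewrite /loop_b hV h ?glued_b// s1 invgK.
Qed.

End Presentation.

Local Open Scope classical_set_scope.
Local Open Scope ring_scope.

Theorem theorem7 (R : realType) (g : nat) (g_ge2 : (2 <= g)%N)
    (x0 : closed_surface R g)
    (Q : finGroupType) (solQ : solvable [set: Q]%SET) (oddQ : odd #|[set: Q]%SET|)
    (theta : {multiplicative fundamental_group R x0 -> Q})
    (theta_surj : forall q : Q, exists x, theta x = q) :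
  exists (d : nat) (rho : fundamental_group R x0 -> 'M[int]_d),
    [/\ (1 <= d)%N,
        forall x, rho x \in unitmx,
        forall x y, rho (x * y)%g = rho x *m rho y,
        infinite_set (range rho) &
        forall x, theta x <> 1%g ->
          exists n : nat, (0 < n)%N /\ rho x ^+ n = 1%:M].
Proof.
have [a [b pres]] := surface_presentation (ltnW g_ge2) x0.
exact: (torsion_off_kernel pres g_ge2 (@gmulfM _ _ theta) theta_surj).
Qed.
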